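(* Let $\phi\in L^{2}(\mathbb{R}^{2n})$. Then there exists a canonical biorthogonal function $\tilde{\phi}$ to $\phi$ with $\tilde{\phi}\in V^{t}(\phi)$ (that is, $\tilde\phi\in V^{t}(\phi)$ with $\langle T^{t}_{(k,l)}\phi,\tilde{\phi}\rangle_{L^{2}(\mathbb{R}^{2n})}=\delta_{(k,l),(0,0)}$ for all $k,l\in\mathbb{Z}^{n}$) if and only if $\frac{1}{[\phi,\phi]}\in L^{1}(\mathbb{T}^{n}\times\mathbb{T}^{n})$.
   Context: Notation: $\mathbb{T}^{n}$ is identified with $[0,1)^{n}$ with Lebesgue measure; $1/[\phi,\phi]$ is taken to be $+\infty$ where $[\phi,\phi]=0$. Twisted translation: for $\phi\in L^{2}(\mathbb{R}^{2n})$ and $(k,l)\in\mathbb{Z}^{n}\times\mathbb{Z}^{n}$, $T^{t}_{(k,l)}\phi(x,y)=e^{\pi i(x\cdot l-y\cdot k)}\phi(x-k,y-l)$ for $(x,y)\in\mathbb{R}^{n}\times\mathbb{R}^{n}$. The principal twisted shift-invariant space is $V^{t}(\phi)=\overline{\operatorname{span}}\{T^{t}_{(k,l)}\phi : k,l\in\mathbb{Z}^{n}\}$. Weyl kernel: for $\phi\in L^{1}\cap L^{2}(\mathbb{R}^{2n})$, $K_{\phi}(\xi,\eta)=\int_{\mathbb{R}^{n}}\phi(x,\eta-\xi)e^{\pi i x\cdot(\xi+\eta)}\,dx$, $\xi,\eta\in\mathbb{R}^{n}$ (the integral kernel of the Weyl transform of $\phi$). The map $\phi\mapsto K_{\phi}$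 is isometric for the $L^{2}(\mathbb{R}^{2n})$ norm and is extended by density to all of $L^{2}(\mathbb{R}^{2n})$. Weyl-Zak transform: $Z_{W}:L^{2}(\mathbb{R}^{2n})\to L^{2}(\mathbb{T}^{n}\times\mathbb{T}^{n}\times\mathbb{R}^{n})$, $Z_{W}\phi(\xi,\xi',\eta)=\sum_{m\in\mathbb{Z}^{n}}K_{\phi}(m+\xi,\eta)e^{-2\pi i m\cdot\xi'}$. Bracket: for $\phi,\psi\in L^{2}(\mathbb{R}^{2n})$, $[\phi,\psi](\xi,\xi')=\int_{\mathbb{R}^{n}}Z_{W}\phi(\xi,\xi',\eta)\overline{Z_{W}\psi(\xi,\xi',\eta)}\,d\eta$ for a.e. $(\xi,\xi')\in\mathbb{T}^{n}\times\mathbb{T}^{n}$. *)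

(* Defs.v *)
From HB Require Import structures.
From mathcomp Require Import all_boot all_order all_algebra.
From mathcomp Require Import finmap complex.
From mathcomp Require Import all_classical all_reals all_analysis summability.

Set Implicit Arguments.
Unset Strict Implicit.
Unset Printing Implicit Defensive.

Import Order.TTheory GRing.Theory Num.Theory.
Import numFieldNormedType.Exports.

Local Open Scope classical_set_scope.
Local Open Scope ring_scope.

Notation Rn R n := (n.-tuple (measurableTypeR R)).
Notation R2n R n := (Rn R n * Rn R n)%type.
Notation R3n R n := (Rn R n * Rn R n * Rn R n)%type.
Notation Zn n := 'rV[int]_n.

Section LebesgueMeasureRn.
Local Open Scope ereal_scope.
Context {R : realType}.

Definition rn_cons n (p : measurableTypeR R * Rn R n) : Rn R n.+1 :=
  [tuple of p.1 :: p.2].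

Lemma measurable_rn_cons n : measurable_fun [set: _] (@rn_cons n).
Proof. exact: measurable_cons. Qed.

Section Step.
Variables (n : nat) (mu : {sigma_finite_measure set (Rn R n) -> \bar R}).

Definition leb_cons : set (Rn R n.+1) -> \bar R :=
  pushforward (lebesgue_measure \x mu) (@rn_cons n).

Let leb_cons_measure : {measure set (Rn R n.+1) -> \bar R} :=
  measure_function_pushforward__canonical__measure_function_Measure
    (lebesgue_measure \x mu) (@measurable_rn_cons n).

HB.instance Definition _ := isMeasure.Build _ _ _ leb_cons
  (measure0 leb_cons_measure) (measure_ge0 leb_cons_measure)
  (@measure_semi_sigma_additive _ _ _ leb_cons_measure).

Let leb_cons_sigma_finite : sigma_finite setT leb_cons.
Proof.
have /sigma_finiteP[F [TF ndF Foo]] := sigma_finiteT (@lebesgue_measure R).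
have /sigma_finiteP[G [TG ndG Goo]] := sigma_finiteT mu.
pose uncons (t : Rn R n.+1) : measurableTypeR R * Rn R n :=
  (thead t, [tuple of behead t]).
have muncons : measurable_fun [set: Rn R n.+1] uncons.
  apply/measurable_fun_pairP; split; first exact: measurable_tnth.
  exact: measurable_behead.
exists (fun k => uncons @^-1` (F k `*` G k)).
  apply/esym/seteqP; split=> // t _.
  have [i _ Fi] : (\bigcup_i F i) (thead t) by rewrite -TF.
  have [j _ Gj] : (\bigcup_i G i) [tuple of behead t] by rewrite -TG.
  exists (maxn i j) => //; split => /=.
    by move: Fi; apply/subsetPset/ndF/leq_maxl.
  by move: Gj; apply/subsetPset/ndG/leq_maxr.
move=> k; have [mF Fk] := Foo k; have [mG Gk] := Goo k; split.
  by rewrite -[X in measurable X]setTI; apply: muncons => //; exact: measurableX.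
rewrite /leb_cons /pushforward (_ : _ @^-1` _ = F k `*` G k).
  by rewrite product_measure1E// lte_mul_pinfty// ge0_fin_numE.
apply/seteqP; split=> -[x y] [/= Fx Gy]; split=> //=.
  by rewrite (_ : y = [tuple of behead (rn_cons (x, y))])//; apply: val_inj.
by rewrite (_ : [tuple of _] = y)//; apply: val_inj.
Qed.

HB.instance Definition _ := @Measure_isSigmaFinite.Build _ _ _
  leb_cons leb_cons_sigma_finite.

End Step.

(* Lebesgue measure on R^n (Borel sets): the product of n copies of the
   one-dimensional Lebesgue measure; on R^0 it is the unit mass at the point *)
Fixpoint leb n : {sigma_finite_measure set (Rn R n) -> \bar R} :=
  if n is m.+1 then leb_cons (leb m) else \d_[tuple].

Lemma leb_box n (A : 'I_n -> set (measurableTypeR R)) :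
  (forall i, measurable (A i)) ->
  leb n [set x | forall i, A i (tnth x i)] =
  \prod_(i < n) lebesgue_measure (A i).
Proof.
elim: n A => [|n IH] A mA.
  rewrite big_ord0 /= diracE mem_set// => -[].
  by case.
rewrite big_ord_recl -IH => [|i]; last exact: mA.
have mA' : measurable
    [set x : Rn R n | forall i, A (lift ord0 i) (tnth x i)].
  rewrite (_ : [set _ | _] = \bigcap_(i in [set: 'I_n])
      ((fun x => tnth x i) @^-1` A (lift ord0 i))); last first.
    by apply/seteqP; split=> [x Ax i _|x Ax i]; [exact: Ax|exact: (Ax i)].
  apply: fin_bigcap_measurable => //= i _; rewrite -[X in measurable X]setTI.
  exact: measurable_tnth.
rewrite /= /leb_cons /pushforward -product_measure1E//.
congr (_ _); apply/seteqP; split=> -[x y] /=.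
  move=> Axy; split; first by have := Axy ord0.
  by move=> i; have := Axy (lift ord0 i); rewrite tnthS.
by move=> [Ax Ay] i; case: (unliftP ord0 i) => [j|] ->//; rewrite tnthS.
Qed.

End LebesgueMeasureRn.

Section ComplexFunctions.
Local Open Scope complex_scope.
Context d (T : measurableType d) {R : realType}.
Variable mu : {measure set T -> \bar R}.
Implicit Types (D : set T) (f g : T -> R[i]).

Definition cmeasurable_fun D f :=
  measurable_fun D (fun x => complex.Re (f x)) /\
  measurable_fun D (fun x => complex.Im (f x)).

(* meaningful when f is integrable; each component is 0 by convention when its
   integral is infinite *)
Definition cintegral D f : R[i] :=
  (\int[mu]_(x in D) complex.Re (f x)) +i* (\int[mu]_(x in D) complex.Im (f x)).

Definition inL1 D f :=
  cmeasurable_fun D f /\ (\int[mu]_(x in D) (Normc.normc (f x))%:E < +oo)%E.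

Definition L2sqnorm D f : \bar R :=
  (\int[mu]_(x in D) (Normc.normc (f x) ^+ 2)%:E)%E.

(* Elements of L^2(D) are represented by functions; no quotient by a.e.
   equality is taken, and the values outside D are irrelevant *)
Definition inL2 D f := cmeasurable_fun D f /\ (L2sqnorm D f < +oo)%E.

Definition L2dot D f g : R[i] := cintegral D (fun x => f x * (g x)^* ).

Definition L2converges D {J : Type} (F : set_system J) (f_ : J -> T -> R[i]) f :=
  (fun j => L2sqnorm D (fun x => f_ j x - f x)) @ F --> 0%E.

Definition cspan {J : Type} (e : J -> T -> R[i]) : set (T -> R[i]) :=
  [set g | exists s : seq (R[i] * J),
     g = fun x => \sum_(p <- s) p.1 * e p.2 x].

Definition L2closure D (S : set (T -> R[i])) : set (T -> R[i]) :=
  [set f | inL2 D f /\ forall eps : R, 0 < eps -> exists2 g, S g &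
     (L2sqnorm D (fun x => (f x - g x)%R) < eps%:E)%E].

End ComplexFunctions.

Section WeylZak.
Local Open Scope complex_scope.
Context {R : realType} {n : nat}.
Implicit Types (x y xi eta : Rn R n) (k l m : Zn n) (phi psi : R2n R n -> R[i]).

Definition rdot x y : R := \sum_(i < n) tnth x i * tnth y i.
Definition radd x y : Rn R n := [tuple tnth x i + tnth y i | i < n].
Definition rsub x y : Rn R n := [tuple tnth x i - tnth y i | i < n].
Definition Zn_to_Rn k : Rn R n := [tuple (k 0 i)%:~R | i < n].

Definition expi (t : R) : R[i] := cos t +i* sin t.

Definition leb2 : {measure set (R2n R n) -> \bar R} :=
  (@leb R n \x @leb R n)%E.
Definition leb3 : {measure set (R3n R n) -> \bar R} := (leb2 \x @leb R n)%E.

(* the fundamental domain [0,1)^n of T^n *)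
Definition cube : set (Rn R n) := [set x | forall i, 0 <= tnth x i < 1].

Definition twisted_translation k l phi : R2n R n -> R[i] := fun p =>
  expi (pi * (rdot p.1 (Zn_to_Rn l) - rdot p.2 (Zn_to_Rn k))) *
  phi (rsub p.1 (Zn_to_Rn k), rsub p.2 (Zn_to_Rn l)).

Definition twisted_shift_invariant_space phi : set (R2n R n -> R[i]) :=
  L2closure leb2 setT
    (cspan (fun kl : Zn n * Zn n => twisted_translation kl.1 kl.2 phi)).

Definition biorthogonal phi psi := forall k l,
  L2dot leb2 setT (twisted_translation k l phi) psi = ((k, l) == (0, 0))%:R.

Definition weyl_kernel_L1L2 phi : R2n R n -> R[i] := fun p =>
  cintegral (leb n) setT
    (fun x => phi (x, rsub p.2 p.1) * expi (pi * rdot x (radd p.1 p.2))).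

(* K is (a representative of) the value at phi of the extension by density of
   weyl_kernel_L1L2 to L^2 *)
Definition is_weyl_kernel phi (K : R2n R n -> R[i]) :=
  inL2 leb2 setT K /\
  exists phi_ : nat -> R2n R n -> R[i],
    [/\ forall j, inL1 leb2 setT (phi_ j) /\ inL2 leb2 setT (phi_ j),
        L2converges leb2 setT \oo phi_ phi &
        L2converges leb2 setT \oo (fun j => weyl_kernel_L1L2 (phi_ j)) K].

(* The representative is unique up to a.e. equality; the choice among
   representatives is immaterial below, and likewise for weyl_zak *)
Definition weyl_kernel phi : R2n R n -> R[i] :=
  xget (fun=> 0) [set K | is_weyl_kernel phi K].

Definition weyl_zak_term phi m (q : R3n R n) : R[i] :=
  let: (xi, xi', eta) := q in
  weyl_kernel phi (radd (Zn_to_Rn m) xi, eta) *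
  expi (- (2 * pi * rdot (Zn_to_Rn m) xi')).

(* The series over Z^n converges unconditionally in L^2(T^n x T^n x R^n), i.e.
   along the directed set of finite subsets of Z^n *)
Definition is_weyl_zak phi (Z : R3n R n -> R[i]) :=
  inL2 leb3 (cube `*` cube `*` setT) Z /\
  L2converges leb3 (cube `*` cube `*` setT) totally
    (fun (F : {fset Zn n}) q => \sum_(m <- F) weyl_zak_term phi m q) Z.

Definition weyl_zak phi : R3n R n -> R[i] :=
  xget (fun=> 0) [set Z | is_weyl_zak phi Z].

Definition bracket phi psi : R2n R n -> R[i] := fun q =>
  L2dot (leb n) setT (fun eta => weyl_zak phi (q, eta))
                     (fun eta => weyl_zak psi (q, eta)).

(* [phi, phi] is real and nonnegative; the inverse of \bar R sends 0 to +oo *)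
Definition inv_bracket phi : R2n R n -> \bar R := fun q =>
  ((complex.Re (bracket phi phi q))%:E^-1)%E.

End WeylZak.

(* Main.v *)
(* Write w = [phi, phi] and E_(k,l)(x, x') = e^(2 pi i (k.x + l.x')). After
   the shear (xi, eta) = (xi, xi + y) the Weyl kernel becomes a Fourier
   transform in one variable, hence an isometry by Plancherel; the Zak
   transform is an isometry by Parseval on the cube. Together they turn the
   twisted translation T_(k,l) into multiplication by (-1)^(k.l) E_(k,l), so
   for every finite family of coefficients c
     || sum c_(k,l) T_(k,l) phi ||^2 =
       int |sum (-1)^(k.l) c_(k,l) E_(k,l)|^2 w.
   Minimizing the left-hand side over the families with c_(0,0) = 1 shows
   that a biorthogonal function exists iff c |-> c_(0,0) is bounded for this
   norm, i.e. iff |int p| <= C ||p||_(L^2(w)) for all trigonometric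
   polynomials p. When 1/w is integrable this is the Cauchy-Schwarz
   inequality. Conversely, the inequality extends by density to all bounded
   measurable p; p = 1/(w + eps) gives int 1/(w + eps) <= C^2, and eps -> 0
   concludes by monotone convergence. *)
Require Import Defs.
From HB Require Import structures.
From mathcomp Require Import all_boot all_order all_algebra.
From mathcomp Require Import finmap complex.
From mathcomp Require Import all_classical all_reals all_analysis summability.
From mathcomp Require Import measurable_realfun.
From mathcomp Require Import ring lra.

Import Order.TTheory GRing.Theory Num.Theory.
Import numFieldNormedType.Exports HBNNSimple.

Local Open Scope classical_set_scope.
Local Open Scope ring_scope.

Set Implicit Arguments.
Unset Strict Implicit.
Unset Printing Implicit Defensive.

(** Elements of L^2 are functions, not classes, and [weyl_kernel phi] and [weyl_zak phi] are chosen
    by [xget], so neither is literally linear in [phi]. The choices made for different functions are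
    therefore never compared. The relations [is_weyl_kernel] and [is_zak] are shown to be stable
    under linear combinations and under twisted translations, and all representatives of one object
    have the same norm; completeness shows that representatives exist, so that the choices are
    meaningful. Only norms cross from the plane to the torus; inner products are used on one side at
    a time.

    The other obstacle is density: w is merely integrable and may vanish, so trigonometric
    polynomials must be dense in L^2(w) without any regularity of w. The sets whose indicator can be
    approximated form a sigma-algebra, and the arcs that generate it are reached through polynomials
    in a single trigonometric polynomial, in the manner of the elementary proofs of
    Stone-Weierstrass. The same density for constant weight yields Parseval, and Parseval yields
    Plancherel. *)

Notation Re := complex.Re.
Notation Im := complex.Im.
Notation normc := Normc.normc.

(** * Complex numbers *)

Section ComplexNumbers.
Local Open Scope complex_scope.
Context {R : realType}.
Implicit Types z u : R[i].

Lemma normc_sqE z : normc z ^+ 2 = Re z ^+ 2 + Im z ^+ 2.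
Proof. by case: z => a b /=; rewrite sqr_sqrtr// addr_ge0// sqr_ge0. Qed.

Lemma normc_ge0 z : 0 <= normc z.
Proof. by case: z => a b /=; exact: sqrtr_ge0. Qed.

Lemma ReM z u : Re (z * u) = Re z * Re u - Im z * Im u.
Proof. by case: z => a b; case: u. Qed.

Lemma ImM z u : Im (z * u) = Re z * Im u + Im z * Re u.
Proof. by case: z => a b; case: u. Qed.

Lemma ReD z u : Re (z + u) = Re z + Re u.
Proof. by case: z => a b; case: u. Qed.

Lemma ImD z u : Im (z + u) = Im z + Im u.
Proof. by case: z => a b; case: u. Qed.

Lemma ReN z : Re (- z) = - Re z. Proof. by case: z. Qed.

Lemma ImN z : Im (- z) = - Im z. Proof. by case: z. Qed.

Lemma Re_conj z : Re z^* = Re z. Proof. by case: z. Qed.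

Lemma Im_conj z : Im z^* = - Im z. Proof. by case: z. Qed.

Definition ReImE := (ReM, ImM, ReD, ImD, ReN, ImN, Re_conj, Im_conj).

Lemma complex_ext z u : Re z = Re u -> Im z = Im u -> z = u.
Proof. by case: z => a b; case: u => c d /= -> ->. Qed.

Lemma normc_conj z : normc z^* = normc z.
Proof. by case: z => a b /=; rewrite sqrrN. Qed.

Lemma normc_real (a : R) : normc a%:C = `|a|.
Proof. by rewrite /= expr0n addr0 sqrtr_sqr. Qed.

Lemma normc_opp z : normc (- z) = normc z.
Proof. by case: z => a b /=; rewrite !sqrrN. Qed.

Lemma normc_triangle z u : normc (z + u) <= normc z + normc u.
Proof. exact: le_normcD. Qed.

Lemma mul_conjc z : z * z^* = (normc z ^+ 2)%:C.
Proof. by apply: complex_ext; rewrite !ReImE /= ?normc_sqE; lra. Qed.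

Lemma normRe_le z : `|Re z| <= normc z.
Proof.
rewrite -(ler_pXn2r (n:=2)) ?nnegrE ?normc_ge0//.
by rewrite real_normK ?num_real// normc_sqE lerDl sqr_ge0.
Qed.

Lemma normIm_le z : `|Im z| <= normc z.
Proof.
rewrite -(ler_pXn2r (n:=2)) ?nnegrE ?normc_ge0//.
by rewrite real_normK ?num_real// normc_sqE lerDr sqr_ge0.
Qed.

Lemma normc_le_ReIm z : normc z <= `|Re z| + `|Im z|.
Proof.
rewrite -(ler_pXn2r (n:=2)) ?nnegrE ?normc_ge0 ?addr_ge0//.
rewrite sqrrD !real_normK ?num_real// normc_sqE.
have := mulr_ge0 (normr_ge0 (Re z)) (normr_ge0 (Im z)); lra.
Qed.

(** On each component the two sides differ by (t a - b)^2 / t. The parameter t is left free so that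
    integrating and then optimizing over t gives the triangle inequality in L^2. *)
Lemma normc_sqD_le t z u : 0 < t ->
  normc (z + u) ^+ 2 <= (1 + t) * normc z ^+ 2 + (1 + t^-1) * normc u ^+ 2.
Proof.
move=> t0; rewrite !normc_sqE !ReImE.
have aux (a b : R) : (a + b) ^+ 2 <= (1 + t) * a ^+ 2 + (1 + t^-1) * b ^+ 2.
  rewrite -subr_ge0.
  have -> : (1 + t) * a ^+ 2 + (1 + t^-1) * b ^+ 2 - (a + b) ^+ 2 =
            t^-1 * (t * a - b) ^+ 2.
    by field; rewrite gt_eqF.
  by rewrite mulr_ge0 ?sqr_ge0// invr_ge0 ltW.
have := aux (Re z) (Re u); have := aux (Im z) (Im u); lra.
Qed.

Lemma expiD (a b : R) : expi (a + b) = expi a * expi b.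
Proof. by apply: complex_ext; rewrite !ReImE /= ?cosD ?sinD; lra. Qed.

Lemma expi0 : expi (0 : R) = 1.
Proof. by rewrite /expi cos0 sin0. Qed.

Lemma normc_expi (a : R) : normc (expi a) = 1.
Proof. by rewrite /= cos2Dsin2 sqrtr1. Qed.

Lemma conj_expi (a : R) : (expi a)^* = expi (- a).
Proof. by rewrite /expi /= cosN sinN. Qed.

Lemma expi_2pi_nat (k : nat) : expi (2 * pi * k%:R : R) = 1.
Proof.
elim: k => [|k IH]; first by rewrite mulr0 expi0.
rewrite -(natr1 k) mulrDr mulr1 expiD IH mul1r (_ : 2 * pi = 0 + pi *+ 2); last by rewrite mulr2n; ring.
by rewrite /expi cosD2pi sinD2pi cos0 sin0.
Qed.

Lemma expi_2pi_int (k : int) : expi (2 * pi * k%:~R : R) = 1.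
Proof.
case: k => k; first exact: expi_2pi_nat.
by rewrite NegzE mulrNz mulrN -conj_expi expi_2pi_nat; apply: complex_ext; rewrite ?ReImE/= ?oppr0.
Qed.

End ComplexNumbers.

(** * Square-integrable functions *)

Section ComplexL2.
Local Open Scope complex_scope.
Context d (T : measurableType d) {R : realType}.
Variables (mu : {measure set T -> \bar R}) (D : set T).
Hypothesis mD : measurable D.
Implicit Types (f g h : T -> R[i]) (c : R[i]).

Lemma cmeasD f g : cmeasurable_fun D f -> cmeasurable_fun D g ->
  cmeasurable_fun D (fun x => f x + g x).
Proof.
move=> [f1 f2] [g1 g2]; split.
  by under eq_fun do rewrite ReD; exact: measurable_funD.
by under eq_fun do rewrite ImD; exact: measurable_funD.
Qed.

Lemma cmeasN f : cmeasurable_fun D f -> cmeasurable_fun D (fun x => - f x).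
Proof.
move=> [f1 f2]; split.
  by under eq_fun do rewrite ReN; exact: measurableT_comp.
by under eq_fun do rewrite ImN; exact: measurableT_comp.
Qed.

Lemma cmeasB f g : cmeasurable_fun D f -> cmeasurable_fun D g ->
  cmeasurable_fun D (fun x => f x - g x).
Proof. by move=> mf mg; apply: cmeasD => //; exact: cmeasN. Qed.

Lemma cmeasM f g : cmeasurable_fun D f -> cmeasurable_fun D g ->
  cmeasurable_fun D (fun x => f x * g x).
Proof.
move=> [f1 f2] [g1 g2]; split.
  under eq_fun do rewrite ReM.
  by apply: measurable_funB; exact: measurable_funM.
under eq_fun do rewrite ImM.
by apply: measurable_funD; exact: measurable_funM.
Qed.

Lemma cmeas_conj f : cmeasurable_fun D f -> cmeasurable_fun D (fun x => (f x)^*).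
Proof.
move=> [f1 f2]; split.
  by under eq_fun do rewrite Re_conj.
by under eq_fun do rewrite Im_conj; exact: measurableT_comp.
Qed.

Lemma cmeas_cst c : cmeasurable_fun D (fun=> c).
Proof. by split; exact: measurable_cst. Qed.

Lemma cmeasZ c f : cmeasurable_fun D f -> cmeasurable_fun D (fun x => c * f x).
Proof. by move=> mf; apply: cmeasM => //; exact: cmeas_cst. Qed.

Lemma cmeas_sum (I : Type) (s : seq I) (F : I -> T -> R[i]) :
  (forall i, cmeasurable_fun D (F i)) ->
  cmeasurable_fun D (fun x => \sum_(i <- s) F i x).
Proof.
move=> mF; elim: s => [|i s IH].
  by under eq_fun do rewrite big_nil; exact: cmeas_cst.
by under eq_fun do rewrite big_cons; exact: cmeasD.
Qed.

Lemma eq_cmeas f g : {in D, f =1 g} -> cmeasurable_fun D f -> cmeasurable_fun D g.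
Proof.
by move=> fg [f1 f2]; split; [apply: eq_measurable_fun f1|apply: eq_measurable_fun f2];
  move=> x xD /=; rewrite fg.
Qed.

Lemma measurable_normc2 f : cmeasurable_fun D f ->
  measurable_fun D (fun x => normc (f x) ^+ 2).
Proof.
move=> [f1 f2]; under eq_fun do rewrite normc_sqE.
by apply: measurable_funD; exact: measurable_funX.
Qed.

Lemma measurable_normc f : cmeasurable_fun D f ->
  measurable_fun D (fun x => normc (f x)).
Proof.
move=> /measurable_normc2 mf.
rewrite (_ : (fun x => _) = Num.sqrt \o (fun x => normc (f x) ^+ 2)).
  apply: measurableT_comp => //; apply: continuous_measurable_fun => x.
  exact: sqrt_continuous.
by apply/funext => x /=; rewrite sqrtr_sqr ger0_norm// normc_ge0.
Qed.

Lemma emeas_normc2 f : cmeasurable_fun D f ->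
  measurable_fun D (fun x => (normc (f x) ^+ 2)%:E : \bar R).
Proof. by move=> /measurable_normc2 mf; exact/measurable_EFinP. Qed.

Lemma emeas_normc f : cmeasurable_fun D f ->
  measurable_fun D (fun x => (normc (f x))%:E : \bar R).
Proof. by move=> /measurable_normc mf; exact/measurable_EFinP. Qed.

Lemma L2sqnorm_ge0 f : (0 <= L2sqnorm mu D f)%E.
Proof. by apply: integral_ge0 => x _; rewrite lee_fin sqr_ge0. Qed.

Lemma le_L2sqnorm f g : cmeasurable_fun D f -> cmeasurable_fun D g ->
  (forall x, D x -> normc (f x) <= normc (g x)) ->
  (L2sqnorm mu D f <= L2sqnorm mu D g)%E.
Proof.
move=> mf mg fg; apply: ge0_le_integral => //.
- by move=> x _; rewrite lee_fin sqr_ge0.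
- exact: emeas_normc2.
- exact: emeas_normc2.
- by move=> x Dx; rewrite lee_fin ler_pXn2r ?nnegrE ?normc_ge0// fg.
Qed.

Lemma eq_L2sqnorm f g : (forall x, D x -> normc (f x) = normc (g x)) ->
  L2sqnorm mu D f = L2sqnorm mu D g.
Proof. by move=> fg; apply: eq_integral => x /[!inE] Dx; rewrite fg. Qed.

Lemma ae_eq_L2sqnorm f g : cmeasurable_fun D f -> cmeasurable_fun D g ->
  {ae mu, forall x, D x -> f x = g x} -> L2sqnorm mu D f = L2sqnorm mu D g.
Proof.
move=> mf mg fg; apply: ge0_ae_eq_integral => //; try exact: emeas_normc2.
- by move=> x _; rewrite lee_fin sqr_ge0.
- by move=> x _; rewrite lee_fin sqr_ge0.
- by apply: filterS fg => x /[apply] ->.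
Qed.

Lemma L2sqnormZ c f : cmeasurable_fun D f ->
  L2sqnorm mu D (fun x => c * f x) = ((normc c ^+ 2)%:E * L2sqnorm mu D f)%E.
Proof.
move=> mf; rewrite /L2sqnorm -ge0_integralZl_EFin ?sqr_ge0//.
- by apply: eq_integral => x _; rewrite Normc.normcM exprMn EFinM.
- by move=> x _; rewrite lee_fin sqr_ge0.
- exact: emeas_normc2.
Qed.

Lemma L2sqnorm0 : L2sqnorm mu D (fun=> 0) = 0%E.
Proof. by apply: integral0_eq => x _; rewrite Normc.normc0 expr0n. Qed.

Lemma L2sqnormN f : L2sqnorm mu D (fun x => - f x) = L2sqnorm mu D f.
Proof. by apply: eq_L2sqnorm => x _; rewrite normc_opp. Qed.

Lemma L2sqnormD_le t f g : 0 < t -> cmeasurable_fun D f -> cmeasurable_fun D g ->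
  (L2sqnorm mu D (fun x => (f x + g x)%R) <=
   (1 + t)%:E * L2sqnorm mu D f + (1 + t^-1)%:E * L2sqnorm mu D g)%E.
Proof.
move=> t0 mf mg.
have t1 : 0 <= 1 + t by rewrite addr_ge0// ltW.
have t2 : 0 <= 1 + t^-1 by rewrite addr_ge0// invr_ge0 ltW.
have p2 (h : T -> R[i]) x : D x -> (0 <= (normc (h x) ^+ 2)%:E)%E.
  by move=> _; rewrite lee_fin sqr_ge0.
rewrite /L2sqnorm -!ge0_integralZl_EFin//; try exact: emeas_normc2; try exact: p2.
rewrite -ge0_integralD//; first last.
- by apply: measurable_funeM; exact: emeas_normc2.
- by move=> x Dx; rewrite mule_ge0 ?lee_fin ?sqr_ge0.
- by apply: measurable_funeM; exact: emeas_normc2.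
- by move=> x Dx; rewrite mule_ge0 ?lee_fin ?sqr_ge0.
apply: ge0_le_integral => //.
- by move=> x Dx; rewrite lee_fin sqr_ge0.
- by apply: emeas_normc2; exact: cmeasD.
- by apply: emeasurable_funD; apply: measurable_funeM; exact: emeas_normc2.
- by move=> x Dx; rewrite -!EFinM -EFinD lee_fin normc_sqD_le.
Qed.

Lemma inL2Z c f : inL2 mu D f -> inL2 mu D (fun x => c * f x).
Proof.
move=> [mf f2]; split; first exact: cmeasZ.
by rewrite L2sqnormZ// lte_mul_pinfty// lee_fin sqr_ge0.
Qed.

Lemma inL2D f g : inL2 mu D f -> inL2 mu D g -> inL2 mu D (fun x => f x + g x).
Proof.
move=> [mf f2] [mg g2]; split; first exact: cmeasD.
apply: le_lt_trans (L2sqnormD_le (t:=1) _ mf mg) _ => //.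
by rewrite lte_add_pinfty// lte_mul_pinfty// lee_fin// addr_ge0// invr_ge0.
Qed.

Lemma inL2N f : inL2 mu D f -> inL2 mu D (fun x => - f x).
Proof. by move=> [mf f2]; split; [exact: cmeasN|rewrite L2sqnormN]. Qed.

Lemma inL2B f g : inL2 mu D f -> inL2 mu D g -> inL2 mu D (fun x => f x - g x).
Proof. by move=> fL gL; apply: inL2D => //; exact: inL2N. Qed.

Lemma inL2_0 : inL2 mu D (fun=> 0).
Proof. by split; [exact: cmeas_cst|rewrite L2sqnorm0 ltry]. Qed.

Lemma inL2_sum (I : Type) (s : seq I) (F : I -> T -> R[i]) :
  (forall i, inL2 mu D (F i)) -> inL2 mu D (fun x => \sum_(i <- s) F i x).
Proof.
move=> mF; elim: s => [|i s IH].
  by under eq_fun do rewrite big_nil; exact: inL2_0.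
by under eq_fun do rewrite big_cons; exact: inL2D.
Qed.

Lemma inL2_le f g : cmeasurable_fun D f -> inL2 mu D g ->
  (forall x, D x -> normc (f x) <= normc (g x)) -> inL2 mu D f.
Proof.
by move=> mf [mg g2] fg; split => //; apply: le_lt_trans (le_L2sqnorm mf mg fg) g2.
Qed.

(** Real-valued for the sake of ordinary arithmetic. Since [fine] sends +oo to 0, the value is
    meaningful only under [inL2]. *)
Definition nrm f : R := Num.sqrt (fine (L2sqnorm mu D f)).

Lemma nrm_ge0 f : 0 <= nrm f. Proof. exact: sqrtr_ge0. Qed.

Lemma nrm2E f : inL2 mu D f -> L2sqnorm mu D f = (nrm f ^+ 2)%:E.
Proof.
move=> [mf f2]; rewrite sqr_sqrtr ?fine_ge0 ?L2sqnorm_ge0// fineK//.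
by rewrite ge0_fin_numE// L2sqnorm_ge0.
Qed.

Lemma nrm_eq f (a : R) : 0 <= a -> L2sqnorm mu D f = (a ^+ 2)%:E -> nrm f = a.
Proof. by move=> a0 fa; rewrite /nrm fa/= sqrtr_sqr ger0_norm. Qed.

Lemma nrmZ c f : inL2 mu D f -> nrm (fun x => c * f x) = normc c * nrm f.
Proof.
move=> fL; apply: nrm_eq; first by rewrite mulr_ge0 ?normc_ge0 ?nrm_ge0.
by rewrite L2sqnormZ; [rewrite nrm2E// exprMn EFinM|exact: (proj1 fL)].
Qed.

Lemma nrmN f : nrm (fun x => - f x) = nrm f.
Proof. by rewrite /nrm L2sqnormN. Qed.

(** Minkowski is obtained before Cauchy-Schwarz, which will be deduced from it: at t = b / a the
    bound of [L2sqnormD_le] equals (a + b)^2. *)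
Lemma nrmD f g : inL2 mu D f -> inL2 mu D g ->
  nrm (fun x => f x + g x) <= nrm f + nrm g.
Proof.
move=> fL gL; set a := nrm f; set b := nrm g.
have key t : 0 < t -> nrm (fun x => f x + g x) ^+ 2 <=
    (1 + t) * a ^+ 2 + (1 + t^-1) * b ^+ 2.
  move=> t0; have := L2sqnormD_le t0 (proj1 fL) (proj1 gL).
  by rewrite !nrm2E//; exact: inL2D.
have ge0 (t : R) : 0 < t -> nrm (fun x => f x + g x) <= a + b + t.
  (* Either norm may vanish; enlarging both by t / 2 makes the optimal ratio b' / a' available at a
     total cost of t. *)
  move=> t0; pose a' := a + t / 2; pose b' := b + t / 2.
  have a0 : 0 < a' by rewrite ltr_wpDl ?nrm_ge0// divr_gt0.
  have b0 : 0 < b' by rewrite ltr_wpDl ?nrm_ge0// divr_gt0.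
  have aa : a ^+ 2 <= a' ^+ 2 by rewrite ler_pXn2r ?nnegrE ?nrm_ge0 ?(ltW a0)// lerDl divr_ge0// ltW.
  have bb : b ^+ 2 <= b' ^+ 2 by rewrite ler_pXn2r ?nnegrE ?nrm_ge0 ?(ltW b0)// lerDl divr_ge0// ltW.
  have := key (b' / a') (divr_gt0 b0 a0); rewrite invf_div => k1.
  rewrite -(ler_pXn2r (n:=2)) ?nnegrE ?nrm_ge0//; last first.
    by rewrite addr_ge0 ?addr_ge0 ?nrm_ge0// ltW.
  rewrite (_ : a + b + t = a' + b'); last by rewrite /a' /b'; lra.
  apply: le_trans k1 _.
  apply: (@le_trans _ _ ((1 + b' / a') * a' ^+ 2 + (1 + a' / b') * b' ^+ 2)).
    by apply: lerD; rewrite ler_wpM2l// addr_ge0// divr_ge0// ltW.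
  suff -> : (1 + b' / a') * a' ^+ 2 + (1 + a' / b') * b' ^+ 2 = (a' + b') ^+ 2 by [].
  by field; rewrite !gt_eqF.
by apply/ler_addgt0Pr => t t0; exact: ge0.
Qed.

Lemma nrmB f g : inL2 mu D f -> inL2 mu D g ->
  nrm (fun x => f x - g x) <= nrm f + nrm g.
Proof. by move=> fL gL; rewrite -(nrmN g); apply: nrmD => //; exact: inL2N. Qed.

Lemma nrm_dist f g : inL2 mu D f -> inL2 mu D g ->
  `|nrm f - nrm g| <= nrm (fun x => f x - g x).
Proof.
move=> fL gL; have fgL := inL2B fL gL.
rewrite ler_norml; apply/andP; split.
  have := nrmB fL fgL; rewrite (_ : (fun x => _) = g); first by lra.
  by apply/funext => x; rewrite opprB addrCA subrr addr0.
have := nrmD fgL gL; rewrite (_ : (fun x => _) = f); first by lra.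
by apply/funext => x; rewrite subrK.
Qed.

Lemma nrm_dist3 f g h : inL2 mu D f -> inL2 mu D g -> inL2 mu D h ->
  nrm (fun x => f x - h x) <= nrm (fun x => f x - g x) + nrm (fun x => g x - h x).
Proof.
move=> fL gL hL; have := nrmD (inL2B fL gL) (inL2B gL hL).
by under [in nrm _]eq_fun do rewrite subrKA.
Qed.

Lemma nrm_distC f g : nrm (fun x => f x - g x) = nrm (fun x => g x - f x).
Proof.
by rewrite -nrmN; congr nrm; apply/funext => x; rewrite opprB.
Qed.

Section convergence.
Context {J : Type} (F : set_system J) {FF : Filter F}.

Lemma L2convergesP (f_ : J -> T -> R[i]) f : L2converges mu D F f_ f <->
  forall e : R, 0 < e -> \forall j \near F, (L2sqnorm mu D (fun x => (f_ j x - f x)%R) < e%:E)%E.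
Proof.
split=> [cv e e0|cv].
  apply: (cv [set y | (y < e%:E)%E]); apply: open_nbhs_nbhs; split.
    exact: open_ereal_lt_ereal.
  by rewrite /= lte_fin.
apply/fine_cvgP; split.
  near=> j; rewrite ge0_fin_numE ?L2sqnorm_ge0//.
  by apply: lt_trans (_ : 1%:E < _)%E; [near: j; exact: cv|exact: ltry].
apply/cvgrPdist_lt => e e0; near=> j; rewrite sub0r normrN /=.
have je : (L2sqnorm mu D (fun x => (f_ j x - f x)%R) < e%:E)%E by near: j; exact: cv.
rewrite ger0_norm ?fine_ge0 ?L2sqnorm_ge0// -lte_fin fineK//.
by rewrite ge0_fin_numE ?L2sqnorm_ge0//; apply: lt_trans je _; exact: ltry.
Unshelve. all: by end_near. Qed.

Lemma L2converges_nrmP (f_ : J -> T -> R[i]) f : (forall j, inL2 mu D (f_ j)) -> inL2 mu D f ->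
  L2converges mu D F f_ f <->
  forall e : R, 0 < e -> \forall j \near F, nrm (fun x => f_ j x - f x) < e.
Proof.
move=> f_L fL; rewrite L2convergesP; split => cv e e0.
  near=> j; rewrite -(ltr_pXn2r (n:=2)) ?nnegrE ?nrm_ge0 ?(ltW e0)//.
  rewrite -lte_fin -nrm2E; last exact: inL2B.
  by near: j; apply: cv; rewrite exprn_gt0.
near=> j; rewrite nrm2E; last exact: inL2B.
have : nrm (fun x => f_ j x - f x) < Num.sqrt e by near: j; apply: cv; rewrite sqrtr_gt0.
move=> h; rewrite lte_fin -[ltRHS](sqr_sqrtr (ltW e0)).
by rewrite ltr_pXn2r ?nnegrE ?nrm_ge0 ?sqrtr_ge0.
Unshelve. all: by end_near. Qed.

Lemma L2converges_nrm (f_ : J -> T -> R[i]) f : (forall j, inL2 mu D (f_ j)) -> inL2 mu D f ->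
  L2converges mu D F f_ f -> nrm (f_ j) @[j --> F] --> nrm f.
Proof.
move=> f_L fL /L2converges_nrmP cv; apply/cvgrPdist_lt => e e0; near=> j.
rewrite distrC; apply: le_lt_trans (nrm_dist (f_L j) fL) _.
by near: j; exact: cv.
Unshelve. all: by end_near. Qed.

Lemma L2convergesD (f_ g_ : J -> T -> R[i]) f g : (forall j, inL2 mu D (f_ j)) -> inL2 mu D f ->
  (forall j, inL2 mu D (g_ j)) -> inL2 mu D g ->
  L2converges mu D F f_ f -> L2converges mu D F g_ g ->
  L2converges mu D F (fun j x => f_ j x + g_ j x) (fun x => f x + g x).
Proof.
move=> f_L fL g_L gL /L2converges_nrmP fc /L2converges_nrmP gc.
apply/L2converges_nrmP; [by move=> j; exact: inL2D|exact: inL2D|] => e e0.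
near=> j; rewrite (_ : (fun x => _) = (fun x => (f_ j x - f x) + (g_ j x - g x))); last first.
  by apply/funext => x; rewrite opprD addrACA.
apply: le_lt_trans (nrmD _ _) _; [exact: inL2B|exact: inL2B|].
rewrite (splitr e) ltrD//; near: j; [apply: fc|apply: gc] => //; exact: divr_gt0.
Unshelve. all: by end_near. Qed.

Lemma L2convergesZ c (f_ : J -> T -> R[i]) f : (forall j, inL2 mu D (f_ j)) -> inL2 mu D f ->
  L2converges mu D F f_ f ->
  L2converges mu D F (fun j x => c * f_ j x) (fun x => c * f x).
Proof.
move=> f_L fL /L2converges_nrmP fc.
apply/L2converges_nrmP; [by move=> j; exact: inL2Z|exact: inL2Z|] => e e0.
have c1 : 0 < normc c + 1 by rewrite ltr_wpDl ?normc_ge0.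
near=> j; under [in nrm _]eq_fun do rewrite -mulrBr.
rewrite nrmZ; last exact: inL2B.
apply: (@le_lt_trans _ _ ((normc c + 1) * nrm (fun x => f_ j x - f x))).
  by rewrite ler_wpM2r ?nrm_ge0// lerDl.
rewrite mulrC -ltr_pdivlMr//; near: j; apply: fc => //.
exact: divr_gt0.
Unshelve. all: by end_near. Qed.

End convergence.

End ComplexL2.

Lemma limn_einf_le (R : realType) (u : (\bar R)^nat) (c : \bar R) :
  (forall j, (u j <= c)%E) -> (limn_einf u <= c)%E.
Proof.
move=> uc; rewrite limn_einf_lim; apply: lime_le; first exact: is_cvg_einfs.
by near=> n; apply: le_trans (uc n); apply: ereal_inf_lbound; exists n => /=.
Unshelve. all: by end_near. Qed.

Lemma cvgn_geometric_diff (R : realType) (u : R^nat) (C : R) :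
  (forall k, `|u k.+1 - u k| <= C * 2^-1 ^+ k) -> cvgn u.
Proof.
move=> uC.
have cT : cvgn (series (telescope u)).
  apply: normed_cvg; apply: (@series_le_cvg _ _ (geometric C 2^-1)) => //.
  - by move=> n; exact: normr_ge0.
  - by move=> n; exact: le_trans (normr_ge0 _) (uC n).
  - apply: is_cvg_geometric_series.
    by rewrite ger0_norm ?invr_ge0// invf_lt1// ltrDl.
rewrite (_ : u = (fun n => u 0%N + series (telescope u) n)).
  by apply: is_cvgD => //; exact: is_cvg_cst.
by apply/funext => n; rewrite -eq_sum_telescope.
Qed.

(** * Completeness of L^2 (Riesz-Fischer) *)

Section L2Complete.
Local Open Scope complex_scope.
Context d (T : measurableType d) {R : realType}.
Variables (mu : {measure set T -> \bar R}) (D : set T).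
Hypothesis mD : measurable D.
Implicit Types (f g h : T -> R[i]) (c : R[i]).

Definition ccvg (u : nat -> R[i]) (l : R[i]) :=
  Re (u j) @[j --> \oo] --> Re l /\ Im (u j) @[j --> \oo] --> Im l.

Lemma ccvg_normc2 (u : nat -> R[i]) l : ccvg u l ->
  normc (u j) ^+ 2 @[j --> \oo] --> normc l ^+ 2.
Proof.
move=> [u1 u2]; rewrite normc_sqE; under eq_fun do rewrite normc_sqE.
by apply: cvgD; rewrite expr2; under eq_fun do rewrite expr2; exact: cvgM.
Qed.

Lemma ccvgD (u v : nat -> R[i]) l m : ccvg u l -> ccvg v m ->
  ccvg (fun j => u j + v j) (l + m).
Proof.
move=> [u1 u2] [v1 v2]; split.
  by rewrite ReD; under eq_fun do rewrite ReD; exact: cvgD.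
by rewrite ImD; under eq_fun do rewrite ImD; exact: cvgD.
Qed.

Lemma ccvgM (u v : nat -> R[i]) l m : ccvg u l -> ccvg v m ->
  ccvg (fun j => u j * v j) (l * m).
Proof.
move=> [u1 u2] [v1 v2]; split.
  by rewrite ReM; under eq_fun do rewrite ReM; apply: cvgB; exact: cvgM.
by rewrite ImM; under eq_fun do rewrite ImM; apply: cvgD; exact: cvgM.
Qed.

Lemma ccvg_cst c : ccvg (fun=> c) c.
Proof. by split; exact: cvg_cst. Qed.

Lemma ccvgN (u : nat -> R[i]) l : ccvg u l -> ccvg (fun j => - u j) (- l).
Proof.
move=> [u1 u2]; split.
  by rewrite ReN; under eq_fun do rewrite ReN; exact: cvgN.
by rewrite ImN; under eq_fun do rewrite ImN; exact: cvgN.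
Qed.

Lemma ccvgB (u v : nat -> R[i]) l m : ccvg u l -> ccvg v m ->
  ccvg (fun j => u j - v j) (l - m).
Proof. by move=> ul vm; apply: ccvgD => //; exact: ccvgN. Qed.

Lemma ccvg_shift k (u : nat -> R[i]) l : ccvg u l -> ccvg (fun j => u (k + j)%N) l.
Proof.
move=> [u1 u2]; split; under eq_fun do rewrite addnC.
  by move: u1; rewrite -(cvg_shiftn k); exact.
by move: u2; rewrite -(cvg_shiftn k); exact.
Qed.

Lemma L2sqnorm_fatou (h_ : nat -> T -> R[i]) h (c : \bar R) :
  (forall j, cmeasurable_fun D (h_ j)) ->
  (forall x, D x -> ccvg (h_ ^~ x) (h x)) ->
  (forall j, (L2sqnorm mu D (h_ j) <= c)%E) ->
  (L2sqnorm mu D h <= c)%E.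
Proof.
move=> mh hh hc.
have := @fatou _ _ _ mu D mD (fun j x => (normc (h_ j x) ^+ 2)%:E).
move=> /(_ (fun j => emeas_normc2 (mh j))) F.
apply: (@le_trans _ _ (limn_einf (fun j => L2sqnorm mu D (h_ j)))).
  apply: le_trans (F _) => //; last by move=> n x _; rewrite lee_fin sqr_ge0.
  rewrite le_eqVlt; apply/orP; left; apply/eqP.
  apply: eq_integral => x /[!inE] Dx; apply/esym.
  have cx : (normc (h_ j x) ^+ 2)%:E @[j --> \oo] --> (normc (h x) ^+ 2)%:E.
    by apply: cvg_EFin; [exact: nearW|exact: ccvg_normc2 (hh x Dx)].
  by rewrite (cvg_limn_einf_sup cx).
exact: limn_einf_le.
Qed.

Lemma cmeas_cvg (h_ : nat -> T -> R[i]) h :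
  (forall j, cmeasurable_fun D (h_ j)) ->
  (forall x, D x -> ccvg (h_ ^~ x) (h x)) -> cmeasurable_fun D h.
Proof.
move=> mh hh; split.
  apply: (measurable_fun_cvg (h:=fun j x => Re (h_ j x))) => [j|x Dx].
    exact: (proj1 (mh j)).
  exact: (proj1 (hh x Dx)).
apply: (measurable_fun_cvg (h:=fun j x => Im (h_ j x))) => [j|x Dx].
  exact: (proj2 (mh j)).
exact: (proj2 (hh x Dx)).
Qed.

(** The sum S of the 4^k |g_(k+1) - g_k|^2 is integrable, its k-th term having integral at most 4^k
    8^-k = 2^-k. Where S is finite, |g_(k+1) - g_k| <= sqrt(S) 2^-k, so the sequence converges
    pointwise. With squares weighted by 4^k, only integrals of nonnegative series are needed. *)
Let fast (g_ : nat -> T -> R[i]) : (forall j, inL2 mu D (g_ j)) ->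
  (forall k j, (k <= j)%N -> nrm mu D (fun x => g_ j x - g_ k x) <= 8^-1 ^+ k) ->
  exists f, inL2 mu D f /\ forall k, nrm mu D (fun x => f x - g_ k x) <= 8^-1 ^+ k.
Proof.
move=> gL gC.
pose s k x : \bar R := ((4 : R) ^+ k * normc (g_ k.+1 x - g_ k x) ^+ 2)%:E.
have s0 k x : (0 <= s k x)%E by rewrite lee_fin mulr_ge0 ?sqr_ge0 ?exprn_ge0.
have dL k : inL2 mu D (fun x => g_ k.+1 x - g_ k x) by exact: inL2B.
have ms k : measurable_fun D (s k).
  rewrite /s; under eq_fun do rewrite EFinM.
  by apply: measurable_funeM; apply: emeas_normc2 => //; exact: (proj1 (dL k)).
pose S x := (\sum_(0 <= k <oo) s k x)%E.
have mS : measurable_fun D S by apply: ge0_emeasurable_sum => // k x _ _.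
have S0 x : (0 <= S x)%E by apply: nneseries_ge0 => k _ _.
have iS : (\int[mu]_(x in D) S x < +oo)%E.
  rewrite integral_nneseries//.
  apply: (@le_lt_trans _ _ (\sum_(0 <= k <oo) ((2^-1 : R) ^+ k)%:E)%E).
    apply: lee_nneseries => [k _ _|k _]; first exact: integral_ge0.
    rewrite /s; under eq_integral do rewrite EFinM.
    rewrite ge0_integralZl_EFin ?exprn_ge0//; first last.
    - by apply: emeas_normc2 => //; exact: (proj1 (dL k)).
    - by move=> x _; rewrite lee_fin sqr_ge0.
    rewrite -/(L2sqnorm mu D (fun x => g_ k.+1 x - g_ k x)) nrm2E//.
    rewrite -EFinM lee_fin.
    have e1 : nrm mu D (fun x => g_ k.+1 x - g_ k x) ^+ 2 <= 8^-1 ^+ k.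
      apply: (@le_trans _ _ ((8^-1 ^+ k) ^+ 2)).
        by rewrite ler_pXn2r ?nnegrE ?nrm_ge0 ?exprn_ge0// gC.
      by rewrite expr2 ler_piMl ?exprn_ge0// exprn_ile1// invf_le1//; lra.
    apply: (@le_trans _ _ (4 ^+ k * 8^-1 ^+ k)); first by rewrite ler_wpM2l ?exprn_ge0.
    by rewrite -exprMn (_ : 4 * 8^-1 = 2^-1)//; lra.
  have c2 := @cvg_geometric_series R 1 2^-1.
  have h2 : `|2^-1 : R| < 1 by rewrite ger0_norm ?invr_ge0// invf_lt1// ltrDl.
  rewrite (_ : (\sum_(0 <= k <oo) _)%E = (1 / (1 - 2^-1))%:E) ?ltry//.
  apply/cvg_lim => //.
  rewrite (_ : (fun n => _) = EFin \o series (geometric 1 2^-1)).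
    by apply: cvg_EFin; [exact: nearW|exact: c2].
  apply/funext => n /=; rewrite /series/= sumEFin; congr EFin.
  by apply: eq_bigr => i _; rewrite mul1r.
pose A := D `&` [set x | (S x < +oo)%E].
have mA : measurable A by exact: emeasurable_fun_infty_o.
have aeA : {ae mu, forall x, D x -> A x}.
  have : mu.-integrable D S.
    apply/integrableP; split => //; under eq_integral do rewrite gee0_abs//.
    exact: iS.
  move=> /(integrable_ae mD); apply: filterS => x /[swap] Dx /(_ Dx).
  by rewrite ge0_fin_numE// => Sx; split.
(* Cutting off the null set where S is infinite makes the sequence converge at every point of D,
   without changing any norm. *)
pose g k x := g_ k x * (\1_A x)%:C.
have gA k x : A x -> g k x = g_ k x by move=> Ax; rewrite /g indicE mem_set// mulr1.
have gA' k x : ~ A x -> g k x = 0 by move=> Ax; rewrite /g indicE memNset// mulr0.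
have mg k : cmeasurable_fun D (g k).
  apply: cmeasM; first exact: (proj1 (gL k)).
  by split => /=; [exact: measurable_indic|exact: measurable_cst].
have gae j k : L2sqnorm mu D (fun x => g j x - g k x) =
    L2sqnorm mu D (fun x => g_ j x - g_ k x).
  apply: ae_eq_L2sqnorm => //; [exact: cmeasB|by apply: cmeasB; exact: (proj1 (gL _))|].
  by apply: filterS aeA => x /[apply] Ax; rewrite !gA.
have cg x : D x -> exists l, ccvg (g ^~ x) l.
  move=> Dx; have [Ax|Ax] := pselect (A x); last first.
    by exists 0; under eq_fun do rewrite gA'//; exact: ccvg_cst.
  have Sfin : S x \is a fin_num by rewrite ge0_fin_numE//; exact: (proj2 Ax).
  have bd k : normc (g k.+1 x - g k x) <= Num.sqrt (fine (S x)) * 2^-1 ^+ k.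
    have : (s k x <= S x)%E.
      rewrite /S (nneseries_split 0 k.+1)//= add0n big_nat_recr//=.
      rewrite -addeA addeCA leeDl// adde_ge0//; first exact: sume_ge0.
      exact: nneseries_ge0.
    rewrite -[in leRHS](fineK Sfin) lee_fin => sk; rewrite !gA//.
    rewrite -(ler_pXn2r (n:=2)) ?nnegrE ?normc_ge0 ?mulr_ge0 ?sqrtr_ge0 ?exprn_ge0//.
    rewrite exprMn sqr_sqrtr ?fine_ge0// -exprM mulnC exprM exprVn -natrX /=.
    rewrite (_ : (2 ^ 2)%N%:R = 4)// exprVn ler_pdivlMr ?exprn_gt0//.
    by rewrite mulrC.
  have cR : cvgn (fun k => Re (g k x)).
    apply: (cvgn_geometric_diff (C := Num.sqrt (fine (S x)))) => k.
    by apply: le_trans (bd k); rewrite -ReN -ReD normRe_le.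
  have cI : cvgn (fun k => Im (g k x)).
    apply: (cvgn_geometric_diff (C := Num.sqrt (fine (S x)))) => k.
    by apply: le_trans (bd k); rewrite -ImN -ImD normIm_le.
  by exists (limn (fun k => Re (g k x)) +i* limn (fun k => Im (g k x))); split.
have /choice[f Hf] : forall x, exists l, D x -> ccvg (g ^~ x) l.
  move=> x; have [Dx|nDx] := pselect (D x); last by exists 0.
  by have [l] := cg x Dx; exists l.
have mf : cmeasurable_fun D f by apply: cmeas_cvg mg _.
have fg k : (L2sqnorm mu D (fun x => (f x - g_ k x)%R) <= ((8^-1 ^+ k) ^+ 2)%:E)%E.
  rewrite (_ : L2sqnorm mu D _ = L2sqnorm mu D (fun x => (f x - g k x)%R)); last first.
    apply: ae_eq_L2sqnorm => //; [by apply: cmeasB => //; exact: (proj1 (gL _))|exact: cmeasB|].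
    by apply: filterS aeA => x /[apply] Ax; rewrite gA.
  (* With k fixed and j growing, Fatou turns the Cauchy bound into a bound on the distance to the
     limit. *)
  apply: (@L2sqnorm_fatou (fun j x => g (k + j)%N x - g k x)).
  - by move=> j; exact: cmeasB.
  - move=> x Dx; apply: ccvgB; last exact: ccvg_cst.
    exact: (ccvg_shift k (Hf x Dx)).
  - move=> j; rewrite gae nrm2E; last exact: inL2B.
    by rewrite lee_fin ler_pXn2r ?nnegrE ?nrm_ge0 ?exprn_ge0// gC// leq_addr.
have fL : inL2 mu D f.
  have fgL : inL2 mu D (fun x => f x - g_ 0%N x).
    split; first by apply: cmeasB => //; exact: (proj1 (gL _)).
    exact: le_lt_trans (fg 0%N) (ltry _).
  have := inL2D mD fgL (gL 0%N).
  rewrite (_ : (fun x => f x - _ + _) = f)//.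
  by apply/funext => x; rewrite subrK.
exists f; split => // k.
rewrite -(ler_pXn2r (n:=2)) ?nnegrE ?nrm_ge0 ?exprn_ge0//.
by rewrite -lee_fin -nrm2E//; exact: inL2B.
Qed.

Lemma L2_complete (f_ : nat -> T -> R[i]) : (forall j, inL2 mu D (f_ j)) ->
  (forall e, 0 < e -> exists N, forall i j, (N <= i)%N -> (N <= j)%N ->
     nrm mu D (fun x => f_ i x - f_ j x) < e) ->
  exists2 f, inL2 mu D f & L2converges mu D \oo f_ f.
Proof.
move=> fL fC.
have /choice[N HN] : forall k, exists N, forall i j, (N <= i)%N -> (N <= j)%N ->
    nrm mu D (fun x => f_ i x - f_ j x) < 8^-1 ^+ k.
  by move=> k; apply: fC; rewrite exprn_gt0.
(* The running maximum makes the extracted indices nondecreasing, as [fast] compares the terms k <=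
   j. *)
pose n k := (\max_(i < k.+1) N i)%N.
have Nn k : (N k <= n k)%N by exact: (leq_bigmax_cond (F:=fun i : 'I_k.+1 => N i) ord_max).
have nn k j : (k <= j)%N -> (n k <= n j)%N.
  move=> kj; apply/bigmax_leqP => i _.
  by apply: (leq_bigmax_cond (F:=fun i : 'I_j.+1 => N i) (widen_ord (kj : (k.+1 <= j.+1)%N) i)).
have [k j kj|f [fL' Hf]] := @fast (fun k => f_ (n k)) (fun k => fL _).
  by apply/ltW/HN => //; exact: leq_trans (Nn k) (nn _ _ kj).
exists f => //; apply/L2converges_nrmP => // e e0.
have e2 : 0 < e / 2 by exact: divr_gt0.
have [k _ /(_ k (leqnn k))/= Hk] : \forall k \near \oo, (8^-1 : R) ^+ k < e / 2.
  have : (8^-1 : R) ^+ k @[k --> \oo] --> 0.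
    by apply: cvg_expr; rewrite ger0_norm ?invr_ge0// invf_lt1//; lra.
  move=> /cvgrPdist_lt /(_ _ e2); apply: filterS => k; rewrite sub0r normrN.
  by rewrite ger0_norm ?exprn_ge0.
near=> i; apply: le_lt_trans (nrm_dist3 mD (fL i) (fL (n k)) fL') _.
rewrite (splitr e) ltrD//.
  apply: lt_trans Hk; apply: HN; last exact: Nn.
  by near: i; exact: nbhs_infty_ge.
by rewrite nrm_distC; apply: le_lt_trans Hk.
Unshelve. all: by end_near. Qed.

End L2Complete.

(** * The complex integral and the inner product *)

Section ComplexIntegral.
Local Open Scope complex_scope.
Context d (T : measurableType d) {R : realType}.
Variables (mu : {measure set T -> \bar R}) (D : set T).
Hypothesis mD : measurable D.
Implicit Types (f g h : T -> R[i]) (c : R[i]).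

Lemma inL1P f : inL1 mu D f <->
  mu.-integrable D (EFin \o (fun x => Re (f x))) /\
  mu.-integrable D (EFin \o (fun x => Im (f x))).
Proof.
split=> [[mf fL]|[/[dup] i1 /integrableP[/measurable_EFinP m1 f1] /[dup] i2 /integrableP[/measurable_EFinP m2 f2]]].
  have iN : mu.-integrable D (fun x => (normc (f x))%:E).
    apply/integrableP; split; first exact: emeas_normc.
    by under eq_integral do rewrite /= ger0_norm ?normc_ge0//.
  by split; apply: le_integrable iN => //;
    [apply/measurable_EFinP; exact: (proj1 mf)|move=> x _|
     apply/measurable_EFinP; exact: (proj2 mf)|move=> x _];
    rewrite lee_fin [leRHS]ger0_norm ?normc_ge0 ?normRe_le ?normIm_le.
have mf : cmeasurable_fun D f by [].
split => //.
have := integrableD mD (integrable_abse i1) (integrable_abse i2) => /integrableP[_].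
apply: le_lt_trans; apply: ge0_le_integral => //.
- by move=> x _; rewrite lee_fin normc_ge0.
- exact: emeas_normc.
- by apply: measurableT_comp => //; apply: emeasurable_funD; apply: measurableT_comp => //;
    apply/measurable_EFinP.
- by move=> x _ /=; rewrite lee_fin [leRHS]ger0_norm ?addr_ge0// normc_le_ReIm.
Qed.

Lemma inL1_Re f : inL1 mu D f -> mu.-integrable D (EFin \o (fun x => Re (f x))).
Proof. by move=> /inL1P[]. Qed.

Lemma inL1_Im f : inL1 mu D f -> mu.-integrable D (EFin \o (fun x => Im (f x))).
Proof. by move=> /inL1P[]. Qed.

Lemma inL1_le f g : cmeasurable_fun D f -> inL1 mu D g ->
  (forall x, D x -> normc (f x) <= normc (g x)) -> inL1 mu D f.
Proof.
move=> mf [mg g1] fg; split => //; apply: le_lt_trans g1.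
apply: ge0_le_integral => //; try exact: emeas_normc.
by move=> x _; rewrite lee_fin normc_ge0.
Qed.

Lemma inL1D f g : inL1 mu D f -> inL1 mu D g -> inL1 mu D (fun x => f x + g x).
Proof.
move=> fL gL; apply/inL1P; split.
  rewrite (_ : _ \o _ = (EFin \o (fun x => Re (f x))) \+ (EFin \o (fun x => Re (g x)))).
    by apply: integrableD => //; exact: inL1_Re.
  by apply/funext => x /=; rewrite ReD.
rewrite (_ : _ \o _ = (EFin \o (fun x => Im (f x))) \+ (EFin \o (fun x => Im (g x)))).
  by apply: integrableD => //; exact: inL1_Im.
by apply/funext => x /=; rewrite ImD.
Qed.

Lemma inL1Z c f : inL1 mu D f -> inL1 mu D (fun x => c * f x).
Proof.
move=> [mf f1]; split; first exact: cmeasZ.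
under eq_integral do rewrite Normc.normcM EFinM.
rewrite ge0_integralZl_EFin ?normc_ge0//; last exact: emeas_normc.
- by rewrite lte_mul_pinfty ?lee_fin ?normc_ge0.
- by move=> x _; rewrite lee_fin normc_ge0.
Qed.

Lemma inL1_0 : inL1 mu D (fun=> 0).
Proof.
split; first exact: cmeas_cst.
by rewrite integral0_eq// => x _; rewrite Normc.normc0.
Qed.

Lemma inL1_sum (I : Type) (s : seq I) (F : I -> T -> R[i]) :
  (forall i, inL1 mu D (F i)) -> inL1 mu D (fun x => \sum_(i <- s) F i x).
Proof.
move=> mF; elim: s => [|i s IH].
  by under eq_fun do rewrite big_nil; exact: inL1_0.
by under eq_fun do rewrite big_cons; exact: inL1D.
Qed.

Lemma eq_cintegral f g : {in D, f =1 g} -> cintegral mu D f = cintegral mu D g.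
Proof.
by move=> fg; rewrite /cintegral; congr (_ +i* _); apply: eq_Rintegral => x xD; rewrite fg.
Qed.

Lemma ae_eq_cintegral f g : cmeasurable_fun D f -> cmeasurable_fun D g ->
  {ae mu, forall x, D x -> f x = g x} -> cintegral mu D f = cintegral mu D g.
Proof.
move=> [f1 f2] [g1 g2] fg; rewrite /cintegral /Rintegral; congr (fine _ +i* fine _);
  apply: ae_eq_integral => //; try exact/measurable_EFinP;
  by apply: filterS fg => x /[apply] ->.
Qed.

Lemma cintegralD f g : inL1 mu D f -> inL1 mu D g ->
  cintegral mu D (fun x => f x + g x) = cintegral mu D f + cintegral mu D g.
Proof.
move=> fL gL; apply: complex_ext; rewrite !ReImE /=.
  by under eq_Rintegral do rewrite ReD; rewrite RintegralD//; exact: inL1_Re.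
by under eq_Rintegral do rewrite ImD; rewrite RintegralD//; exact: inL1_Im.
Qed.

Lemma cintegralZ c f : inL1 mu D f ->
  cintegral mu D (fun x => c * f x) = c * cintegral mu D f.
Proof.
move=> fL; have iZ r (p : T -> R) : mu.-integrable D (EFin \o p) ->
    mu.-integrable D (EFin \o (fun x => r * p x)).
  by move=> /(integrableZl mD r); apply: eq_integrable => // x _ /=; rewrite EFinM.
have i1 := inL1_Re fL; have i2 := inL1_Im fL.
apply: complex_ext; rewrite !ReImE /=.
  under eq_Rintegral do rewrite ReM -mulNr.
  by rewrite RintegralD//; [rewrite !RintegralZl// mulNr|exact: iZ|exact: iZ].
under eq_Rintegral do rewrite ImM.
by rewrite RintegralD//; [rewrite !RintegralZl|exact: iZ|exact: iZ].
Qed.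

Lemma inL1N f : inL1 mu D f -> inL1 mu D (fun x => - f x).
Proof. by move=> /(inL1Z (-1)); under eq_fun do rewrite mulN1r. Qed.

Lemma inL1B f g : inL1 mu D f -> inL1 mu D g -> inL1 mu D (fun x => f x - g x).
Proof. by move=> fL gL; apply: inL1D => //; exact: inL1N. Qed.

Lemma cintegralB f g : inL1 mu D f -> inL1 mu D g ->
  cintegral mu D (fun x => f x - g x) = cintegral mu D f - cintegral mu D g.
Proof.
move=> fL gL; rewrite cintegralD//; last exact: inL1N.
rewrite -[in RHS]mulN1r -cintegralZ//; congr (_ + _).
by apply: eq_cintegral => x _; rewrite mulN1r.
Qed.

Lemma cintegral0 : cintegral mu D (fun=> 0) = 0.
Proof.
by rewrite /cintegral /Rintegral !integral0_eq.
Qed.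

Lemma cintegral_sum (I : Type) (s : seq I) (F : I -> T -> R[i]) :
  (forall i, inL1 mu D (F i)) ->
  cintegral mu D (fun x => \sum_(i <- s) F i x) = \sum_(i <- s) cintegral mu D (F i).
Proof.
move=> mF; elim: s => [|i s IH].
  by under eq_cintegral do rewrite big_nil; rewrite big_nil cintegral0.
under eq_cintegral do rewrite big_cons.
by rewrite cintegralD ?big_cons ?IH//; exact: inL1_sum.
Qed.

Lemma rotate_to_norm (z : R[i]) : exists2 c, normc c = 1 & c * z = (normc z)%:C.
Proof.
have [->|z0] := eqVneq z 0.
  by exists 1; rewrite ?Normc.normc1// mul1r Normc.normc0.
have nz : normc z != 0 by apply: contra_neq z0; exact: Normc.eq0_normc.
exists (((normc z)^-1)%:C * z^* ).
  rewrite Normc.normcM normc_conj normc_real ger0_norm ?invr_ge0 ?normc_ge0//.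
  by rewrite mulVf.
rewrite -mulrA [z^* * z]mulrC mul_conjc -[LHS]/(_%:C * _%:C) -rmorphM/=.
by rewrite expr2 mulrA mulVf// mul1r.
Qed.

Lemma cintegral_dominated (f_ : nat -> T -> R[i]) f g :
  (forall j, cmeasurable_fun D (f_ j)) -> inL1 mu D g ->
  (forall x, D x -> ccvg (f_ ^~ x) (f x)) ->
  (forall j x, D x -> normc (f_ j x) <= normc (g x)) ->
  ccvg (fun j => cintegral mu D (f_ j)) (cintegral mu D f).
Proof.
move=> mf_ gL cv dom; have mf := cmeas_cvg mf_ cv.
have ig : mu.-integrable D (fun x => (normc (g x))%:E).
  apply/integrableP; split; first exact: emeas_normc (proj1 gL).
  by under eq_integral do rewrite /= ger0_norm ?normc_ge0//; exact: (proj2 gL).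
have aux (p : R[i] -> R) : (forall z, `|p z| <= normc z) ->
    (forall j, measurable_fun D (fun x => p (f_ j x))) ->
    measurable_fun D (fun x => p (f x)) ->
    (forall x, D x -> p (f_ j x) @[j --> \oo] --> p (f x)) ->
    \int[mu]_(x in D) p (f_ j x) @[j --> \oo] --> \int[mu]_(x in D) p (f x).
  move=> pn m1 m2 pc.
  have [||||i1 _] := @dominated_convergence _ _ _ mu D mD
     (fun j x => (p (f_ j x))%:E) (fun x => (p (f x))%:E) _ _ _ _ ig.
  - by move=> j; exact/measurable_EFinP.
  - exact/measurable_EFinP.
  - by apply: aeW => x Dx; apply: cvg_EFin; [exact: nearW|exact: pc].
  - by apply: aeW => x j Dx /=; rewrite lee_fin (le_trans (pn _))// dom.
  by move=> c; apply: fine_cvg; rewrite fineK//; exact: integrable_fin_num i1.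
split; apply: aux.
- exact: normRe_le.
- by move=> j; exact: (proj1 (mf_ j)).
- exact: (proj1 mf).
- by move=> x Dx; exact: (proj1 (cv x Dx)).
- exact: normIm_le.
- by move=> j; exact: (proj2 (mf_ j)).
- exact: (proj2 mf).
- by move=> x Dx; exact: (proj2 (cv x Dx)).
Qed.

Lemma inL2M_inL1 f g : inL2 mu D f -> inL2 mu D g -> inL1 mu D (fun x => f x * (g x)^* ).
Proof.
move=> [mf f2] [mg g2]; split; first by apply: cmeasM => //; exact: cmeas_conj.
apply: (@le_lt_trans _ _ (L2sqnorm mu D f + L2sqnorm mu D g)%E); last exact: lte_add_pinfty.
rewrite /L2sqnorm -ge0_integralD//; try exact: emeas_normc2; try by move=> x _; rewrite lee_fin sqr_ge0.
apply: ge0_le_integral => //.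
- by move=> x _; rewrite lee_fin normc_ge0.
- by apply: emeas_normc; apply: cmeasM => //; exact: cmeas_conj.
- by apply: emeasurable_funD; exact: emeas_normc2.
- move=> x _; rewrite -EFinD lee_fin Normc.normcM normc_conj.
  set a := normc (f x); set b := normc (g x).
  have := sqr_ge0 (a - b); have := sqr_ge0 (a + b); nra.
Qed.

Lemma L2dotDl f g h : inL2 mu D f -> inL2 mu D g -> inL2 mu D h ->
  L2dot mu D (fun x => f x + g x) h = L2dot mu D f h + L2dot mu D g h.
Proof.
move=> fL gL hL; rewrite -cintegralD; try exact: inL2M_inL1.
by apply: eq_cintegral => x _; rewrite mulrDl.
Qed.

Lemma L2dotZl c f g : inL2 mu D f -> inL2 mu D g ->
  L2dot mu D (fun x => c * f x) g = c * L2dot mu D f g.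
Proof.
move=> fL gL; rewrite -cintegralZ; last exact: inL2M_inL1.
by apply: eq_cintegral => x _; rewrite mulrA.
Qed.

Lemma L2dotBl f g h : inL2 mu D f -> inL2 mu D g -> inL2 mu D h ->
  L2dot mu D (fun x => f x - g x) h = L2dot mu D f h - L2dot mu D g h.
Proof.
move=> fL gL hL; rewrite -cintegralB; try exact: inL2M_inL1.
by apply: eq_cintegral => x _; rewrite mulrBl.
Qed.

Lemma L2dot_suml (I : Type) (s : seq I) (c : I -> R[i]) (F : I -> T -> R[i]) g :
  (forall i, inL2 mu D (F i)) -> inL2 mu D g ->
  L2dot mu D (fun x => \sum_(i <- s) c i * F i x) g =
  \sum_(i <- s) c i * L2dot mu D (F i) g.
Proof.
move=> FL gL; rewrite /L2dot; under eq_cintegral do rewrite mulr_suml.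
rewrite cintegral_sum; last by move=> i; apply: inL2M_inL1 => //; exact: inL2Z.
apply: eq_bigr => i _; rewrite -cintegralZ; last exact: inL2M_inL1.
by apply: eq_cintegral => x _; rewrite mulrA.
Qed.

Lemma cintegral_conj f : inL1 mu D f ->
  cintegral mu D (fun x => (f x)^* ) = (cintegral mu D f)^*.
Proof.
move=> fL; apply: complex_ext; rewrite ?ReImE /=.
  by apply: eq_Rintegral => x _; rewrite Re_conj.
rewrite -[RHS]mulN1r -RintegralZl//; last exact: inL1_Im.
by apply: eq_Rintegral => x _; rewrite Im_conj mulN1r.
Qed.

Lemma L2dotC f g : inL2 mu D f -> inL2 mu D g -> L2dot mu D g f = (L2dot mu D f g)^*.
Proof.
move=> fL gL; rewrite -cintegral_conj; last exact: inL2M_inL1.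
by apply: eq_cintegral => x _; rewrite rmorphM/= conjcK mulrC.
Qed.

Lemma L2dotZr c f g : inL2 mu D f -> inL2 mu D g ->
  L2dot mu D f (fun x => c * g x) = c^* * L2dot mu D f g.
Proof.
move=> fL gL; rewrite -cintegralZ; last exact: inL2M_inL1.
by apply: eq_cintegral => x _; rewrite rmorphM/= mulrCA.
Qed.

Lemma L2dot_nrm f : inL2 mu D f -> L2dot mu D f f = (nrm mu D f ^+ 2)%:C.
Proof.
move=> fL; apply: complex_ext => /=.
  rewrite /nrm sqr_sqrtr ?fine_ge0 ?L2sqnorm_ge0//.
  by congr fine; apply: eq_integral => x _; rewrite mul_conjc.
by rewrite /Rintegral integral0_eq// => x _; rewrite mul_conjc.
Qed.

Lemma nrm2D f g : inL2 mu D f -> inL2 mu D g ->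
  nrm mu D (fun x => f x + g x) ^+ 2 =
  nrm mu D f ^+ 2 + nrm mu D g ^+ 2 + 2 * Re (L2dot mu D f g).
Proof.
move=> fL gL; have fgL := inL2D mD fL gL.
have Rr (a : R) : Re a%:C = a by [].
have := congr1 (@complex.Re _) (L2dot_nrm fgL).
rewrite L2dotDl// (L2dotC fgL fL) (L2dotC fgL gL) !L2dotDl// !ReImE.
rewrite (L2dotC fL gL) !L2dot_nrm// !ReImE !Rr; lra.
Qed.

(** Multiplying f by a unimodular c makes the inner product equal to its modulus. Squaring the
    triangle inequality for c f + g and cancelling the two square terms leaves the claim. *)
Lemma cauchy_schwarz f g : inL2 mu D f -> inL2 mu D g ->
  normc (L2dot mu D f g) <= nrm mu D f * nrm mu D g.
Proof.
move=> fL gL; have [c c1 cE] := rotate_to_norm (L2dot mu D f g).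
have cfL := inL2Z mD c fL.
have := nrmD mD cfL gL; rewrite -(ler_pXn2r (n:=2)) ?nnegrE ?addr_ge0 ?nrm_ge0//.
rewrite nrm2D// L2dotZl// cE nrmZ// c1 mul1r /= sqrrD; lra.
Qed.

End ComplexIntegral.

(** * Lebesgue measure on R^n and the characters of the torus *)

Section CountableSums.
Local Open Scope ereal_scope.
Context {R : realType} {I : countType}.

(** Gives access to the theorems on series over nat; codes that decode to no index contribute 0. *)
Lemma esum_countE (a : I -> \bar R) : (forall i, 0 <= a i) ->
  \esum_(i in [set: I]) a i =
  \sum_(k <oo) (if pickle_inv k is Some i then a i else 0).
Proof.
move=> a0.
have b0 k : 0 <= (if pickle_inv k is Some i then a i else 0).
  by case: pickle_inv.
rewrite nneseries_esumT//.
transitivity (\esum_(k in range (@choice.pickle I)) (if pickle_inv k is Some i then a i else 0)).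
  rewrite esum_image; last by move=> x y _ _; exact: (pcan_inj choice.pickleK).
  by apply: eq_esum => i _; rewrite pickleK_inv.
rewrite esum_mkcond; apply: eq_esum => k _; case: ifPn => // kr.
have := @pickle_invK I k; case: pickle_inv => //= i ik.
by exfalso; move: kr; apply/negP; rewrite negbK inE; exists i.
Qed.

Context d (T : measurableType d) (mu : {measure set T -> \bar R}) (D : set T).
Hypothesis mD : measurable D.

Lemma integral_esum (f : I -> T -> \bar R) :
  (forall i, measurable_fun D (f i)) -> (forall i x, D x -> 0 <= f i x) ->
  \int[mu]_(x in D) (\esum_(i in [set: I]) f i x) =
  \esum_(i in [set: I]) \int[mu]_(x in D) f i x.
Proof.
move=> mf f0; rewrite esum_countE; last by move=> i; apply: integral_ge0 => x; exact: f0.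
pose g k x := if @pickle_inv I k is Some i then f i x else 0.
transitivity (\int[mu]_(x in D) \sum_(k <oo) g k x).
  apply: eq_integral => x /[!inE] Dx; rewrite esum_countE// => i; exact: f0.
rewrite integral_nneseries//.
- by apply: eq_eseriesr => k _; rewrite /g; case: pickle_inv => //; rewrite integral0.
- by move=> k; rewrite /g; case: pickle_inv.
- by move=> k x Dx; rewrite /g; case: pickle_inv => // i; exact: f0.
Qed.

Lemma integral_countable_partition (A : I -> set T) (g : T -> \bar R) :
  (forall i, measurable (A i)) -> trivIset setT A -> D `<=` \bigcup_i A i ->
  measurable_fun D g -> (forall x, D x -> 0 <= g x) ->
  \int[mu]_(x in D) g x = \esum_(i in [set: I]) \int[mu]_(x in D `&` A i) g x.
Proof.
move=> mA tA DA mg g0; rewrite esum_countE; last first.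
  by move=> i; apply: integral_ge0 => x [Dx _]; exact: g0.
pose B k := if @pickle_inv I k is Some i then D `&` A i else set0.
have BD : D = \bigcup_k B k.
  apply/seteqP; split => x.
    move=> Dx; have [i _ Ax] := DA x Dx; exists (choice.pickle i) => //.
    by rewrite /B pickleK_inv.
  by case=> k _; rewrite /B; case: pickle_inv => // i [].
rewrite [in LHS]BD ge0_integral_bigcup//.
- by apply: eq_eseriesr => k _; rewrite /B; case: pickle_inv => //; rewrite integral_set0.
- by move=> k; rewrite /B; case: pickle_inv => // i; exact: measurableI.
- by rewrite -BD.
- by rewrite -BD.
- move=> i j _ _ [x []]; rewrite /B.
  have := @pickle_invK I i; have := @pickle_invK I j.
  case: (pickle_inv i) => //= a; case: (pickle_inv j) => //= b <- <- [_ Aa] [_ Ab].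
  by congr choice.pickle; apply: (tA a b) => //; exists x.
Qed.

End CountableSums.

Section RnMeasurability.
Local Open Scope complex_scope.
Context {R : realType} d (T : measurableType d).

Lemma cmeas_expi D (f : T -> R) : measurable_fun D f ->
  cmeasurable_fun D (fun x => expi (f x)).
Proof.
move=> mf; split => /=.
  by apply: measurableT_comp => //; apply: continuous_measurable_fun => x; exact: continuous_cos.
by apply: measurableT_comp => //; apply: continuous_measurable_fun => x; exact: continuous_sin.
Qed.

Lemma meas_radd n (f g : T -> Rn R n) : measurable_fun setT f ->
  measurable_fun setT g -> measurable_fun setT (fun x => radd (f x) (g x)).
Proof.
move=> /measurable_fun_tnthP mf /measurable_fun_tnthP mg; apply/measurable_fun_tnthP => i.
rewrite (_ : _ \o _ = (fun x => tnth (f x) i + tnth (g x) i)).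
  by apply: (measurable_funD (mf i) (mg i)).
by apply/funext => x /=; rewrite tnth_mktuple.
Qed.

Lemma meas_rsub n (f g : T -> Rn R n) : measurable_fun setT f ->
  measurable_fun setT g -> measurable_fun setT (fun x => rsub (f x) (g x)).
Proof.
move=> /measurable_fun_tnthP mf /measurable_fun_tnthP mg; apply/measurable_fun_tnthP => i.
rewrite (_ : _ \o _ = (fun x => tnth (f x) i - tnth (g x) i)).
  by apply: (measurable_funB (mf i) (mg i)).
by apply/funext => x /=; rewrite tnth_mktuple.
Qed.

Lemma meas_rdot n (f g : T -> Rn R n) : measurable_fun setT f ->
  measurable_fun setT g -> measurable_fun setT (fun x => rdot (f x) (g x)).
Proof.
move=> /measurable_fun_tnthP mf /measurable_fun_tnthP mg.
apply: measurable_sum => i.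
exact: (measurable_funM (mf i) (mg i)).
Qed.

End RnMeasurability.

Section RnVectors.
Context {R : realType} {n : nat}.
Implicit Types (x y z : Rn R n) (k l m : Zn n).

Lemma raddC x y : radd x y = radd y x.
Proof. by apply: eq_from_tnth => i; rewrite !tnth_mktuple addrC. Qed.

Lemma raddA x y z : radd x (radd y z) = radd (radd x y) z.
Proof. by apply: eq_from_tnth => i; rewrite !tnth_mktuple addrA. Qed.

Lemma rsubE x y : rsub x y = radd x [tuple - tnth y i | i < n].
Proof. by apply: eq_from_tnth => i; rewrite !tnth_mktuple. Qed.

Lemma raddK x y : rsub (radd x y) y = x.
Proof. by apply: eq_from_tnth => i; rewrite !tnth_mktuple addrK. Qed.

Lemma rsubK x y : radd (rsub x y) y = x.
Proof. by apply: eq_from_tnth => i; rewrite !tnth_mktuple subrK. Qed.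

Lemma Zn_to_RnD k l : Zn_to_Rn (k + l) = radd (Zn_to_Rn k) (Zn_to_Rn l) :> Rn R n.
Proof. by apply: eq_from_tnth => i; rewrite !tnth_mktuple mxE rmorphD. Qed.

Lemma rdotC x y : rdot x y = rdot y x.
Proof. by apply: eq_bigr => i _; rewrite mulrC. Qed.

Lemma rdotDl x y z : rdot (radd x y) z = rdot x z + rdot y z.
Proof. by rewrite /rdot -big_split; apply: eq_bigr => i _; rewrite tnth_mktuple mulrDl. Qed.

Lemma rdotDr x y z : rdot x (radd y z) = rdot x y + rdot x z.
Proof. by rewrite rdotC rdotDl !(rdotC x). Qed.

Lemma rdotBl x y z : rdot (rsub x y) z = rdot x z - rdot y z.
Proof. by apply/eqP; rewrite -subr_eq opprK -rdotDl rsubK. Qed.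

Lemma rdotBr x y z : rdot x (rsub y z) = rdot x y - rdot x z.
Proof. by rewrite rdotC rdotBl !(rdotC x). Qed.

Lemma rdot_ZZ k l : exists j : int, rdot (Zn_to_Rn k) (Zn_to_Rn l) = j%:~R :> R.
Proof.
exists (\sum_(i < n) k 0 i * l 0 i); rewrite rmorph_sum/=.
by apply: eq_bigr => i _; rewrite !tnth_mktuple rmorphM.
Qed.

Lemma Zn_to_Rn0 : Zn_to_Rn 0 = [tuple 0 | i < n] :> Rn R n.
Proof. by apply: eq_from_tnth => i; rewrite !tnth_mktuple mxE. Qed.

Lemma radd0 x : radd x (Zn_to_Rn 0) = x.
Proof. by apply: eq_from_tnth => i; rewrite Zn_to_Rn0 !tnth_mktuple addr0. Qed.

Lemma rsub0 x : rsub x (Zn_to_Rn 0) = x.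
Proof. by apply: eq_from_tnth => i; rewrite Zn_to_Rn0 !tnth_mktuple subr0. Qed.

Lemma rdot0r x : rdot x (Zn_to_Rn 0) = 0.
Proof. by rewrite Zn_to_Rn0; apply: big1 => i _; rewrite tnth_mktuple mulr0. Qed.

Lemma rdotNr x k : rdot x (Zn_to_Rn (- k)) = - rdot x (Zn_to_Rn k).
Proof.
rewrite /rdot -sumrN; apply: eq_bigr => i _.
by rewrite !tnth_mktuple mxE rmorphN mulrN.
Qed.

Lemma meas_cube : measurable (cube : set (Rn R n)).
Proof.
rewrite (_ : cube = \bigcap_(i in [set: 'I_n]) ((fun x => tnth x i) @^-1` `[0, 1[%classic)).
  apply: fin_bigcap_measurable => //= i _; rewrite -[X in measurable X]setTI.
  exact: measurable_tnth.
apply/seteqP; split=> [x Ax i _|x Ax i] /=; first by rewrite in_itv; exact: Ax.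
by have := Ax i I; rewrite /= in_itv.
Qed.

Lemma leb_cube : leb n (cube : set (Rn R n)) = 1%E.
Proof.
rewrite (_ : cube = [set x | forall i, `[0, 1[%classic (tnth x i)]).
  rewrite (leb_box (A := fun=> `[0, 1[%classic))//.
  by apply: big1 => i _; rewrite lebesgue_measure_itv/= lte_fin ltr01 oppr0 adde0.
by apply/seteqP; split=> [x Ax i|x Ax i] /=; have := Ax i; rewrite /= in_itv.
Qed.

Definition Rn_floor x : Zn n := \row_i Num.floor (tnth x i).

Lemma cube_floor x : cube (rsub x (Zn_to_Rn (Rn_floor x))).
Proof.
by move=> i; rewrite !tnth_mktuple mxE subr_ge0 ltrBlDr floor_le_tmp addrC -[1]/(1%:~R) -rmorphD/= floorD1_gt.
Qed.

Lemma cube_uniq x k : cube (rsub x (Zn_to_Rn k)) -> k = Rn_floor x.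
Proof.
move=> xk; apply/rowP => i; rewrite mxE; apply/esym/floor_def.
have := xk i; rewrite !tnth_mktuple subr_ge0 ltrBlDr => /andP[-> h] /=.
by rewrite rmorphD/= addrC.
Qed.

End RnVectors.

(** * Translation invariance and tiling of R^n by integer cubes *)

Section Translation.
Local Open Scope ereal_scope.
Context {R : realType}.

(** The image of Lebesgue measure under a translation gives half-open intervals their length, hence
    is Lebesgue measure by uniqueness. *)
Lemma lebesgue_integral_translate (a : R) (g : measurableTypeR R -> \bar R) :
  measurable_fun setT g -> (forall x, 0 <= g x) ->
  \int[lebesgue_measure]_x g (x + a)%R = \int[lebesgue_measure]_x g x.
Proof.
move=> mg g0.
have mt : measurable_fun setT (fun x : measurableTypeR R => (x + a)%R : measurableTypeR R).
  exact: measurable_funD.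
rewrite -(@ge0_integral_pushforward _ _ _ _ _ _ mt lebesgue_measure setT g)//.
apply: eq_measure_integral => A mA _; apply/esym.
apply: (@lebesgue_measure_unique R (measure_function_pushforward__canonical__measure_function_Measure lebesgue_measure mt)) => //.
move=> _ [[x y]] _ <-; rewrite /= /pushforward.
rewrite (_ : _ @^-1` _ = `](x - a)%R, (y - a)%R]%classic).
  rewrite !lebesgue_measure_itv/= !lte_fin ltrD2r; case: ifPn => // _.
  by rewrite -!EFinD; congr EFin; ring.
by apply/seteqP; split => z /=; rewrite !in_itv/= ltrBlDr lerBrDr.
Qed.

Lemma leb_consE n (g : Rn R n.+1 -> \bar R) :
  measurable_fun setT g -> (forall x, 0 <= g x) ->
  \int[leb n.+1]_x g x =
  \int[lebesgue_measure]_x \int[leb n]_y g (rn_cons (x, y)).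
Proof.
move=> mg g0; rewrite [LHS](@ge0_integral_pushforward _ _ _ _ _ _ (@measurable_rn_cons R n) (lebesgue_measure \x leb n) setT g)//.
rewrite preimage_setT fubini_tonelli1//; last by move=> x; exact: g0.
by apply: measurableT_comp => //; exact: measurable_rn_cons.
Qed.

(** One coordinate at a time, by Tonelli and the recursive construction of [leb]. *)
Lemma leb_translate n (a : Rn R n) (g : Rn R n -> \bar R) :
  measurable_fun setT g -> (forall x, 0 <= g x) ->
  \int[leb n]_x g (radd x a) = \int[leb n]_x g x.
Proof.
elim: n a g => [|n IH] a g mg g0.
  apply: eq_integral => x _; congr g.
  by apply: eq_from_tnth => -[].
have ma : measurable_fun setT (fun x => g (radd x a)).
  by apply: measurableT_comp => //; exact: meas_radd.
rewrite !leb_consE//.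
pose a' : Rn R n := [tuple of behead a].
have E x y : radd (rn_cons (x, y)) a = rn_cons (x + thead a, radd y a')%R.
  apply: eq_from_tnth => i; rewrite tnth_mktuple.
  have [j ->|->] := unliftP ord0 i; last by [].
  by rewrite !tnthS tnth_mktuple /a'; congr (_ + _)%R; rewrite {1}(tuple_eta a) tnthS.
under eq_integral do under eq_integral do rewrite E.
rewrite (@lebesgue_integral_translate (thead a) (fun x => \int[leb n]_y g (rn_cons (x, radd y a')))).
- apply: eq_integral => x _; apply: (IH a' (fun y => g (rn_cons (x, y)))) => //.
  apply: measurableT_comp => //.
  exact: (measurable_fun_pair2 _ (@measurable_rn_cons R n)).
- apply: (measurable_fun_fubini_tonelli_F (fun p => g (rn_cons (p.1, radd p.2 a')))) => //.
  apply: measurableT_comp => //; apply: measurableT_comp; first exact: measurable_rn_cons.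
  by apply: measurable_fun_pair => //; exact: meas_radd.
- by move=> x; exact: integral_ge0.
Qed.

End Translation.

Section ProductDomains.
Local Open Scope ereal_scope.
Context d1 d2 (T1 : measurableType d1) (T2 : measurableType d2) {R : realType}.
Context (m1 : {sigma_finite_measure set T1 -> \bar R}).
Context (m2 : {sigma_finite_measure set T2 -> \bar R}).
Variables (D1 : set T1) (D2 : set T2).
Hypotheses (mD1 : measurable D1) (mD2 : measurable D2).
Variable g : T1 * T2 -> \bar R.
Hypotheses (mg : measurable_fun setT g) (g0 : forall p, 0 <= g p).

Let mgr : measurable_fun setT (g \_ (D1 `*` D2)).
Proof. by apply/(measurable_restrictT _ _).1; [exact: measurableX|exact: measurable_funTS]. Qed.

Let gr0 p : 0 <= (g \_ (D1 `*` D2)) p.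
Proof. by apply: erestrict_ge0. Qed.

Let patchE x y : (g \_ (D1 `*` D2)) (x, y) =
  ((fun x => ((fun y => g (x, y)) \_ D2) y) \_ D1) x.
Proof. by rewrite /patch in_setX; case: (x \in D1); case: (y \in D2). Qed.

(** Extension of g by zero outside the rectangle reduces this to Tonelli on the whole product. *)
Lemma integral_setX12 : \int[m1 \x m2]_(p in D1 `*` D2) g p =
  \int[m1]_(x in D1) \int[m2]_(y in D2) g (x, y).
Proof.
rewrite integral_mkcond (fubini_tonelli1 _ mgr gr0) [RHS]integral_mkcond.
apply: eq_integral => x _; rewrite /fubini_F/= /patch.
case: ifPn => xD; last first.
  by apply: integral0_eq => y _; rewrite in_setX (negbTE xD).
rewrite [RHS]integral_mkcond; apply: eq_integral => y _.
by rewrite /patch in_setX xD.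
Qed.

Lemma integral_setX21 : \int[m1 \x m2]_(p in D1 `*` D2) g p =
  \int[m2]_(y in D2) \int[m1]_(x in D1) g (x, y).
Proof.
rewrite integral_mkcond (fubini_tonelli2 _ mgr gr0) [RHS]integral_mkcond.
apply: eq_integral => y _; rewrite /fubini_G/= /patch.
case: ifPn => yD; last first.
  by apply: integral0_eq => x _; rewrite in_setX (negbTE yD) andbF.
rewrite [RHS]integral_mkcond; apply: eq_integral => x _.
by rewrite /patch in_setX yD andbT.
Qed.

Lemma measurable_integral_snd :
  measurable_fun setT (fun x => \int[m2]_(y in D2) g (x, y)).
Proof.
rewrite (_ : (fun x => _) = fubini_F m2 (g \_ (setT `*` D2))).
  apply: measurable_fun_fubini_tonelli_F => [|p]; last exact: erestrict_ge0.
  by apply/(measurable_restrictT _ _).1; [exact: measurableX|exact: measurable_funTS].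
apply/funext => x; rewrite integral_mkcond; apply: eq_integral => y _.
by rewrite /patch in_setX in_setT.
Qed.

Lemma measurable_integral_fst :
  measurable_fun setT (fun y => \int[m1]_(x in D1) g (x, y)).
Proof.
rewrite (_ : (fun y => _) = fubini_G m1 (g \_ (D1 `*` setT))).
  apply: measurable_fun_fubini_tonelli_G => [|p]; last exact: erestrict_ge0.
  by apply/(measurable_restrictT _ _).1; [exact: measurableX|exact: measurable_funTS].
apply/funext => y; rewrite integral_mkcond; apply: eq_integral => x _.
by rewrite /patch in_setX in_setT andbT.
Qed.

End ProductDomains.

Section Tiling.
Local Open Scope ereal_scope.
Context {R : realType} {n : nat}.
Implicit Types (g : Rn R n -> \bar R) (a : Rn R n) (D : set (Rn R n)).

Lemma meas_shift_set D a : measurable D -> measurable [set y | D (rsub y a)].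
Proof.
move=> mD; have h : measurable_fun setT (fun y : Rn R n => rsub y a) by exact: meas_rsub.
by rewrite -[X in measurable X]setTI; exact: h.
Qed.

Lemma meas_comp_radd g a : measurable_fun setT g ->
  measurable_fun setT (fun x => g (radd a x)).
Proof. by move=> mg; apply: measurableT_comp => //; exact: meas_radd. Qed.

Lemma leb_translate_dom D a g : measurable D -> measurable_fun setT g ->
  (forall x, 0 <= g x) ->
  \int[leb n]_(x in D) g (radd a x) = \int[leb n]_(x in [set y | D (rsub y a)]) g x.
Proof.
move=> mD mg g0; have mDa := meas_shift_set a mD.
rewrite [RHS]integral_mkcond -(leb_translate a).
- rewrite integral_mkcond; apply: eq_integral => x _; rewrite /patch raddC.
  suff -> : (radd x a \in [set y | D (rsub y a)]) = (x \in D) by [].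
  by apply/idP/idP; rewrite !inE /= raddK.
- by apply/(measurable_restrictT _ _).1 => //; exact: measurable_funTS.
- by move=> x; exact: erestrict_ge0.
Qed.

Lemma leb_tile g : measurable_fun setT g -> (forall x, 0 <= g x) ->
  \int[leb n]_x g x =
  \esum_(m in [set: Zn n]) \int[leb n]_(x in cube) g (radd (Zn_to_Rn m) x).
Proof.
move=> mg g0.
rewrite (@integral_countable_partition _ _ _ _ _ _ _ (fun m : Zn n => [set x : Rn R n | cube (rsub x (Zn_to_Rn m))]))//.
- by apply: eq_esum => m _; rewrite setTI leb_translate_dom//; exact: meas_cube.
- by move=> m; apply: meas_shift_set; exact: meas_cube.
- by move=> k l _ _ [x [/= /cube_uniq -> /cube_uniq ->]].
- by move=> x _; exists (Rn_floor x) => //; exact: cube_floor.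
Qed.

(** The cube and its translate by a are both fundamental domains of Z^n. Each is cut by the integer
    translates of the other, and periodicity of g matches the pieces. *)
Lemma integral_cube_periodic g a : measurable_fun setT g -> (forall x, 0 <= g x) ->
  (forall m x, g (radd (Zn_to_Rn m) x) = g x) ->
  \int[leb n]_(x in cube) g (radd a x) = \int[leb n]_(x in cube) g x.
Proof.
move=> mg g0 pg; rewrite leb_translate_dom//; last exact: meas_cube.
have mC := meas_shift_set a (meas_cube : measurable (cube : set (Rn R n))).
rewrite integral_mkcond leb_tile; first last.
- by move=> x; exact: erestrict_ge0.
- by apply/(measurable_restrictT _ _).1 => //; exact: measurable_funTS.
rewrite [RHS](@integral_countable_partition _ _ _ _ _ _ _ (fun m : Zn n => [set x : Rn R n | cube (rsub (radd (Zn_to_Rn m) x) a)]))//.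
- apply: eq_esum => m _; rewrite [RHS]integral_mkcond [LHS]integral_mkcond.
  apply: eq_integral => x _; rewrite /patch in_setI pg.
  rewrite (_ : (radd _ x \in _) = (x \in [set x | cube (rsub (radd (Zn_to_Rn m) x) a)])).
    by case: (x \in cube).
  by apply/idP/idP; rewrite !inE.
- exact: meas_cube.
- move=> m; rewrite -[X in measurable X]setTI.
  have h : measurable_fun setT (fun x : Rn R n => rsub (radd (Zn_to_Rn m) x) a).
    by apply: meas_rsub => //; exact: meas_radd.
  by apply: h => //; exact: meas_cube.
- have E k x : cube (rsub (radd (Zn_to_Rn k) x) a) -> (- k)%R = Rn_floor (rsub x a).
    move=> h; apply: cube_uniq; rewrite (_ : rsub _ _ = rsub (radd (Zn_to_Rn k) x) a)//.
    apply: eq_from_tnth => i; rewrite !tnth_mktuple mxE rmorphN opprK /=.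
    by rewrite addrC addrA.
  by move=> k l _ _ [x [/= /E hk /E hl]]; apply: oppr_inj; rewrite hk hl.
- move=> x _; exists (- Rn_floor (rsub x a))%R => //=.
  have := cube_floor (rsub x a).
  rewrite (_ : rsub (rsub x a) _ = rsub (radd (Zn_to_Rn (- Rn_floor (rsub x a))%R) x) a)//.
  by apply: eq_from_tnth => i; rewrite !(tnth_mktuple, mxE) rmorphN addrAC (addrC (- _)%R).
- exact: measurable_funTS.
Qed.

End Tiling.

(** * Characters of the torus and their orthogonality *)

Section Characters.
Local Open Scope complex_scope.
Context {R : realType} {n : nat}.
Implicit Types (x y : Rn R n) (k l m : Zn n).

Definition zchar k x : R[i] := expi (2 * pi * rdot (Zn_to_Rn k) x).

Lemma zcharD k l x : zchar (k + l) x = zchar k x * zchar l x.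
Proof. by rewrite /zchar Zn_to_RnD rdotDl mulrDr expiD. Qed.

Lemma zchar_radd k x y : zchar k (radd x y) = zchar k x * zchar k y.
Proof. by rewrite /zchar rdotDr mulrDr expiD. Qed.

Lemma zchar_Zn k m : zchar k (Zn_to_Rn m) = 1.
Proof. by rewrite /zchar; have [j ->] := @rdot_ZZ R n k m; exact: expi_2pi_int. Qed.

Lemma zchar0 x : zchar 0 x = 1.
Proof. by rewrite /zchar rdotC rdot0r mulr0 expi0. Qed.

Lemma zcharN k x : zchar (- k) x = (zchar k x)^*.
Proof. by rewrite conj_expi /zchar rdotC rdotNr mulrN rdotC. Qed.

Lemma normc_zchar k x : normc (zchar k x) = 1.
Proof. exact: normc_expi. Qed.

Lemma cmeas_zchar k D : cmeasurable_fun D (zchar k).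
Proof.
apply: cmeas_expi; apply: measurable_funTS; apply: measurable_funM => //.
by apply: meas_rdot.
Qed.

(** Half a period in a coordinate i with k_i <> 0, that is 1 / (2 k_i). Translating by a then
    reverses the sign of the character, which will force its integral to vanish. *)
Lemma half_shift k : k != 0 -> exists a, zchar k a = -1.
Proof.
move=> /rV0Pn[i ki].
have ki0 : (k 0 i)%:~R != 0 :> R by rewrite intr_eq0.
exists [tuple if j == i then (2 * (k 0 i)%:~R)^-1 else 0 | j < n].
rewrite /zchar /rdot (bigD1 i)//= !tnth_mktuple eqxx big1 ?addr0; last first.
  by move=> j /negbTE ji; rewrite !tnth_mktuple ji mulr0.
rewrite (_ : 2 * pi * _ = pi); last by field.
by rewrite /expi cospi sinpi; apply: complex_ext; rewrite ?ReImE/= ?oppr0.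
Qed.

End Characters.

(** Lets a sign reversal be used although translation invariance is stated for nonnegative
    integrands: the reversal exchanges 1 + u and 1 - u, which are nonnegative, and equality of their
    integrals kills the integral of u. *)
Lemma Rintegral_alternating (R : realType) d (T : measurableType d)
    (mu : {measure set T -> \bar R}) (D : set T) (u : T -> R) :
  measurable D -> (mu D < +oo)%E -> measurable_fun D u -> (forall x, `|u x| <= 1) ->
  (\int[mu]_(x in D) (1 + u x)%:E = \int[mu]_(x in D) (1 - u x)%:E)%E ->
  \int[mu]_(x in D) u x = 0.
Proof.
move=> mD Doo mu' u1 E.
have i1 : mu.-integrable D (EFin \o (fun=> 1 : R)).
  apply/integrableP; split; first exact: measurable_cst.
  by under eq_integral do rewrite /= normr1; rewrite integral_cst// mul1e.
have iu : mu.-integrable D (EFin \o u).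
  apply: le_integrable i1 => //; first exact/measurable_EFinP.
  by move=> x _ /=; rewrite lee_fin normr1.
have := congr1 fine E.
rewrite -[LHS]/(\int[mu]_(x in D) (1 + u x)) -[RHS]/(\int[mu]_(x in D) (1 - u x)).
rewrite RintegralD// RintegralB//; lra.
Qed.

Lemma inL1_bounded_finite (R : realType) d (T : measurableType d)
    (mu : {measure set T -> \bar R}) (D : set T) (f : T -> R[i]) (M : R) :
  measurable D -> (mu D < +oo)%E -> 0 <= M ->
  cmeasurable_fun D f -> (forall x, D x -> normc (f x) <= M) -> inL1 mu D f.
Proof.
move=> mD Doo M0 mf fM; split => //.
apply: (@le_lt_trans _ _ (\int[mu]_(x in D) M%:E)%E); last first.
  by rewrite integral_cst// lte_mul_pinfty// ?lee_fin.
by apply: ge0_le_integral => //; [move=> x _; rewrite lee_fin normc_ge0|exact: emeas_normc].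
Qed.

Lemma inL2_bounded_finite (R : realType) d (T : measurableType d)
    (mu : {measure set T -> \bar R}) (D : set T) (f : T -> R[i]) (M : R) :
  measurable D -> (mu D < +oo)%E -> 0 <= M ->
  cmeasurable_fun D f -> (forall x, D x -> normc (f x) <= M) -> inL2 mu D f.
Proof.
move=> mD Doo M0 mf fM; split => //.
apply: (@le_lt_trans _ _ (\int[mu]_(x in D) (M ^+ 2)%:E)%E); last first.
  by rewrite integral_cst// lte_mul_pinfty// ?lee_fin ?sqr_ge0.
apply: ge0_le_integral => //.
- by move=> x _; rewrite lee_fin sqr_ge0.
- exact: emeas_normc2.
- by move=> x Dx; rewrite lee_fin ler_pXn2r ?nnegrE ?normc_ge0// fM.
Qed.

Lemma leb_cube_lty (R : realType) n :
  ((leb n : {measure set (Rn R n) -> \bar R}) cube < +oo)%E.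
Proof. by apply: (@le_lt_trans _ _ 1%E); rewrite ?ltry// -(@leb_cube R n). Qed.

Section CharacterOrthogonality.
Local Open Scope complex_scope.
Context {R : realType} {n : nat}.
Implicit Types (x y : Rn R n) (k l m : Zn n).

Let mcube := @meas_cube R n.

Let ReIm_expi_le1 (t : R) (p : R[i] -> R) : (forall z, `|p z| <= normc z) ->
  `|p (expi t)| <= 1.
Proof. by move=> pn; apply: le_trans (pn _) _; rewrite normc_expi. Qed.

Lemma cube_char_integral k : k != 0 ->
  cintegral (leb n) cube (zchar k : Rn R n -> R[i]) = 0.
Proof.
move=> k0; have [a ka] := @half_shift R n k k0.
have key (p : R[i] -> R) : (forall z, `|p z| <= normc z) ->
    (forall z, p (- z) = - p z) -> measurable_fun setT (fun x : Rn R n => p (zchar k x)) ->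
    \int[leb n]_(x in cube) p (zchar k x) = 0.
  move=> pn pN mp; apply: Rintegral_alternating => //.
  - exact: leb_cube_lty.
  - exact: measurable_funTS.
  - by move=> x; exact: ReIm_expi_le1.
  - rewrite -(@integral_cube_periodic _ _ (fun x => (1 + p (zchar k x))%:E) a).
    + by apply: eq_integral => x _; rewrite zchar_radd ka mulN1r pN.
    + by apply/measurable_EFinP; exact: measurable_funD.
    + move=> x; rewrite lee_fin -lerBlDl sub0r.
      by have /ler_normlP[] := @ReIm_expi_le1 (2 * pi * rdot (Zn_to_Rn k) x) p pn; rewrite lerNl.
    + by move=> m x; rewrite zchar_radd zchar_Zn mul1r.
apply: complex_ext => /=.
  by apply: (key (@complex.Re R)); [exact: normRe_le|exact: ReN|exact: (proj1 (cmeas_zchar k setT))].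
by apply: (key (@complex.Im R)); [exact: normIm_le|exact: ImN|exact: (proj2 (cmeas_zchar k setT))].
Qed.

Lemma cube_char_integral0 : cintegral (leb n) cube (zchar 0 : Rn R n -> R[i]) = 1.
Proof.
under eq_cintegral do rewrite zchar0.
apply: complex_ext => /=; rewrite Rintegral_cst//; last by rewrite mul0r.
by rewrite mul1r [X in fine X](_ : _ = 1%E)//; exact: leb_cube.
Qed.

Lemma inL2_zchar k : inL2 (leb n) cube (zchar k : Rn R n -> R[i]).
Proof.
apply: (@inL2_bounded_finite _ _ _ _ _ _ 1) => //.
- exact: leb_cube_lty.
- exact: cmeas_zchar.
- by move=> x _; rewrite normc_zchar.
Qed.

Lemma L2dot_zchar k l :
  L2dot (leb n) cube (zchar k : Rn R n -> R[i]) (zchar l) = (k == l)%:R.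
Proof.
transitivity (cintegral (leb n) cube (zchar (k - l) : Rn R n -> R[i])).
  by apply: eq_cintegral => x _; rewrite zcharD zcharN.
have [->|kl] := eqVneq k l; first by rewrite subrr cube_char_integral0.
by rewrite cube_char_integral// subr_eq0.
Qed.

Lemma inL2_trig (s : seq (Zn n)) (c : Zn n -> R[i]) :
  inL2 (leb n) cube (fun x : Rn R n => \sum_(m <- s) c m * zchar m x).
Proof. by apply: inL2_sum => // m; apply: inL2Z => //; exact: inL2_zchar. Qed.

(** Pythagoras, adding one character at a time. With repeated indices the coefficients would add up
    before being squared, hence [uniq]. *)
Lemma nrm_trig (s : seq (Zn n)) (c : Zn n -> R[i]) : uniq s ->
  nrm (leb n) cube (fun x : Rn R n => \sum_(m <- s) c m * zchar m x) ^+ 2 =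
  \sum_(m <- s) normc (c m) ^+ 2.
Proof.
elim: s => [_|m s IH /= /andP[ms us]].
  rewrite big_nil (_ : (fun x => _) = fun=> 0).
    by rewrite /nrm L2sqnorm0/= sqrtr0 expr0n.
  by apply/funext => x; rewrite big_nil.
rewrite (_ : (fun x => \sum_(m0 <- m :: s) _) =
    (fun x => c m * zchar m x + \sum_(m0 <- s) c m0 * zchar m0 x)); last first.
  by apply/funext => x; rewrite big_cons.
have mL : inL2 (leb n) cube (fun x : Rn R n => c m * zchar m x).
  by apply: inL2Z => //; exact: inL2_zchar.
rewrite nrm2D//; last exact: inL2_trig.
rewrite IH// big_cons nrmZ//; last exact: inL2_zchar.
rewrite L2dotZl//; [|exact: inL2_zchar|exact: inL2_trig].
rewrite (L2dotC mcube (inL2_trig _ _) (inL2_zchar m)).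
rewrite L2dot_suml//; [|by move=> i; exact: inL2_zchar|exact: inL2_zchar].
have -> : \sum_(i <- s) c i * L2dot (leb n) cube (zchar i) (zchar m : Rn R n -> R[i]) = 0.
  rewrite big_seq; apply: big1 => i si.
  rewrite L2dot_zchar; case: eqVneq => [im|]; last by rewrite mulr0.
  by move: ms; rewrite -im si.
rewrite (_ : 0^* = 0 :> R[i]); last by apply: complex_ext; rewrite ?ReImE/= ?oppr0.
rewrite mulr0 /= mulr0 addr0; congr (_ + _).
have nn := nrm_ge0 (leb n) cube (zchar m : Rn R n -> R[i]).
have : nrm (leb n) cube (zchar m : Rn R n -> R[i]) ^+ 2 = 1.
  have := L2dot_nrm (inL2_zchar m); rewrite L2dot_zchar eqxx.
  by move=> /(congr1 (@complex.Re _)) /= <-.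
by move=> n1; rewrite exprMn n1 mulr1.
Qed.

Lemma L2sqnorm_trig (s : seq (Zn n)) (c : Zn n -> R[i]) : uniq s ->
  L2sqnorm (leb n) cube (fun x : Rn R n => \sum_(m <- s) c m * zchar m x) =
  (\sum_(m <- s) normc (c m) ^+ 2)%:E.
Proof. by move=> us; rewrite nrm2E ?nrm_trig//; exact: inL2_trig. Qed.

Definition zchar2 (kl : Zn n * Zn n) (p : R2n R n) : R[i] :=
  zchar kl.1 p.1 * zchar kl.2 p.2.

Lemma zchar2E kl p : zchar2 kl p =
  expi (2 * pi * (rdot (Zn_to_Rn kl.1) p.1 + rdot (Zn_to_Rn kl.2) p.2)).
Proof. by rewrite mulrDr expiD. Qed.

Lemma cmeas_zchar2 kl D : cmeasurable_fun D (zchar2 kl).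
Proof.
rewrite (_ : zchar2 kl = fun p => expi (2 * pi * (rdot (Zn_to_Rn kl.1) p.1 + rdot (Zn_to_Rn kl.2) p.2))).
  apply: cmeas_expi; apply: measurable_funTS; apply: measurable_funM => //.
  by apply: measurable_funD; apply: meas_rdot.
by apply/funext => p; rewrite zchar2E.
Qed.

Lemma normc_zchar2 kl p : normc (zchar2 kl p) = 1.
Proof. by rewrite Normc.normcM !normc_zchar mulr1. Qed.

Definition cube2 : set (R2n R n) := cube `*` cube.

Lemma meas_cube2 : measurable cube2.
Proof. exact: measurableX. Qed.

Lemma leb_cube2 : leb2 cube2 = 1%E.
Proof. transitivity (leb n (cube : set (Rn R n)) * leb n (cube : set (Rn R n)))%E.
  by apply: product_measure1E; exact: mcube.
by rewrite leb_cube mule1. Qed.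

Lemma cube2_char_integral (kl : Zn n * Zn n) : kl != (0, 0) ->
  cintegral leb2 cube2 (zchar2 kl) = 0.
Proof.
case: kl => k l kl0.
have key (p : R[i] -> R) : (forall z, `|p z| <= normc z) ->
    (forall z, p (- z) = - p z) -> measurable_fun setT (fun q => p (zchar2 (k, l) q)) ->
    \int[leb2]_(q in cube2) p (zchar2 (k, l) q) = 0.
  move=> pn pN mp; apply: Rintegral_alternating => //.
  - exact: meas_cube2.
  - by have -> := leb_cube2; rewrite ltry.
  - exact: measurable_funTS.
  - by move=> x; rewrite zchar2E; exact: ReIm_expi_le1.
  - have p1 (x : R2n R n) : 0 <= 1 + p (zchar2 (k, l) x).
      rewrite -lerBlDl sub0r zchar2E.
      by have /ler_normlP[] := ReIm_expi_le1 (2 * pi * (rdot (Zn_to_Rn k) x.1 + rdot (Zn_to_Rn l) x.2)) pn; rewrite lerNl.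
    have p1' (x : R2n R n) : 0 <= 1 - p (zchar2 (k, l) x).
      rewrite subr_ge0 zchar2E.
      by have /ler_normlP[] := ReIm_expi_le1 (2 * pi * (rdot (Zn_to_Rn k) x.1 + rdot (Zn_to_Rn l) x.2)) pn.
    have mpp : measurable_fun setT (fun q => (1 + p (zchar2 (k, l) q))%:E : \bar R).
      by apply/measurable_EFinP; exact: measurable_funD.
    have mpm : measurable_fun setT (fun q => (1 - p (zchar2 (k, l) q))%:E : \bar R).
      by apply/measurable_EFinP; exact: measurable_funB.
    (* The half-period shift takes place in the second variable, or in the first one when l = 0, k
       being nonzero in that case. *)
    have [l0|l0] := eqVneq l 0.
      have [k0|k0] := eqVneq k 0; first by move: kl0; rewrite k0 l0 eqxx.
      have [a ka] := @half_shift R n k k0.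
      rewrite /leb2 /cube2 (integral_setX21 _ _ mcube mcube mpp)//.
      rewrite (integral_setX21 _ _ mcube mcube mpm)//.
      apply: eq_integral => y _; rewrite -(@integral_cube_periodic _ _ (fun x => (1 + p (zchar2 (k, l) (x, y)))%:E) a).
      + by apply: eq_integral => x _; rewrite /zchar2/= zchar_radd ka mulN1r mulNr pN.
      + exact: (measurable_fun_pair1 y mpp).
      + by move=> x; rewrite lee_fin.
      + by move=> m x; rewrite /zchar2/= zchar_radd zchar_Zn mul1r.
    have [a la] := @half_shift R n l l0.
    rewrite /leb2 /cube2 (integral_setX12 _ _ mcube mcube mpp)//.
    rewrite (integral_setX12 _ _ mcube mcube mpm)//.
    apply: eq_integral => x _; rewrite -(@integral_cube_periodic _ _ (fun y => (1 + p (zchar2 (k, l) (x, y)))%:E) a).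
    + by apply: eq_integral => y _; rewrite /zchar2/= zchar_radd la mulN1r mulrN pN.
    + exact: (measurable_fun_pair2 x mpp).
    + by move=> y; rewrite lee_fin.
    + by move=> m y; rewrite /zchar2/= zchar_radd zchar_Zn mul1r.
apply: complex_ext => /=.
  by apply: (key (@complex.Re R)); [exact: normRe_le|exact: ReN|exact: (proj1 (cmeas_zchar2 (k, l) setT))].
by apply: (key (@complex.Im R)); [exact: normIm_le|exact: ImN|exact: (proj2 (cmeas_zchar2 (k, l) setT))].
Qed.

Lemma cube2_char_integral0 : cintegral leb2 cube2 (zchar2 (0, 0)) = 1.
Proof.
have mc := meas_cube2.
under eq_cintegral do rewrite /zchar2 !zchar0 mulr1.
apply: complex_ext => /=; rewrite Rintegral_cst//; last by rewrite mul0r.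
by rewrite mul1r [X in fine X](_ : _ = 1%E)//; exact: leb_cube2.
Qed.

End CharacterOrthogonality.

(** * Density in weighted L^2 spaces *)

Section L2Dominated.
Local Open Scope complex_scope.
Context d (T : measurableType d) {R : realType}.
Variables (mu : {measure set T -> \bar R}) (D : set T).
Hypothesis mD : measurable D.
Implicit Types (f g h : T -> R[i]) (c : R[i]).

Lemma L2_dominated (h_ : nat -> T -> R[i]) g :
  (forall j, cmeasurable_fun D (h_ j)) -> inL2 mu D g ->
  (forall x, D x -> ccvg (h_ ^~ x) 0) ->
  (forall j x, D x -> normc (h_ j x) <= normc (g x)) ->
  forall e, 0 < e -> \forall j \near \oo, nrm mu D (h_ j) < e.
Proof.
move=> mh [mg g2] h0 hg e e0.
have hL j : inL2 mu D (h_ j) by apply: inL2_le (hg j) => //; split.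
have ig : mu.-integrable D (fun x => (normc (g x) ^+ 2)%:E).
  apply/integrableP; split; first exact: emeas_normc2.
  by under eq_integral do rewrite /= ger0_norm ?sqr_ge0//; exact: g2.
have [||||_ _] := @dominated_convergence _ _ _ mu D mD
   (fun j x => (normc (h_ j x) ^+ 2)%:E) (fun=> 0%E) _ _ _ _ ig.
- by move=> j; exact: emeas_normc2.
- exact: measurable_cst.
- apply: aeW => x Dx; apply: cvg_EFin; first exact: nearW.
  by have := ccvg_normc2 (h0 x Dx); rewrite Normc.normc0 expr0n.
- apply: aeW => x j Dx /=; rewrite lee_fin ger0_norm ?sqr_ge0//.
  by rewrite ler_pXn2r ?nnegrE ?normc_ge0// hg.
rewrite integral0 => /fine_cvgP[_ /cvgrPdist_lt].
move=> /(_ (e ^+ 2)) /(_ _)/wrap[]; first by rewrite exprn_gt0.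
apply: filterS => j; rewrite sub0r normrN /= -/(L2sqnorm mu D (h_ j)) nrm2E//= .
rewrite ger0_norm ?sqr_ge0// ltr_pXn2r ?nnegrE ?nrm_ge0//.
exact: ltW.
Qed.

Lemma inL2_bounded_mul (s f : T -> R[i]) (M : R) : inL2 mu D s ->
  cmeasurable_fun D f -> 0 <= M -> (forall x, D x -> normc (f x) <= M) ->
  inL2 mu D (fun x => f x * s x) /\
  nrm mu D (fun x => f x * s x) <= M * nrm mu D s.
Proof.
move=> sL mf M0 fM.
have MsL : inL2 mu D (fun x => M%:C * s x) by exact: inL2Z.
have mfs : cmeasurable_fun D (fun x => f x * s x) by apply: cmeasM => //; exact: (proj1 sL).
have le x : D x -> normc (f x * s x) <= normc (M%:C * s x).
  move=> Dx; rewrite !Normc.normcM ler_wpM2r ?normc_ge0// normc_real ger0_norm//.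
  exact: fM.
have fsL := inL2_le mD mfs MsL le; split => //.
have := le_L2sqnorm mu mD mfs (proj1 MsL) le.
by rewrite (nrm2E fsL) (nrm2E MsL) lee_fin ler_pXn2r ?nnegrE ?nrm_ge0// nrmZ// normc_real ger0_norm.
Qed.

End L2Dominated.

(** With [bernoulli_sub], this controls the powers (1 - t^k)^(k 2^k) on either side of t = 1/2. *)
Lemma bernoulli_add (R : realType) (m : nat) (y : R) : 0 <= y ->
  1 + m%:R * y <= (1 + y) ^+ m.
Proof.
move=> y0; elim: m => [|m IH]; first by rewrite mul0r addr0 expr0.
rewrite exprS; apply: (@le_trans _ _ ((1 + y) * (1 + m%:R * y))); last first.
  by rewrite ler_wpM2l// addr_ge0.
have : 0 <= m%:R * y * y by rewrite !mulr_ge0.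
rewrite -natr1; lra.
Qed.

Lemma bernoulli_sub (R : realType) (m : nat) (y : R) : 0 <= y <= 1 ->
  1 - m%:R * y <= (1 - y) ^+ m.
Proof.
move=> /andP[y0 y1]; elim: m => [|m IH]; first by rewrite mul0r subr0 expr0.
rewrite exprS; apply: (@le_trans _ _ ((1 - y) * (1 - m%:R * y))); last first.
  by rewrite ler_wpM2l// subr_ge0.
have : 0 <= m%:R * y * y by rewrite !mulr_ge0.
rewrite -natr1; lra.
Qed.

Lemma cvg_nat_mul_geometric (R : realType) (q : R) : 0 <= q < 1 ->
  k%:R * q ^+ k @[k --> \oo] --> 0.
Proof.
move=> /andP[q0 q1]; have [->|qn0] := eqVneq q 0.
  rewrite (_ : (fun k => _) = fun=> 0); first exact: cvg_cst.
  by apply/funext => -[|k]; rewrite ?mul0r// expr0n mulr0.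
have qp : 0 < q by rewrite lt_neqAle eq_sym qn0.
(* Half of the decay pays for the factor k: with 1 / r = 1 + dl, Bernoulli gives k r^k <= 1 / dl, so
   k q^k <= r^k / dl. *)
pose r := Num.sqrt q.
have r0 : 0 < r by rewrite sqrtr_gt0.
have rr : r ^+ 2 = q by rewrite sqr_sqrtr.
have r1 : r < 1 by rewrite -(ltr_pXn2r (n:=2)) ?nnegrE ?(ltW r0)// rr expr1n.
pose dl := r^-1 - 1.
have d0 : 0 < dl by rewrite subr_gt0 invf_gt1.
apply: (squeeze_cvgr (f:=fun=> 0) (h:=fun k => dl^-1 * r ^+ k)).
- near=> k; rewrite mulr_ge0 ?exprn_ge0//=.
  have b := bernoulli_add k (ltW d0).
  have rE : 1 + dl = r^-1 by rewrite /dl addrC subrK.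
  rewrite rE in b.
  have b' : k%:R * dl <= r^-1 ^+ k by apply: le_trans b; rewrite lerDr.
  rewrite -rr -exprM mulnC exprM expr2 mulrA ler_wpM2r ?exprn_ge0 ?(ltW r0)//.
  by rewrite -[leRHS]mul1r ler_pdivlMr// mulrAC -ler_pdivlMr ?exprn_gt0// mul1r -exprVn.
- exact: cvg_cst.
- rewrite -(mulr0 dl^-1); apply: cvgM; first exact: cvg_cst.
  by apply: cvg_expr; rewrite ger0_norm// ltW.
Unshelve. all: by end_near. Qed.

(* On [0,1), an arc starting at 0 is a superlevel set of a trigonometric
   polynomial of degree 1. *)
Lemma cos_arc (R : realType) (c a : R) : 0 <= c < 1 -> 0 < a <= 1 ->
  (cos (pi * a) < cos (2 * pi * c - pi * a)) = (0 < c < a).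
Proof.
move=> /andP[c0 c1] /andP[a0 a1].
have p0 := @pi_gt0 R.
have apos : 0 <= pi * a <= pi by rewrite mulr_ge0 ?(ltW p0) ?(ltW a0)//= ger_pMr.
have E : 2 * pi * c - pi * a = pi * (2 * c - a) by ring.
have [ca|ca] := ltP c a.
  have [cz|cz] := ltP 0 c; last first.
    have -> : c = 0 by apply/eqP; rewrite eq_le cz c0.
    by rewrite mulr0 add0r cosN ltxx.
  rewrite -(cosN (_ - _)).
  have [h|h] := leP (2 * c - a) 0.
    rewrite ltr_cos ?in_itv//= E -mulrN.
      by rewrite ltr_pM2l//; lra.
    by apply/andP; split; [rewrite mulr_ge0 ?(ltW p0)//; lra|rewrite ger_pMr//; lra].
  rewrite cosN ltr_cos ?in_itv//= E.
    by rewrite ltr_pM2l//; lra.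
  by apply/andP; split; [rewrite mulr_ge0 ?(ltW p0)//; lra|rewrite ger_pMr//; lra].
rewrite andbF; apply/negbTE; rewrite -leNgt E.
have [h|h] := leP (2 * c - a) 1.
  rewrite leNgt ltr_cos ?in_itv//= ?ltr_pM2l//; first by lra.
  by apply/andP; split; [rewrite mulr_ge0 ?(ltW p0)//; lra|rewrite ger_pMr//; lra].
(* Here the angle exceeds pi. Reflecting it brings it back to pi (2 - (2 c - a)), which lies in
   [0, pi] and beyond pi a because c < 1. *)
rewrite -(cosN (pi * (2 * c - a))) -(cosD2pi (- _)).
rewrite (_ : - (pi * (2 * c - a)) + pi *+ 2 = pi * (2 - (2 * c - a))); last by rewrite mulr2n; ring.
rewrite leNgt ltr_cos ?in_itv//= ?ltr_pM2l//; first by lra.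
by apply/andP; split; [rewrite mulr_ge0 ?(ltW p0)//; lra|rewrite ger_pMr//; lra].
Qed.

Section Density.
Local Open Scope complex_scope.
Context d (T : measurableType d) {R : realType}.
Variables (mu : {measure set T -> \bar R}) (D : set T).
Hypothesis mD : measurable D.
Variable (s : T -> R[i]).
Hypothesis sL : inL2 mu D s.
Variable A : set (T -> R[i]).
Hypothesis A_cst : forall c, A (fun=> c).
Hypothesis A_add : forall f g, A f -> A g -> A (fun x => f x + g x).
Hypothesis A_mul : forall f g, A f -> A g -> A (fun x => f x * g x).
Hypothesis A_meas : forall f, A f -> cmeasurable_fun D f.
Hypothesis A_bnd : forall f, A f -> exists2 M, 0 <= M & forall x, D x -> normc (f x) <= M.

(** Membership in the closure of A in L^2(|s|^2 mu), the weight being carried by the factor s rather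
    than by the measure. Boundedness is built in because it makes the class closed under
    products. *)
Definition approximable f := [/\ cmeasurable_fun D f,
  exists2 M : R, 0 <= M & forall x, D x -> normc (f x) <= M &
  forall e, 0 < e -> exists2 p, A p & nrm mu D (fun x => (f x - p x) * s x) < e].

Let diffL f g : cmeasurable_fun D f -> cmeasurable_fun D g ->
  (exists2 M : R, 0 <= M & forall x, D x -> normc (f x) <= M) ->
  (exists2 M : R, 0 <= M & forall x, D x -> normc (g x) <= M) ->
  inL2 mu D (fun x => (f x - g x) * s x).
Proof.
move=> mf mg [M M0 fM] [N N0 gN].
have [||||] := @inL2_bounded_mul _ _ _ mu D mD s (fun x => f x - g x) (M + N) => //.
- exact: cmeasB.
- exact: addr_ge0.
- move=> x Dx; apply: le_trans (normc_triangle _ _) _.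
  by rewrite normc_opp lerD ?fM ?gN.
Qed.

Lemma approximable_sub f : A f -> approximable f.
Proof.
move=> Af; split; [exact: A_meas|exact: A_bnd|] => e e0; exists f => //.
rewrite (_ : (fun x => _) = fun=> 0); last by apply/funext => x; rewrite subrr mul0r.
by rewrite /nrm L2sqnorm0/= sqrtr0.
Qed.

Lemma approximable_near f : cmeasurable_fun D f ->
  (exists2 M : R, 0 <= M & forall x, D x -> normc (f x) <= M) ->
  (forall e, 0 < e -> exists2 g, approximable g &
     nrm mu D (fun x => (f x - g x) * s x) < e) -> approximable f.
Proof.
move=> mf bf fg; split => // e e0; have e2 : 0 < e / 2 by rewrite divr_gt0.
have [g [mg bg gA] hg] := fg _ e2; have [p Ap hp] := gA _ e2.
exists p => //; rewrite (_ : (fun x => _) = (fun x => (f x - g x) * s x + (g x - p x) * s x)).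
  rewrite (splitr e); apply: le_lt_trans (nrmD mD _ _) _; last exact: ltrD.
    exact: diffL.
  by apply: diffL => //; [exact: A_meas|exact: A_bnd].
by apply/funext => x; rewrite -mulrDl subrKA.
Qed.

Lemma approximableD f g : approximable f -> approximable g ->
  approximable (fun x => f x + g x).
Proof.
move=> [mf [M M0 fM] fA] [mg [N N0 gN] gA]; split; first exact: cmeasD.
  exists (M + N) => [|x Dx]; first exact: addr_ge0.
  by apply: le_trans (normc_triangle _ _) _; rewrite lerD ?fM ?gN.
move=> e e0; have e2 : 0 < e / 2 by rewrite divr_gt0.
have [p Ap hp] := fA _ e2; have [q Aq hq] := gA _ e2.
exists (fun x => p x + q x); first exact: A_add.
rewrite (_ : (fun x => _) = (fun x => (f x - p x) * s x + (g x - q x) * s x)).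
  rewrite (splitr e); apply: le_lt_trans (nrmD mD _ _) _; last exact: ltrD.
    by apply: diffL; [|exact: A_meas|exists M|exact: A_bnd].
  by apply: diffL; [|exact: A_meas|exists N|exact: A_bnd].
by apply/funext => x; rewrite -mulrDl opprD addrACA.
Qed.

Let mul_sub f p : approximable f -> A p -> approximable (fun x => f x * p x).
Proof.
move=> [mf [M M0 fM] fA] Ap; have mp := A_meas Ap; have [N N0 pN] := A_bnd Ap.
split; first exact: cmeasM.
  exists (M * N) => [|x Dx]; first exact: mulr_ge0.
  by rewrite Normc.normcM ler_pM ?normc_ge0 ?fM ?pN.
move=> e e0; have N1 : 0 < N + 1 by rewrite ltr_wpDl.
have [q Aq hq] := fA _ (divr_gt0 e0 N1).
exists (fun x => q x * p x); first exact: A_mul.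
rewrite (_ : (fun x => _) = (fun x => p x * ((f x - q x) * s x))); last first.
  by apply/funext => x; rewrite -mulrBl mulrAC mulrC mulrA.
have dL : inL2 mu D (fun x => (f x - q x) * s x).
  by apply: diffL; [|exact: A_meas|exists M|exact: A_bnd].
have [_ le] := inL2_bounded_mul mD dL mp N0 pN.
apply: le_lt_trans le _; apply: (@le_lt_trans _ _ ((N + 1) * nrm mu D (fun x => (f x - q x) * s x))).
  by rewrite ler_wpM2r ?nrm_ge0// lerDl.
by rewrite mulrC -ltr_pdivlMr.
Qed.

(** Only one factor can be replaced at a time: f g is close to f q with q in A since f is bounded,
    and f q is approximable by [mul_sub] since q is bounded. *)
Lemma approximableM f g : approximable f -> approximable g ->
  approximable (fun x => f x * g x).
Proof.
move=> fH [mg [N N0 gN] gA]; have [mf [M M0 fM] fA] := fH.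
have bfg : exists2 K : R, 0 <= K & forall x, D x -> normc (f x * g x) <= K.
  exists (M * N) => [|x Dx]; first exact: mulr_ge0.
  by rewrite Normc.normcM ler_pM ?normc_ge0 ?fM ?gN.
apply: approximable_near => //; first exact: cmeasM.
move=> e e0; have M1 : 0 < M + 1 by rewrite ltr_wpDl.
have [q Aq hq] := gA _ (divr_gt0 e0 M1).
exists (fun x => f x * q x); first exact: mul_sub.
rewrite (_ : (fun x => _) = (fun x => f x * ((g x - q x) * s x))); last first.
  by apply/funext => x; rewrite -mulrBr mulrA.
have dL : inL2 mu D (fun x => (g x - q x) * s x).
  by apply: diffL; [|exact: A_meas|exists N|exact: A_bnd].
have [_ le] := inL2_bounded_mul mD dL mf M0 fM.
apply: le_lt_trans le _; apply: (@le_lt_trans _ _ ((M + 1) * nrm mu D (fun x => (g x - q x) * s x))).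
  by rewrite ler_wpM2r ?nrm_ge0// lerDl.
by rewrite mulrC -ltr_pdivlMr.
Qed.

Lemma approximable_cst c : approximable (fun=> c).
Proof. exact: approximable_sub. Qed.

Lemma approximableZ c f : approximable f -> approximable (fun x => c * f x).
Proof. by move=> fH; apply: approximableM => //; exact: approximable_cst. Qed.

Lemma approximableB f g : approximable f -> approximable g ->
  approximable (fun x => f x - g x).
Proof.
move=> fH /(approximableZ (-1)); under eq_fun do rewrite mulN1r.
exact: approximableD.
Qed.

Lemma approximable_sum (I : Type) (r : seq I) (F : I -> T -> R[i]) :
  (forall i, approximable (F i)) -> approximable (fun x => \sum_(i <- r) F i x).
Proof.
move=> mF; elim: r => [|i r IH].
  by under eq_fun do rewrite big_nil; exact: approximable_cst.
by under eq_fun do rewrite big_cons; exact: approximableD.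
Qed.

Lemma approximableX f k : approximable f -> approximable (fun x => f x ^+ k).
Proof.
move=> fH; elim: k => [|k IH].
  by under eq_fun do rewrite expr0; exact: approximable_cst.
by under eq_fun do rewrite exprS; exact: approximableM.
Qed.

Lemma eq_approximable f g : (forall x, D x -> f x = g x) -> approximable f -> approximable g.
Proof.
move=> fg [mf [M M0 fM] fA]; split.
- by apply: eq_cmeas mf => x /[!inE]; exact: fg.
- by exists M => // x Dx; rewrite -fg// fM.
- move=> e /fA[p Ap pe]; exists p => //.
  rewrite /nrm (_ : L2sqnorm mu D _ = L2sqnorm mu D (fun x => (f x - p x) * s x))//.
  by apply: eq_L2sqnorm => x Dx; rewrite fg.
Qed.

(** The weighted differences are dominated by 2 M |s|, which is square integrable. *)
Lemma approximable_lim (f_ : nat -> T -> R[i]) f (M : R) : 0 <= M ->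
  (forall j, approximable (f_ j)) ->
  (forall x, D x -> ccvg (f_ ^~ x) (f x)) ->
  (forall j x, D x -> normc (f_ j x) <= M) ->
  (forall x, D x -> normc (f x) <= M) -> approximable f.
Proof.
move=> M0 fH cv fM' fM.
have mf_ j : cmeasurable_fun D (f_ j) by have [] := fH j.
have mf := cmeas_cvg mf_ cv.
apply: approximable_near => //; first by exists M.
move=> e e0.
have [N _ /(_ N (leqnn N)) /= h] : \forall j \near \oo, nrm mu D (fun x => (f x - f_ j x) * s x) < e.
  apply: (@L2_dominated _ _ _ mu D mD (fun j x => (f x - f_ j x) * s x) (fun x => (M + M)%:C * s x)) => //.
  - by move=> j; apply: cmeasM => //; [exact: cmeasB|exact: (proj1 sL)].
  - exact: inL2Z.
  - move=> x Dx; rewrite (_ : 0 = (f x - f x) * s x); last by rewrite subrr mul0r.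
    apply: ccvgM; last exact: ccvg_cst.
    by apply: ccvgB; [exact: ccvg_cst|exact: cv].
  - move=> j x Dx; rewrite !Normc.normcM ler_wpM2r ?normc_ge0//.
    rewrite normc_real ger0_norm ?addr_ge0//.
    by apply: le_trans (normc_triangle _ _) _; rewrite normc_opp lerD// ?fM// fM'.
by exists (f_ N).
Qed.

(* The polynomials (1 - t^k)^(k 2^k) tend to 1 for 0 <= t < 1/2 and to 0 for
   1/2 <= t <= 1. *)
Lemma approximable_half_cut (phi : T -> R) :
  approximable (fun x => (phi x)%:C) -> (forall x, D x -> 0 <= phi x <= 1) ->
  approximable (fun x => ((phi x < 2^-1)%R : bool)%:R).
Proof.
move=> fH f01.
pose h k x := (1 - phi x ^+ k) ^+ (k * 2 ^ k).
have h01 k x : D x -> 0 <= h k x <= 1.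
  move=> /f01/andP[f0 f1].
  have p0 : 0 <= phi x ^+ k by exact: exprn_ge0.
  have p1 : phi x ^+ k <= 1 by exact: exprn_ile1.
  have h0 : 0 <= 1 - phi x ^+ k by rewrite subr_ge0.
  by rewrite exprn_ge0//= exprn_ile1// gerBl.
apply: (@approximable_lim (fun k x => (h k x)%:C) _ 1) => //.
- move=> k; rewrite (_ : (fun x => _) = (fun x => (1 - (phi x)%:C ^+ k) ^+ (k * 2 ^ k))).
    apply: approximableX; apply: approximableB; first exact: approximable_cst.
    exact: approximableX.
  by apply/funext => x; rewrite /h rmorphXn rmorphB rmorph1 rmorphXn.
- move=> x Dx; suff cv : h k x @[k --> \oo] --> (((phi x < 2^-1)%R)%:R : R).
    have bC (b : bool) : (b%:R : R[i]) = (b%:R : R)%:C by case: b.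
    by rewrite bC; split; [exact: cv|exact: cvg_cst].
  have /andP[f0 f1] := f01 x Dx.
  have [fl|fl] := ltP (phi x) 2^-1.
    have q01 : 0 <= 2 * phi x < 1.
      by rewrite mulr_ge0//= mulrC -ltr_pdivlMr ?mul1r// -[ltRHS]mul1r.
    have kq := cvg_nat_mul_geometric q01.
    (* Bernoulli bounds h from below by 1 - k 2^k phi^k, and k (2 phi)^k tends to 0 because 2 phi <
       1. *)
    apply: (squeeze_cvgr (f:=fun k => 1 - k%:R * (2 * phi x) ^+ k) (h:=fun=> 1)).
    - near=> k; have /andP[_ ->] := h01 k x Dx; rewrite andbT.
      rewrite exprMn mulrA -natrX -natrM; apply: bernoulli_sub.
      by rewrite exprn_ge0// exprn_ile1.
    - by rewrite -[X in _ --> X]subr0; apply: cvgB => //; exact: cvg_cst.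
    - exact: cvg_cst.
  apply: (squeeze_cvgr (f:=fun=> 0) (h:=@harmonic R)).
  - near=> k; have /andP[-> _] := h01 k x Dx => /=.
    set y := phi x ^+ k.
    have y0 : 0 <= y by exact: exprn_ge0.
    have y1 : y <= 1 by exact: exprn_ile1.
    (* With m = k 2^k one has (1 - y)^m (1 + y)^m <= 1, so a lower bound for (1 + y)^m bounds h from
       above. Since 2 phi >= 1, Bernoulli gives k + 1, whence h <= 1 / (k + 1). *)
    have b : k.+1%:R <= (1 + y) ^+ (k * 2 ^ k).
      apply: le_trans (bernoulli_add _ y0).
      rewrite -natr1 addrC lerD2l natrM natrX -mulrA -exprMn.
      rewrite ler_peMr// exprn_ege1// mulrC -ler_pdivrMr// mul1r; exact: fl.
    have : (1 - y) ^+ (k * 2 ^ k) * (1 + y) ^+ (k * 2 ^ k) <= 1.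
      rewrite -exprMn; apply: exprn_ile1.
        by rewrite mulr_ge0 ?subr_ge0// addr_ge0.
      have := sqr_ge0 y; nra.
    rewrite /harmonic/= -[_^-1]mul1r ler_pdivlMr//; apply: le_trans.
    by rewrite ler_wpM2l// exprn_ge0// subr_ge0.
  - exact: cvg_cst.
  - exact: cvg_harmonic.
- by move=> k x Dx; rewrite normc_real; have /andP[h0 h1] := h01 k x Dx; rewrite ger0_norm.
- by move=> x Dx; case: (_ < _); rewrite ?Normc.normc1 ?Normc.normc0.
Unshelve. all: by end_near. Qed.

Definition approximable_sets : set (set T) :=
  [set E : set T | approximable (fun x => (x \in E)%:R : R[i])].

Lemma approximable_setC E : approximable_sets E -> approximable_sets (~` E).
Proof.
move=> EH; rewrite /approximable_sets/=.
rewrite (_ : (fun x => _) = (fun x => 1 - (x \in E)%:R)).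
  by apply: approximableB => //; exact: approximable_cst.
by apply/funext => x; rewrite in_setC; case: (x \in E); rewrite ?subrr ?subr0.
Qed.

Lemma approximable_setI E F : approximable_sets E -> approximable_sets F ->
  approximable_sets (E `&` F).
Proof.
move=> EH FH; rewrite /approximable_sets/=.
rewrite (_ : (fun x => _) = (fun x => (x \in E)%:R * (x \in F)%:R)).
  exact: approximableM.
by apply/funext => x; rewrite in_setI -natrM mulnb.
Qed.

Lemma approximable_setU E F : approximable_sets E -> approximable_sets F ->
  approximable_sets (E `|` F).
Proof.
move=> EH FH; rewrite -(setCK (E `|` F)) setCU.
by apply/approximable_setC/approximable_setI; exact: approximable_setC.
Qed.

Lemma approximable_set0 : approximable_sets set0.
Proof.
rewrite /approximable_sets/= (_ : (fun x => _) = fun=> 0).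
  exact: approximable_cst.
by apply/funext => x; rewrite in_set0.
Qed.

(** Finite unions come from products and complements; countable ones are bounded pointwise limits of
    finite ones. *)
Lemma sigma_algebra_approximable : sigma_algebra setT approximable_sets.
Proof.
split; first exact: approximable_set0.
  by move=> E EH; rewrite setTD; exact: approximable_setC.
move=> E EH; pose U j := \big[setU/set0]_(i < j) E i.
apply: (@approximable_lim (fun j x => (x \in U j)%:R) _ 1) => //.
- move=> j; rewrite /U; elim: j => [|j IH].
    by rewrite big_ord0; exact: approximable_set0.
  by rewrite big_ord_recr /=; exact: approximable_setU.
- move=> x Dx; have [xU|xU] := boolP (x \in \bigcup_k E k); last first.
    rewrite (_ : (fun j => _) = fun=> 0); first exact: ccvg_cst.
    apply/funext => j; case: (boolP (x \in U j)) => // xj; exfalso.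
    move/negP: xU; apply; move: xj; rewrite /U !inE -bigcup_mkord.
    by move=> [i /= _ Ex]; exists i.
  move: xU; rewrite inE => -[i _ Ex].
  have ev (p : R[i] -> R) : p ((x \in U j)%:R) @[j --> \oo] --> p 1.
    apply: cvg_near_cst; exists i.+1 => // j /= ij.
    rewrite (_ : x \in U j)//; rewrite inE /U.
    by rewrite (bigD1 (Ordinal ij))//=; left.
  by split; exact: ev.
- by move=> j x _; case: (_ \in _); rewrite ?Normc.normc1 ?Normc.normc0.
- by move=> x _; case: (_ \in _); rewrite ?Normc.normc1 ?Normc.normc0.
Qed.

Section coordinates.
Variables (J : Type) (co : J -> T -> R).
Hypothesis co01 : forall i x, D x -> 0 <= co i x < 1.
Hypothesis co_char : forall i (b : bool), A (fun x => expi ((-1) ^+ b * (2 * pi * co i x))).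
(* The coordinates generate the sigma-algebra of T. *)
Hypothesis co_meas : forall d' (T' : measurableType d') (f : T' -> T),
  (forall i, measurable_fun setT (fun t => co i (f t))) -> measurable_fun setT f.

Let arc i a : 0 < a <= 1 -> approximable_sets [set x | 0 < co i x < a].
Proof.
move=> /andP[a0 a1].
(* By [cos_arc], phi < 1/2 exactly on the arc. A difference of cosines has modulus at most 2, so
   division by 4 keeps phi in [0, 1], as [approximable_half_cut] demands. *)
pose phi x := 2^-1 + (cos (pi * a) - cos (2 * pi * co i x - pi * a)) / 4.
apply: (eq_approximable (f := fun x => (phi x < 2^-1)%R%:R)) => [x Dx|].
  have -> : (phi x < 2^-1) = (cos (pi * a) < cos (2 * pi * co i x - pi * a)).
    by rewrite /phi gtrDl pmulr_llt0 ?invr_gt0// subr_lt0.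
  rewrite cos_arc ?a0//; last exact: co01.
  congr ((_ : bool)%:R); apply/idP/idP; rewrite inE//.
apply: approximable_half_cut => [|x Dx]; last first.
  have := cos_le1 (pi * a); have := cos_geN1 (pi * a).
  have := cos_le1 (2 * pi * co i x - pi * a); have := cos_geN1 (2 * pi * co i x - pi * a).
  rewrite /phi; lra.
apply: approximable_sub.
(* Euler's formula for the cosine: the coefficients -1/8 are -1/4 times the 1/2 of cos t = (e^(it) +
   e^(-it)) / 2. *)
pose C : R[i] := (2^-1 + cos (pi * a) / 4)%:C.
rewrite (_ : (fun x => _) = (fun x => C +
   ((- 8^-1)%:C * expi (- (pi * a)) * expi ((-1) ^+ false * (2 * pi * co i x)) +
    (- 8^-1)%:C * expi (pi * a) * expi ((-1) ^+ true * (2 * pi * co i x))))).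
  apply: A_add; first exact: A_cst.
  by apply: A_add; apply: A_mul; rewrite ?A_cst//; exact: co_char.
apply/funext => x; rewrite expr0 expr1 mul1r mulN1r /phi cosB /C.
move: (2 * pi * co i x) (pi * a) => t u.
by apply: complex_ext; rewrite !ReImE /= ?cosN ?sinN; lra.
Qed.

(** T is given a second sigma-algebra, that of the approximable sets. The identity from the new
    structure to the old one is measurable as soon as the coordinates are, so only the rays {co < a}
    have to be examined. *)
Lemma approximable_measurable E : measurable E -> approximable_sets E.
Proof.
move=> mE; pose T' := g_sigma_algebraType approximable_sets.
have sB : <<s approximable_sets >> = approximable_sets.
  exact: sigma_algebra_id sigma_algebra_approximable.
have mB (F : set T') : measurable F -> approximable_sets F by rewrite /measurable/= sB.
have Bm (F : set T') : approximable_sets F -> measurable F by rewrite /measurable/= sB.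
suff mid : measurable_fun setT (idfun : T' -> T).
  by apply: mB; have := mid measurableT _ mE; rewrite setTI.
apply: co_meas => i mT; apply: (measurability _ (RGenInftyO.measurableE R)) => //.
move=> _ [_ [a ->] <-]; rewrite setTI; apply: Bm.
(* [arc] omits the endpoint 0. On D the zero set of the coordinate is the complement of the arc with
   a = 1; it is added to the arc to form the ray. *)
have zero : approximable_sets [set x | co i x <= 0].
  have h1 : 0 < (1 : R) <= 1 by rewrite ltr01 lexx.
  have := approximable_setC (arc i h1).
  apply: eq_approximable => x Dx; congr ((_ : bool)%:R).
  apply/idP/idP; rewrite !inE /=; have /andP[c0 c1] := co01 i Dx; rewrite c1 andbT leNgt => /negP//.
have [a0|a0] := leP a 0.
  apply: eq_approximable approximable_set0 => x Dx; congr ((_ : bool)%:R).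
  rewrite in_set0; apply/esym/negbTE/negP; rewrite inE /= in_itv/=.
  by have /andP[c0 c1] := co01 i Dx => h; have := le_lt_trans c0 (lt_le_trans h a0); rewrite ltxx.
have [a1|a1] := leP a 1; last first.
  apply: eq_approximable (approximable_setC approximable_set0) => x Dx; congr ((_ : bool)%:R).
  apply/idP/idP; rewrite !inE /= ?in_itv/= => _; last by [].
  by have /andP[c0 c1] := co01 i Dx; apply: lt_trans a1.
have aa : 0 < a <= 1 by rewrite a0.
apply: eq_approximable (approximable_setU zero (arc i aa)) => x Dx; congr ((_ : bool)%:R).
apply/idP/idP; rewrite !inE /= in_itv/=.
  by move=> [c0|/andP[]//]; exact: le_lt_trans a0.
by move=> ca; have [c0|c0] := leP (co i x) 0; [left|right; rewrite ca].
Qed.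

(** f is the pointwise limit of simple functions below it, hence bounded by M, and simple functions
    are combinations of approximable indicators. *)
Lemma approximable_bounded_ge0 (f : T -> R) (M : R) : measurable_fun setT f ->
  (forall x, 0 <= f x <= M) -> approximable (fun x => (f x)%:C).
Proof.
move=> mf fM.
have f0 x : 0 <= f x by have /andP[] := fM x.
have M0 : 0 <= M by exact: le_trans (f0 point) (proj2 (andP (fM point))).
have mf' : measurable_fun setT (EFin \o f) by exact/measurable_EFinP.
pose g := nnsfun_approx measurableT mf'.
have gf j x : 0 <= g j x <= f x.
  rewrite fun_ge0 /=.
  have cv := cvg_nnsfun_approx measurableT mf' (fun x _ => f0 x : (0 <= (f x)%:E)%E) (x:=x) I.
  have cv' : g j x @[j --> \oo] --> f x by move/fine_cvgP: cv => [].
  have nd : {homo (g ^~ x) : n m / (n <= m)%N >-> n <= m}.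
    by move=> n m nm; have /lefP := nd_nnsfun_approx measurableT mf' nm; exact.
  rewrite -(cvg_lim _ cv')//; apply: nondecreasing_cvgn_le => //.
  by apply/cvg_ex; exists (f x).
apply: (@approximable_lim (fun j x => (g j x)%:C) _ M) => //.
- move=> j.
  rewrite (_ : (fun x => _) = (fun x => \sum_(y <- fset_set (range (g j))) y%:C * (x \in g j @^-1` [set y])%:R)).
    apply: approximable_sum => y; apply: approximableZ.
    by apply: approximable_measurable; rewrite -[X in measurable X]setTI; exact: measurable_funPT.
  apply/funext => x; rewrite [in LHS]fimfunE fsbig_finite//= rmorph_sum/=.
  by apply: eq_bigr => y _; rewrite rmorphM/= indicE; case: (_ \in _).
- move=> x Dx; have cv := cvg_nnsfun_approx measurableT mf' (fun x _ => f0 x : (0 <= (f x)%:E)%E) (x:=x) I.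
  by split => /=; [move/fine_cvgP: cv => []|exact: cvg_cst].
- move=> j x _; have /andP[g0 gfx] := gf j x; rewrite normc_real ger0_norm//.
  by apply: le_trans gfx _; have /andP[] := fM x.
- by move=> x _; rewrite normc_real ger0_norm//; have /andP[] := fM x.
Qed.

(** Both components are shifted into [0, 2 M], approximated there, and shifted back. *)
Lemma approximable_bounded (f : T -> R[i]) (M : R) : cmeasurable_fun setT f ->
  (forall x, normc (f x) <= M) -> approximable f.
Proof.
move=> [f1 f2] fM.
have Rb x : 0 <= Re (f x) + M <= M + M.
  have /ler_normlP[h1 h2] := le_trans (normRe_le _) (fM x).
  by rewrite lerD2r h2 andbT -lerBlDr sub0r lerNl.
have Ib x : 0 <= Im (f x) + M <= M + M.
  have /ler_normlP[h1 h2] := le_trans (normIm_le _) (fM x).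
  by rewrite lerD2r h2 andbT -lerBlDr sub0r lerNl.
have a1 := approximable_bounded_ge0 (measurable_funD f1 (measurable_cst M)) Rb.
have a2 := approximable_bounded_ge0 (measurable_funD f2 (measurable_cst M)) Ib.
have := approximableD (approximableB a1 (approximable_cst M%:C))
  (approximableZ 'i (approximableB a2 (approximable_cst M%:C))).
apply: eq_approximable => x _; apply: complex_ext; rewrite !ReImE/=; lra.
Qed.

End coordinates.

End Density.

Section CharacterSpans.
Local Open Scope complex_scope.
Context {R : realType} d (T : measurableType d) (J : zmodType) (e : J -> T -> R[i]).
Hypothesis e0 : forall x, e 0 x = 1.
Hypothesis eD : forall j k x, e (j + k) x = e j x * e k x.
Hypothesis e1 : forall j x, normc (e j x) = 1.
Hypothesis me : forall j, cmeasurable_fun setT (e j).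

Lemma cspan_cst c : cspan e (fun=> c).
Proof. by exists [:: (c, 0)]; apply/funext => x; rewrite big_seq1 e0 mulr1. Qed.

Lemma cspanD f g : cspan e f -> cspan e g -> cspan e (fun x => f x + g x).
Proof.
by move=> [s ->] [t ->]; exists (s ++ t); apply/funext => x; rewrite big_cat.
Qed.

Lemma cspanM f g : cspan e f -> cspan e g -> cspan e (fun x => f x * g x).
Proof.
move=> [s ->] [t ->]; exists [seq (p.1 * q.1, p.2 + q.2) | p <- s, q <- t].
apply/funext => x; rewrite big_allpairs_dep mulr_suml; apply: eq_bigr => p _.
by rewrite mulr_sumr; apply: eq_bigr => q _ /=; rewrite eD mulrACA.
Qed.

Lemma cmeas_cspan D f : measurable D -> cspan e f -> cmeasurable_fun D f.
Proof.
move=> mD [s ->]; apply: cmeas_sum => // p; apply: cmeasZ => //.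
by split; apply: measurable_funTS; [exact: (proj1 (me _))|exact: (proj2 (me _))].
Qed.

Lemma cspan_bounded f : cspan e f -> exists2 M, 0 <= M & forall x, normc (f x) <= M.
Proof.
move=> [s ->]; exists (\sum_(p <- s) normc p.1) => [|x].
  by apply: sumr_ge0 => p _; exact: normc_ge0.
elim: s => [|p s IH]; first by rewrite !big_nil Normc.normc0.
rewrite !big_cons; apply: le_trans (normc_triangle _ _) _.
by rewrite lerD// Normc.normcM e1 mulr1.
Qed.

(** Terms with the same index are merged, as the norm formulas for trigonometric sums need distinct
    frequencies. *)
Lemma cspan_uniq f : cspan e f -> exists s (c : J -> R[i]), uniq s /\
  f = fun x => \sum_(j <- s) c j * e j x.
Proof.
move=> [s ->]; exists (undup (unzip2 s)), (fun j => \sum_(p <- s | p.2 == j) p.1).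
split; first exact: undup_uniq.
apply/funext => x; under [in RHS]eq_bigr do rewrite mulr_suml big_mkcond.
rewrite exchange_big/= big_seq [RHS]big_seq; apply: eq_bigr => p ps.
rewrite (bigD1_seq p.2) ?undup_uniq//=; last by rewrite mem_undup; exact: map_f.
by rewrite eqxx big1 ?addr0// => j /negbTE; rewrite eq_sym => ->.
Qed.

End CharacterSpans.

(** * Density of trigonometric polynomials and Parseval's identity *)

Section TrigDensity.
Local Open Scope complex_scope.
Context {R : realType} {n : nat}.

Lemma rdot_delta (i : 'I_n) (x : Rn R n) : rdot (Zn_to_Rn (delta_mx 0 i)) x = tnth x i.
Proof.
rewrite /rdot (bigD1 i)//= tnth_mktuple mxE !eqxx mul1r big1 ?addr0// => j ji.
by rewrite tnth_mktuple mxE (negbTE ji) andbF mul0r.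
Qed.

Lemma zchar_dense (s : Rn R n -> R[i]) f M : inL2 (leb n) cube s ->
  cmeasurable_fun setT f -> (forall x, normc (f x) <= M) ->
  forall eps, 0 < eps -> exists2 p, cspan (@zchar R n) p &
    nrm (leb n) cube (fun x => (f x - p x) * s x) < eps.
Proof.
move=> sL mf fM.
have mz k : cmeasurable_fun setT (zchar k : Rn R n -> R[i]) by exact: cmeas_zchar.
have := @approximable_bounded _ _ _ (leb n) cube (@meas_cube R n) s sL
  (cspan (@zchar R n)) (cspan_cst (@zchar0 R n)) (@cspanD _ _ _ _ _)
  (cspanM (@zcharD R n)) (fun f => cmeas_cspan mz (@meas_cube R n)) _
  'I_n (fun i x => tnth x i) _ _ _ f M mf fM.
case=> //.
- move=> g gA; have [K K0 gK] := cspan_bounded (@normc_zchar R n) gA.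
  by exists K => // x _; exact: gK.
- move=> i b; exists [:: (1, (-1) ^+ b *: delta_mx 0 i)]; apply/funext => x.
  rewrite big_seq1 mul1r /zchar; congr expi; case: b.
    by rewrite expr1 scaleN1r rdotC rdotNr rdotC rdot_delta mulN1r mulrN.
  by rewrite expr0 scale1r rdot_delta mul1r.
- by move=> d' T' g mg; apply/measurable_fun_tnthP.
Qed.

Lemma zchar2_dense (s : R2n R n -> R[i]) f M : inL2 leb2 cube2 s ->
  cmeasurable_fun setT f -> (forall x, normc (f x) <= M) ->
  forall eps, 0 < eps -> exists2 p, cspan (@zchar2 R n) p &
    nrm leb2 cube2 (fun x => (f x - p x) * s x) < eps.
Proof.
move=> sL mf fM.
have mz k : cmeasurable_fun setT (zchar2 k : R2n R n -> R[i]) by exact: cmeas_zchar2.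
have z0 x : zchar2 (0 : Zn n * Zn n) x = 1 :> R[i] by rewrite /zchar2 !zchar0 mulr1.
have zD (j k : Zn n * Zn n) x : zchar2 (j + k) x = zchar2 j x * zchar2 k x :> R[i].
  by rewrite /zchar2 !zcharD mulrACA.
have := @approximable_bounded _ _ _ leb2 cube2 (@meas_cube2 R n) s sL
  (cspan (@zchar2 R n)) (cspan_cst z0) (@cspanD _ _ _ _ _)
  (cspanM zD) (fun f => cmeas_cspan mz (@meas_cube2 R n)) _
  ('I_n + 'I_n)%type (fun i p => match i with inl i => tnth p.1 i | inr i => tnth p.2 i end) _ _ _ f M mf fM.
case=> //.
- move=> g gA; have [K K0 gK] := cspan_bounded (@normc_zchar2 R n) gA.
  by exists K => // x _; exact: gK.
- by move=> [] i [x y] [].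
- move=> [] i b.
    exists [:: (1, ((-1) ^+ b *: delta_mx 0 i, 0))]; apply/funext => x.
    rewrite big_seq1 mul1r /zchar2 zchar0 mulr1 /zchar; congr expi; case: b.
      by rewrite expr1 scaleN1r rdotC rdotNr rdotC rdot_delta mulN1r mulrN.
    by rewrite expr0 scale1r rdot_delta mul1r.
  exists [:: (1, (0, (-1) ^+ b *: delta_mx 0 i))]; apply/funext => x.
  rewrite big_seq1 mul1r /zchar2 zchar0 mul1r /zchar; congr expi; case: b.
    by rewrite expr1 scaleN1r rdotC rdotNr rdotC rdot_delta mulN1r mulrN.
  by rewrite expr0 scale1r rdot_delta mul1r.
- move=> d' T' g mg; apply/measurable_fun_pairP; split; apply/measurable_fun_tnthP => i.
    exact: (mg (inl i)).
  exact: (mg (inr i)).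
Qed.

(** g is replaced by 0 where |g| exceeds a large integer; the bounded function so obtained falls
    under [zchar_dense] with constant weight 1. *)
Lemma zchar_dense_L2 (g : Rn R n -> R[i]) : cmeasurable_fun setT g ->
  inL2 (leb n) cube g -> forall eps, 0 < eps -> exists2 p, cspan (@zchar R n) p &
    nrm (leb n) cube (fun x => g x - p x) < eps.
Proof.
move=> mg gL eps eps0; have mc := @meas_cube R n.
have e2 : 0 < eps / 2 by rewrite divr_gt0.
pose h (j : nat) x : R[i] := g x * ((normc (g x) <= j%:R)%R%:R : R)%:C.
have mh j : cmeasurable_fun setT (h j).
  apply: cmeasM => //; split => /=; last exact: measurable_cst.
  rewrite (_ : (fun x => _) = \1_[set x | normc (g x) <= j%:R]).
    apply: measurable_indic; rewrite -[X in measurable X]setTI.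
    have mle : measurable_fun setT (fun x => normc (g x) <= j%:R).
      by apply: measurable_fun_ler; [exact: measurable_normc|exact: measurable_cst].
    exact: (mle measurableT [set true]).
  by apply/funext => x; rewrite indicE; congr ((_ : bool)%:R); apply/idP/idP; rewrite inE.
have mh' j : cmeasurable_fun cube (h j).
  by split; apply: measurable_funTS; [exact: (proj1 (mh j))|exact: (proj2 (mh j))].
have hg j x : normc (h j x) <= normc (g x).
  rewrite /h Normc.normcM normc_real; case: (_ <= j%:R); first by rewrite normr1 mulr1.
  by rewrite normr0 mulr0 normc_ge0.
have [N _ /(_ N (leqnn N)) /= hN] : \forall j \near \oo, nrm (leb n) cube (fun x => g x - h j x) < eps / 2.
  apply: (@L2_dominated _ _ _ (leb n) cube mc (fun j x => g x - h j x) (fun x => 2%:C * g x)) => //.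
  - by move=> j; apply: cmeasB => //; exact: (proj1 gL).
  - exact: inL2Z.
  - move=> x _; have E (p : R[i] -> R) : p (g x - h j x) @[j --> \oo] --> p 0.
      apply: cvg_near_cst; near=> j; rewrite /h (_ : (_ <= _) = true) ?mulr1 ?subrr//.
      near: j; exact: nbhs_infty_ger.
    by split; exact: E.
  - move=> j x _; apply: le_trans (normc_triangle _ _) _.
    rewrite normc_opp [leRHS]Normc.normcM normc_real ger0_norm// mulr_natl mulr2n.
    by rewrite lerD2l hg.
have oneL : inL2 (leb n) cube (fun=> 1 : R[i]).
  apply: (@inL2_bounded_finite _ _ _ _ _ _ 1) => //; first exact: leb_cube_lty.
  by move=> x _; rewrite Normc.normc1.
have hb x : normc (h N x) <= N%:R.
  rewrite /h Normc.normcM normc_real; have [gN|gN] := boolP (normc (g x) <= N%:R).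
    by rewrite normr1 mulr1.
  by rewrite normr0 mulr0.
have [p Ap pe] := zchar_dense oneL (mh N) hb e2; exists p => //.
have pL : inL2 (leb n) cube p.
  have [K K0 pK] := cspan_bounded (@normc_zchar R n) Ap.
  apply: (@inL2_bounded_finite _ _ _ _ _ _ K) => //; first exact: leb_cube_lty.
  by apply: cmeas_cspan Ap => // k; exact: cmeas_zchar.
have hL : inL2 (leb n) cube (h N) by apply: inL2_le gL _ => // x _; exact: hg.
apply: le_lt_trans (nrm_dist3 mc gL hL pL) _; rewrite (splitr eps) ltrD//.
by move: pe; under [in X in X -> _]eq_fun do rewrite mulr1.
Unshelve. all: by end_near. Qed.

(** Both halves of Parseval follow from this expansion: Bessel's inequality when the c_k are the
    Fourier coefficients, and the optimality of the latter among all coefficients. *)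
Lemma nrm_sub_trig (g : Rn R n -> R[i]) (s : seq (Zn n)) (c : Zn n -> R[i]) :
  inL2 (leb n) cube g -> uniq s ->
  nrm (leb n) cube (fun x => g x - \sum_(k <- s) c k * zchar k x) ^+ 2 =
  nrm (leb n) cube g ^+ 2 + \sum_(k <- s) (normc (c k) ^+ 2 -
     2 * Re (c k * (L2dot (leb n) cube g (zchar k))^* )).
Proof.
move=> gL us; have mc := @meas_cube R n; have SL := inL2_trig s c.
rewrite nrm2D//; last exact: inL2N.
rewrite nrmN nrm_trig// sumrB addrA; congr (_ + _).
rewrite (L2dotC mc (inL2N SL) gL) Re_conj.
under [X in L2dot _ _ X]eq_fun do rewrite -mulN1r.
rewrite L2dotZl// mulN1r ReN mulrN -mulr_sumr.
rewrite L2dot_suml//; last by move=> k; exact: inL2_zchar.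
congr (- (2 * _)).
rewrite (_ : Re _ = \sum_(i <- s) Re (c i * L2dot (leb n) cube (zchar i) g)).
  by apply: eq_bigr => k _; rewrite (L2dotC mc gL (inL2_zchar k)).
by elim: (s) => [|k t IH]; rewrite ?big_nil// !big_cons ReD IH.
Qed.

Lemma parseval (g : Rn R n -> R[i]) : cmeasurable_fun setT g ->
  inL2 (leb n) cube g ->
  (\esum_(k in [set: Zn n]) (normc (L2dot (leb n) cube g (zchar k)) ^+ 2)%:E)%E =
  L2sqnorm (leb n) cube g.
Proof.
move=> mg gL; rewrite nrm2E//; pose c k := L2dot (leb n) cube g (zchar k).
apply/eqP; rewrite eq_le; apply/andP; split.
  apply: ge_ereal_sup => _ [F [finF _] <-].
  rewrite fsbig_finite// sumEFin lee_fin -/c.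
  have := sqr_ge0 (nrm (leb n) cube (fun x => g x - \sum_(k <- fset_set F) c k * zchar k x)).
  rewrite nrm_sub_trig ?fset_uniq//.
  suff -> : \sum_(k <- fset_set F) (normc (c k) ^+ 2 - 2 * Re (c k * (c k)^* )) =
      - \sum_(k <- fset_set F) normc (c k) ^+ 2 by rewrite subr_ge0.
  rewrite -sumrN; apply: eq_bigr => k _.
  by rewrite mul_conjc; rewrite -[Re _]/(normc (c k) ^+ 2); ring.
apply/lee_addgt0Pr => e e0.
have [p /cspan_uniq[s [a [us ->]]] pe] : exists2 p, cspan (@zchar R n) p &
    nrm (leb n) cube (fun x => g x - p x) < Num.sqrt e.
  by apply: zchar_dense_L2 => //; rewrite sqrtr_gt0.
have pe2 : nrm (leb n) cube (fun x => g x - \sum_(k <- s) a k * zchar k x) ^+ 2 <= e.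
  by rewrite -[leRHS](sqr_sqrtr (ltW e0)) ler_pXn2r ?nnegrE ?nrm_ge0 ?sqrtr_ge0 ?ltW.
apply: (@le_trans _ _ ((\sum_(k <- s) normc (c k) ^+ 2)%:E + e%:E)%E).
  rewrite -EFinD lee_fin; move: pe2; rewrite nrm_sub_trig//.
  suff : \sum_(k <- s) (- normc (c k) ^+ 2) <=
     \sum_(k <- s) (normc (a k) ^+ 2 - 2 * Re (a k * (c k)^* )).
    by rewrite sumrN; lra.
  apply: ler_sum => k _; rewrite !normc_sqE ReM Re_conj Im_conj.
  have := sqr_ge0 (Re (a k) - Re (c k)); have := sqr_ge0 (Im (a k) - Im (c k)); lra.
rewrite leeD2r// -sumEFin.
have -> : (\sum_(k <- s) (normc (c k) ^+ 2)%:E = \sum_(k \in [set` s]) (normc (c k) ^+ 2)%:E)%E.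
  by rewrite fsbig_seq.
apply: esum_ge; exists [set` s] => //; split; first exact: finite_seq.
by [].
Qed.

(** Parseval after the permutation k -> -k of Z^n, to agree with the sign of the exponent in
    [fourier]. *)
Lemma parseval_pos (g : Rn R n -> R[i]) : cmeasurable_fun setT g ->
  inL2 (leb n) cube g ->
  (\esum_(k in [set: Zn n])
     (normc (cintegral (leb n) cube (fun x => (g x * zchar k x)%R)) ^+ 2)%:E)%E =
  L2sqnorm (leb n) cube g.
Proof.
move=> mg gL; rewrite -(parseval mg gL).
have bij : set_bij [set: Zn n] [set: Zn n] (fun k : Zn n => - k).
  split; first by [].
    by move=> x y _ _ /oppr_inj.
  by move=> k _; exists (- k); rewrite ?opprK.
rewrite [RHS](@reindex_esum _ _ _ _ _ _ _ bij).
apply: eq_esum => k _; congr ((normc _ ^+ 2)%:E).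
rewrite /L2dot; apply: eq_cintegral => x _; congr (_ * _).
by apply: complex_ext; rewrite zcharN !ReImE ?opprK.
Qed.

End TrigDensity.

(** * The Fourier transform *)

Lemma cmeas_comp (R : realType) d1 d2 (T1 : measurableType d1) (T2 : measurableType d2)
    (f : T2 -> R[i]) (g : T1 -> T2) : cmeasurable_fun setT f ->
  measurable_fun setT g -> cmeasurable_fun setT (fun x => f (g x)).
Proof.
by move=> [m1 m2] mg; split; [exact: (measurableT_comp m1 mg)|exact: (measurableT_comp m2 mg)].
Qed.

Section ParametricIntegral.
Local Open Scope complex_scope.
Context d1 d2 (T1 : measurableType d1) (T2 : measurableType d2) {R : realType}.
Variable m2 : {sigma_finite_measure set T2 -> \bar R}.

(** Each component is [fine] of a difference of two Tonelli integrals, those of the positive and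
    negative parts; sections where the integral takes its default value are covered by this formula
    too. *)
Lemma cmeas_cintegral (G : T1 * T2 -> R[i]) : cmeasurable_fun setT G ->
  cmeasurable_fun setT (fun x => cintegral m2 setT (fun y => G (x, y))).
Proof.
have key (p : T1 * T2 -> R) : measurable_fun setT p ->
    measurable_fun setT (fun x => \int[m2]_(y in setT) p (x, y)).
  move=> mp; rewrite /Rintegral; apply: (measurableT_comp (f:=fine)) => //.
  have mE : measurable_fun setT (EFin \o p) by exact/measurable_EFinP.
  rewrite (_ : (fun x => _) =
    (fubini_F m2 (EFin \o p)^\+ \- fubini_F m2 (EFin \o p)^\-)%E).
    apply: emeasurable_funB; apply: measurable_fun_fubini_tonelli_F => //.
      exact: measurable_funepos.
    exact: measurable_funeneg.
  by apply/funext => x; rewrite [LHS]integralE; congr (_ - _)%E; apply: eq_integral => y _;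
    rewrite ?funeposE ?funenegE.
by move=> [mr mi]; split; [exact: (key (fun p => Re (G p)))|exact: (key (fun p => Im (G p)))].
Qed.

End ParametricIntegral.

Section Restriction.
Local Open Scope complex_scope.
Context d (T : measurableType d) {R : realType} (mu : {measure set T -> \bar R}).
Implicit Types (f g : T -> R[i]) (D : set T).

Lemma cmeasT D f : measurable D -> cmeasurable_fun setT f -> cmeasurable_fun D f.
Proof. by move=> mD [m1 m2]; split; exact: measurable_funTS. Qed.

Lemma inL2T D f : measurable D -> inL2 mu setT f -> inL2 mu D f.
Proof.
move=> mD [mf f2]; split; first exact: cmeasT.
apply: le_lt_trans f2; apply: ge0_subset_integral => //.
- exact: emeas_normc2.
- by move=> x _; rewrite lee_fin sqr_ge0.
Qed.

Lemma inL1T D f : measurable D -> inL1 mu setT f -> inL1 mu D f.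
Proof.
move=> mD [mf f2]; split; first exact: cmeasT.
apply: le_lt_trans f2; apply: ge0_subset_integral => //.
- exact: emeas_normc.
- by move=> x _; rewrite lee_fin normc_ge0.
Qed.

Lemma inL1_expi D f (t : T -> R) :
  measurable D -> inL1 mu D f -> measurable_fun D t -> inL1 mu D (fun x => f x * expi (t x)).
Proof.
move=> mD fL mt; apply: inL1_le (fL) _ => //.
  by apply: cmeasM => //; [exact: (proj1 fL)|exact: cmeas_expi].
by move=> x _; rewrite Normc.normcM normc_expi mulr1.
Qed.

Lemma inL2_expi D f (t : T -> R) :
  measurable D -> inL2 mu D f -> measurable_fun D t -> inL2 mu D (fun x => f x * expi (t x)).
Proof.
move=> mD fL mt; apply: inL2_le (fL) _ => //.
  by apply: cmeasM => //; [exact: (proj1 fL)|exact: cmeas_expi].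
by move=> x _; rewrite Normc.normcM normc_expi mulr1.
Qed.

Lemma cintegral_mkcond D f g : (forall x, x \in D -> g x = f x) ->
  (forall x, x \notin D -> g x = 0) -> cintegral mu setT g = cintegral mu D f.
Proof.
move=> gf g0; rewrite /cintegral; congr (_ +i* _);
  rewrite [RHS]Rintegral_mkcond; apply: eq_Rintegral => x _; rewrite /patch;
  by case: ifPn => xD; [rewrite gf|rewrite g0].
Qed.

End Restriction.

Section FourierTransform.
Local Open Scope complex_scope.
Context {R : realType} {n : nat}.
Implicit Types (f g : Rn R n -> R[i]) (x xi a : Rn R n).

Lemma cmeas_translate f a : cmeasurable_fun setT f ->
  cmeasurable_fun setT (fun x => f (radd a x)).
Proof.
by move=> mf; apply: (cmeas_comp mf); exact: meas_radd.
Qed.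

Lemma cintegral_translate f a : cmeasurable_fun setT f ->
  cintegral (leb n) setT (fun x => f (radd a x)) = cintegral (leb n) setT f.
Proof.
have key (p : Rn R n -> R) : measurable_fun setT p ->
    \int[leb n]_(x in setT) p (radd a x) = \int[leb n]_(x in setT) p x.
  move=> mp; have mE : measurable_fun setT (EFin \o p) by exact/measurable_EFinP.
  rewrite /Rintegral; congr fine; rewrite integralE [RHS]integralE.
  rewrite -(@leb_translate _ _ a ((EFin \o p)^\+)%E)//; last exact: measurable_funepos.
  rewrite -(@leb_translate _ _ a ((EFin \o p)^\-)%E)//; last exact: measurable_funeneg.
  by congr (_ - _)%E; apply: eq_integral => x _; rewrite ?funeposE ?funenegE /= [radd a x]raddC.
by move=> [m1 m2]; apply: complex_ext => /=; exact: key.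
Qed.

Lemma L2sqnorm_translate f a : cmeasurable_fun setT f ->
  L2sqnorm (leb n) setT (fun x => f (radd a x)) = L2sqnorm (leb n) setT f.
Proof.
move=> mf; rewrite /L2sqnorm -[RHS](@leb_translate _ _ a).
- by apply: eq_integral => x _; rewrite raddC.
- exact: emeas_normc2.
- by move=> x; rewrite lee_fin sqr_ge0.
Qed.

Lemma inL2_translate f a : inL2 (leb n) setT f -> inL2 (leb n) setT (fun x => f (radd a x)).
Proof.
by move=> [mf f2]; split; [exact: cmeas_translate|rewrite L2sqnorm_translate].
Qed.

Lemma inL1_translate f a : inL1 (leb n) setT f -> inL1 (leb n) setT (fun x => f (radd a x)).
Proof.
move=> [mf f1]; split; first exact: cmeas_translate.
rewrite (_ : (\int[_]_(x in _) _)%E = (\int[leb n]_x (normc (f x))%:E)%E)//.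
rewrite -[RHS](@leb_translate _ _ a).
- by apply: eq_integral => x _; rewrite raddC.
- exact: emeas_normc.
- by move=> x; rewrite lee_fin normc_ge0.
Qed.

(** The exponent has a plus sign, as in the Weyl kernel. *)
Definition fourier f xi := cintegral (leb n) setT (fun x => f x * expi (2 * pi * rdot x xi)).

Lemma meas_rdotl xi D : measurable_fun D (fun x : Rn R n => 2 * pi * rdot x xi).
Proof. by apply: measurable_funTS; apply: measurable_funM => //; exact: meas_rdot. Qed.

Lemma cmeas_fourier f : cmeasurable_fun setT f -> cmeasurable_fun setT (fourier f).
Proof.
move=> mf; rewrite /fourier.
apply: (cmeas_cintegral _ (G := fun p => f p.2 * expi (2 * pi * rdot p.2 p.1))).
apply: cmeasM.
  exact: (cmeas_comp mf).
by apply: cmeas_expi; apply: measurable_funM => //; exact: meas_rdot.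
Qed.

Lemma fourierB f g xi : inL1 (leb n) setT f -> inL1 (leb n) setT g ->
  fourier (fun x => f x - g x) xi = fourier f xi - fourier g xi.
Proof.
move=> fL gL; rewrite /fourier -cintegralB//.
- by apply: eq_cintegral => x _; rewrite mulrBl.
- by apply: inL1_expi => //; exact: meas_rdotl.
- by apply: inL1_expi => //; exact: meas_rdotl.
Qed.

(** The indicator of the cube m + [0,1)^n. *)
Definition tile (m : Zn n) x : R[i] := (Rn_floor x == m)%:R.

Lemma tile_shift m x : tile m (radd (Zn_to_Rn m) x) = (x \in (cube : set (Rn R n)))%:R.
Proof.
rewrite /tile; congr ((_ : bool)%:R); apply/eqP/idP.
  by move=> h; have := cube_floor (radd (Zn_to_Rn m) x); rewrite h raddC raddK inE.
by rewrite inE => cx; apply/esym/cube_uniq; rewrite raddC raddK.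
Qed.

Lemma cmeas_tile m D : measurable D -> cmeasurable_fun D (tile m).
Proof.
move=> mD; rewrite (_ : tile m = fun x => (\1_[set x | cube (rsub x (Zn_to_Rn m))] x)%:C).
  split => /=; last exact: measurable_cst.
  by apply: measurable_indic; apply: meas_shift_set; exact: meas_cube.
apply/funext => x; rewrite /tile indicE.
have -> : (Rn_floor x == m) = (x \in [set x | cube (rsub x (Zn_to_Rn m))]).
  apply/eqP/idP; first by move=> <-; rewrite inE; exact: cube_floor.
  by rewrite inE => /cube_uniq.
by case: (_ \in _).
Qed.

Lemma sum_tile (s : seq (Zn n)) x : uniq s ->
  \sum_(m <- s) tile m x = (Rn_floor x \in s)%:R.
Proof.
elim: s => [|m s IH] /=; first by rewrite big_nil.
move=> /andP[ms us]; rewrite big_cons IH// in_cons /tile.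
by case: eqP => [->|_]; rewrite ?(negbTE ms) ?addr0 ?add0r.
Qed.

(* For f supported on finitely many unit cubes, the values of its Fourier
   transform at k + sg, k in Z^n, are the Fourier coefficients of the finite
   sum h sg over the translates of f; Parseval for h in x and in sg gives
   Plancherel for f. *)
Section FinitelyManyTiles.
Variables (s : seq (Zn n)) (f : Rn R n -> R[i]).
Hypotheses (us : uniq s) (fL1 : inL1 (leb n) setT f) (fL2 : inL2 (leb n) setT f).
Hypothesis fs : forall x, Rn_floor x \notin s -> f x = 0.

Let mc := @meas_cube R n.

Let h (sg : Rn R n) x := \sum_(m <- s) f (radd (Zn_to_Rn m) x) *
  expi (2 * pi * rdot (radd (Zn_to_Rn m) x) sg).

(** For fixed x, and up to a unimodular factor, h is a trigonometric polynomial in sg with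
    coefficients f(m + x); this is what the second use of Parseval needs. *)
Let hE sg x : h sg x = expi (2 * pi * rdot x sg) *
  \sum_(m <- s) f (radd (Zn_to_Rn m) x) * zchar m sg.
Proof.
rewrite mulr_sumr; apply: eq_bigr => m _.
by rewrite rdotDl mulrDr expiD -/(zchar m sg); ring.
Qed.

Let mh : cmeasurable_fun setT (fun p : Rn R n * Rn R n => h p.1 p.2).
Proof.
apply: cmeas_sum => // m; apply: cmeasM.
  exact: (cmeas_comp (cmeas_translate (Zn_to_Rn m) (proj1 fL2))).
apply: cmeas_expi; apply: measurable_funM => //; apply: meas_rdot => //.
by apply: meas_radd.
Qed.

Let mhs sg : cmeasurable_fun setT (h sg).
Proof.
split; [exact: (measurable_fun_pair2 sg (proj1 mh))|exact: (measurable_fun_pair2 sg (proj2 mh))].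
Qed.

Let hL2 sg : inL2 (leb n) cube (h sg).
Proof.
apply: inL2_sum => // m; apply: inL2T => //.
have := @inL2_expi _ _ _ (leb n) setT _ (fun x => 2 * pi * rdot (radd (Zn_to_Rn m) x) sg) measurableT (inL2_translate (Zn_to_Rn m) fL2).
apply; apply: measurable_funM => //; apply: meas_rdot => //.
by apply: meas_radd.
Qed.

(** Every tile is translated back to the unit cube. The phase of frequency k is not affected,
    because [zchar k] is periodic, and the phases of frequency sg are those collected in h. *)
Lemma fourier_tiles k sg : fourier f (radd (Zn_to_Rn k) sg) =
  cintegral (leb n) cube (fun x => h sg x * zchar k x).
Proof.
pose e x := expi (2 * pi * rdot x (radd (Zn_to_Rn k) sg)).
have me : cmeasurable_fun setT e by apply: cmeas_expi; exact: meas_rdotl.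
have feL : inL1 (leb n) setT (fun x => f x * e x).
  by apply: inL1_expi => //; exact: meas_rdotl.
have ftL m : inL1 (leb n) setT (fun x => tile m x * (f x * e x)).
  apply: inL1_le (feL) _ => //.
    by apply: cmeasM => //; [exact: cmeas_tile|exact: (proj1 feL)].
  move=> x _; rewrite Normc.normcM /tile; case: (_ == _).
    by rewrite Normc.normc1 mul1r.
  by rewrite Normc.normc0 mul0r normc_ge0.
transitivity (cintegral (leb n) setT (fun x => \sum_(m <- s) tile m x * (f x * e x))).
  apply: eq_cintegral => x _; rewrite -mulr_suml sum_tile//.
  by case: (boolP (_ \in s)) => [|/fs ->]; rewrite ?mul1r// !mul0r.
rewrite cintegral_sum//.
under [in RHS]eq_cintegral do rewrite mulr_suml.
rewrite [RHS]cintegral_sum//; last first.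
  move=> m; apply: inL1T => //.
  have := inL1_translate (Zn_to_Rn m) feL.
  congr (inL1 _ _ _); apply/funext => x; rewrite /e rdotDr mulrDr expiD.
  rewrite -[expi (2 * pi * rdot _ (Zn_to_Rn k))]/(_) (rdotC _ (Zn_to_Rn k)).
  rewrite -[expi (2 * pi * rdot (Zn_to_Rn k) _)]/(zchar k _) zchar_radd zchar_Zn mul1r.
  by rewrite mulrA mulrAC.
apply: eq_bigr => m _; rewrite -(@cintegral_translate _ (Zn_to_Rn m)); last exact: (proj1 (ftL m)).
apply: cintegral_mkcond => x; rewrite tile_shift => xc.
  rewrite xc mul1r /e rdotDr mulrDr expiD (rdotC _ (Zn_to_Rn k)).
  rewrite -[expi (2 * pi * rdot (Zn_to_Rn k) _)]/(zchar k _) zchar_radd zchar_Zn mul1r.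
  by rewrite mulrA mulrAC.
by rewrite (negbTE xc) mul0r.
Qed.

Lemma plancherel_tiles : L2sqnorm (leb n) setT (fourier f) = L2sqnorm (leb n) setT f.
Proof.
have mF := cmeas_fourier (proj1 fL2).
have p2 (g : Rn R n -> R[i]) x : (0 <= (normc (g x) ^+ 2)%:E)%E by rewrite lee_fin sqr_ge0.
have mhh : measurable_fun setT (fun p : Rn R n * Rn R n => (normc (h p.1 p.2) ^+ 2)%:E : \bar R).
  exact: emeas_normc2 mh.
have mFF := emeas_normc2 mF.
rewrite {1}/L2sqnorm (leb_tile mFF)//.
rewrite -integral_esum//; last first.
  by move=> k; apply: measurable_funTS; exact: (meas_comp_radd (Zn_to_Rn k) mFF).
transitivity (\int[leb n]_(sg in cube) L2sqnorm (leb n) cube (h sg))%E.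
  apply: eq_integral => sg _; rewrite -parseval_pos//.
  by apply: eq_esum => k _; rewrite fourier_tiles.
transitivity (\int[leb n]_(x in cube) \int[leb n]_(sg in cube) (normc (h sg x) ^+ 2)%:E)%E.
  rewrite -(integral_setX12 (leb n) (leb n) mc mc mhh)//.
  by rewrite (integral_setX21 (leb n) (leb n) mc mc mhh).
transitivity (\int[leb n]_(x in cube) \esum_(m in [set: Zn n]) (normc (f (radd (Zn_to_Rn m) x)) ^+ 2)%:E)%E.
  apply: eq_integral => x /[!inE] cx.
  transitivity (\sum_(m <- s) normc (f (radd (Zn_to_Rn m) x)) ^+ 2)%:E.
    rewrite -L2sqnorm_trig//; apply: eq_integral => sg _.
    by rewrite hE Normc.normcM normc_expi mul1r.
  rewrite -sumEFin fsbig_seq// -esum_fset; [|exact: finite_seq|by move=> m _; rewrite lee_fin sqr_ge0].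
  rewrite esum_mkcond; apply: eq_esum => m _; case: ifPn => // ms.
  rewrite fs ?Normc.normc0 ?expr0n//.
  have : tile m (radd (Zn_to_Rn m) x) = 1 by rewrite tile_shift mem_set.
  rewrite /tile; case: eqP => [-> _|_ /esym/eqP]; last by rewrite oner_eq0.
  by apply: contra ms => ms; rewrite inE.
have mff := emeas_normc2 (proj1 fL2).
rewrite integral_esum//; last first.
  by move=> m; apply: measurable_funTS; exact: (meas_comp_radd (Zn_to_Rn m) mff).
by rewrite -(leb_tile mff).
Qed.

End FinitelyManyTiles.

(** g N keeps f on the unit cubes of code less than N, so [plancherel_tiles] applies to g N and to
    differences of such truncations. Integrability of f makes the transforms converge pointwise,
    square integrability makes the truncations converge in norm. *)
Lemma plancherel f : inL1 (leb n) setT f -> inL2 (leb n) setT f ->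
  L2sqnorm (leb n) setT (fourier f) = L2sqnorm (leb n) setT f.
Proof.
move=> fL1 fL2.
pose S N : seq (Zn n) := undup (pmap (@pickle_inv (Zn n)) (iota 0 N)).
have inS N m : (m \in S N) = (choice.pickle m < N)%N.
  rewrite mem_undup mem_pmap; apply/mapP/idP => [[k]|mN].
    rewrite mem_iota add0n => kN /esym km.
    by have := @pickle_invK (Zn n) k; rewrite km /= => ->.
  by exists (choice.pickle m); rewrite ?mem_iota// pickleK_inv.
have uS N : uniq (S N) by exact: undup_uniq.
pose g N x := f x * \sum_(m <- S N) tile m x.
have gE N x : g N x = f x * (choice.pickle (Rn_floor x) < N)%N%:R.
  by rewrite /g sum_tile// inS.
have mg N : cmeasurable_fun setT (g N).
  apply: cmeasM; [exact: (proj1 fL1)|apply: cmeas_sum => // m; exact: cmeas_tile].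
have gf N x : normc (g N x) <= normc (f x).
  rewrite gE; case: (_ < _)%N; rewrite ?mulr1// mulr0 Normc.normc0; exact: normc_ge0.
have gL1 N : inL1 (leb n) setT (g N) by apply: inL1_le fL1 _.
have gL2 N : inL2 (leb n) setT (g N) by apply: inL2_le fL2 _.
have gs M N : (M <= N)%N -> L2sqnorm (leb n) setT (fourier (fun x => g N x - g M x)) =
    L2sqnorm (leb n) setT (fun x => g N x - g M x).
  move=> MN; apply: (@plancherel_tiles (S N)) => //; [exact: inL1B|exact: inL2B|].
  move=> x; rewrite inS -leqNgt => Nx; rewrite !gE ltnNge Nx ltnNge (leq_trans MN Nx).
  by rewrite !mulr0 subr0.
have gs0 N : L2sqnorm (leb n) setT (fourier (g N)) = L2sqnorm (leb n) setT (g N).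
  apply: (@plancherel_tiles (S N)) => // x; rewrite inS -leqNgt => Nx.
  by rewrite gE ltnNge Nx mulr0.
have cg x : ccvg (g ^~ x) (f x).
  have E (p : R[i] -> R) : p (g j x) @[j --> \oo] --> p (f x).
    apply: cvg_near_cst; near=> j; rewrite gE (_ : (_ < _)%N = true) ?mulr1//.
    near: j; exact: nbhs_infty_gt.
  by split; exact: E.
have cF xi : ccvg (fun N => fourier (g N) xi) (fourier f xi).
  apply: (@cintegral_dominated _ _ _ (leb n) setT measurableT _ _ f) => //.
  - by move=> N; apply: cmeasM => //; apply: cmeas_expi; exact: meas_rdotl.
  - by move=> x _; apply: ccvgM; [exact: cg|exact: ccvg_cst].
  - by move=> N x _; rewrite Normc.normcM normc_expi mulr1.
have mF N := cmeas_fourier (mg N).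
have mFf := cmeas_fourier (proj1 fL1).
(* The transform of f is so far only a pointwise limit. Fatou, applied to the differences of the
   truncations N + j and N, gives the inequality that suffices. *)
have bd N : (L2sqnorm (leb n) setT (fun xi => (fourier f xi - fourier (g N) xi)%R) <=
    L2sqnorm (leb n) setT (fun x => (f x - g N x)%R))%E.
  apply: (@L2sqnorm_fatou _ _ _ _ _ measurableT (fun j xi => fourier (g (N + j)%N) xi - fourier (g N) xi)).
  - by move=> j; exact: cmeasB.
  - by move=> xi _; apply: ccvgB; [apply: (ccvg_shift N (cF xi))|exact: ccvg_cst].
  - move=> j; rewrite (_ : (fun x => _) = fourier (fun x => g (N + j)%N x - g N x)); last first.
      by apply/funext => xi; rewrite fourierB.
    rewrite gs ?leq_addr//; apply: le_L2sqnorm => //.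
    + exact: cmeasB.
    + by apply: cmeasB => //; exact: (proj1 fL1).
    + move=> x _; rewrite [g N x]gE; case: ltnP => h; last by rewrite mulr0 !subr0.
      have hj : (choice.pickle (Rn_floor x) < N + j)%N by exact: leq_trans h (leq_addr _ _).
      rewrite gE hj; have -> : true%:R = 1 :> R[i] by [].
      by rewrite mulr1.
have fgL N := inL2B measurableT fL2 (gL2 N).
have FgL N : inL2 (leb n) setT (fourier (g N)).
  by split => //; rewrite gs0; exact: (proj2 (gL2 N)).
have FdL N : inL2 (leb n) setT (fun xi => fourier f xi - fourier (g N) xi).
  split; first exact: cmeasB.
  exact: le_lt_trans (bd N) (proj2 (fgL N)).
have FL : inL2 (leb n) setT (fourier f).
  have := inL2D measurableT (FdL 0%N) (FgL 0%N).
  by under eq_fun do rewrite subrK.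
suff nE : nrm (leb n) setT (fourier f) = nrm (leb n) setT f by rewrite !nrm2E// nE.
apply/eqP; rewrite -subr_eq0 -normr_le0; apply/ler_addgt0Pr => e e0; rewrite add0r.
have e2 : 0 < e / 2 by rewrite divr_gt0.
have [N _ /(_ N (leqnn N))/= hN] : \forall N \near \oo, nrm (leb n) setT (fun x => f x - g N x) < e / 2.
  apply: (@L2_dominated _ _ _ (leb n) setT measurableT (fun N x => f x - g N x) (fun x => 2%:C * f x)) => //.
  - by move=> N; exact: (proj1 (fgL N)).
  - exact: inL2Z.
  - by move=> x _; rewrite -(subrr (f x)); apply: ccvgB; [exact: ccvg_cst|exact: cg].
  - move=> N x _; apply: le_trans (normc_triangle _ _) _.
    rewrite normc_opp [leRHS]Normc.normcM normc_real ger0_norm// mulr_natl mulr2n.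
    by rewrite lerD2l gf.
have d1 : nrm (leb n) setT (fun xi => fourier f xi - fourier (g N) xi) <= nrm (leb n) setT (fun x => f x - g N x).
  rewrite -(ler_pXn2r (n:=2)) ?nnegrE ?nrm_ge0// -lee_fin -!nrm2E//; exact: bd.
have d2 := nrm_dist measurableT FL (FgL N).
have d3 := nrm_dist measurableT fL2 (gL2 N).
have E : nrm (leb n) setT (fourier (g N)) = nrm (leb n) setT (g N) by rewrite /nrm gs0.
rewrite E in d2.
apply: le_trans (ler_distD (nrm (leb n) setT (g N)) _ _) _.
rewrite (splitr e); apply: lerD.
  by apply: le_trans d2 _; apply: le_trans d1 _; exact: ltW.
by rewrite distrC; apply: le_trans d3 _; exact: ltW.
Unshelve. all: by end_near. Qed.

End FourierTransform.

(** * The Weyl kernel *)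

Section Slices.
Local Open Scope complex_scope.
Context d1 d2 (T1 : measurableType d1) (T2 : measurableType d2) {R : realType}.
Context (m1 : {sigma_finite_measure set T1 -> \bar R}).
Context (m2 : {sigma_finite_measure set T2 -> \bar R}).

Lemma ae_slice_lty (g : T1 * T2 -> \bar R) : measurable_fun setT g ->
  (forall p, (0 <= g p)%E) -> (\int[m1 \x m2]_p g p < +oo)%E ->
  {ae m2, forall y, (\int[m1]_x g (x, y) < +oo)%E}.
Proof.
move=> mg g0 goo.
have mG := measurable_integral_fst m1 measurableT mg g0.
have : m2.-integrable setT (fun y => \int[m1]_x g (x, y))%E.
  apply/integrableP; split => //.
  under eq_integral do rewrite gee0_abs ?integral_ge0//.
  by rewrite -(fubini_tonelli2 g mg g0).
move=> /(integrable_ae measurableT); apply: filterS => y /(_ Logic.I).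
by rewrite ge0_fin_numE// integral_ge0.
Qed.

Lemma cmeas_slice (f : T1 * T2 -> R[i]) y : cmeasurable_fun setT f ->
  cmeasurable_fun setT (fun x => f (x, y)).
Proof.
by move=> [mr mi]; split; [exact: (measurable_fun_pair1 y mr)|exact: (measurable_fun_pair1 y mi)].
Qed.

Lemma ae_slice_inL1 (f : T1 * T2 -> R[i]) : inL1 (m1 \x m2)%E setT f ->
  {ae m2, forall y, inL1 m1 setT (fun x => f (x, y))}.
Proof.
move=> [mf f1]; have := ae_slice_lty (emeas_normc mf) _ f1.
case=> [p|N [mN N0 NP]]; first by rewrite lee_fin normc_ge0.
exists N; split=> // y /= h; apply: NP => /= h2; apply: h; split => //.
exact: cmeas_slice.
Qed.

Lemma ae_slice_inL2 (f : T1 * T2 -> R[i]) : inL2 (m1 \x m2)%E setT f ->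
  {ae m2, forall y, inL2 m1 setT (fun x => f (x, y))}.
Proof.
move=> [mf f1]; have := ae_slice_lty (emeas_normc2 mf) _ f1.
case=> [p|N [mN N0 NP]]; first by rewrite lee_fin sqr_ge0.
exists N; split=> // y /= h; apply: NP => /= h2; apply: h; split => //.
exact: cmeas_slice.
Qed.

End Slices.

Section IntegrableApproximation.
Context d (T : measurableType d) {R : realType}.
Variable mu : {sigma_finite_measure set T -> \bar R}.

(** f is restricted to an exhausting sequence of sets of finite measure. There it is integrable
    since |f| <= 1 + |f|^2, and the restrictions converge by domination. *)
Lemma L1L2_approx (f : T -> R[i]) : inL2 mu setT f ->
  exists f_ : nat -> T -> R[i],
    (forall j, inL1 mu setT (f_ j) /\ inL2 mu setT (f_ j)) /\ L2converges mu setT \oo f_ f.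
Proof.
move=> fL; have /sigma_finiteP[F [TF ndF Foo]] := sigma_finiteT mu.
pose f_ j x : R[i] := f x * (\1_(F j) x)%:C%C.
have fE j x : f_ j x = if x \in F j then f x else 0.
  by rewrite /f_ indicE; case: (x \in F j); rewrite ?mulr1 ?mulr0.
have mf_ j : cmeasurable_fun setT (f_ j).
  apply: cmeasM; first exact: (proj1 fL).
  split => /=; last exact: measurable_cst.
  by apply: measurable_indic; have [] := Foo j.
have le j x : normc (f_ j x) <= normc (f x).
  by rewrite fE; case: ifP => // _; rewrite Normc.normc0 normc_ge0.
have f_L j : inL2 mu setT (f_ j) by apply: inL2_le fL _.
exists f_; split.
  move=> j; split => //; split => //.
  have [mFj Fjoo] := Foo j.
  apply: (@le_lt_trans _ _ (\int[mu]_x ((\1_(F j) x)%:E + (normc (f x) ^+ 2)%:E))%E).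
    apply: ge0_le_integral => //.
    - by move=> x _; rewrite lee_fin normc_ge0.
    - exact: emeas_normc.
    - apply: emeasurable_funD; last by apply: emeas_normc2; exact: (proj1 fL).
      by apply/measurable_EFinP; exact: measurable_indic.
    - move=> x _; rewrite -EFinD lee_fin fE indicE; case: (x \in F j); last first.
        by rewrite Normc.normc0 addr_ge0 ?sqr_ge0.
      have := sqr_ge0 (normc (f x) - 1); have := normc_ge0 (f x).
      move: (normc (f x)) => a; rewrite -[true%:R]/(1 : R); nra.
  rewrite ge0_integralD//; first last.
  - by apply: emeas_normc2; exact: (proj1 fL).
  - by move=> x _; rewrite lee_fin sqr_ge0.
  - by apply/measurable_EFinP; exact: measurable_indic.
  rewrite integral_indic// setIT; apply: lte_add_pinfty => //; exact: (proj2 fL).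
apply/L2converges_nrmP => //.
apply: (@L2_dominated _ _ _ mu setT measurableT (fun j x => f_ j x - f x) f) => //.
- by move=> j; apply: cmeasB => //; exact: (proj1 fL).
- move=> x _; have [i _ Fix] : (\bigcup_i F i) x by rewrite -TF.
  have E (p : R[i] -> R) : p (f_ j x - f x) @[j --> \oo] --> p 0.
    apply: cvg_near_cst; exists i => // j /= ij; rewrite fE mem_set ?subrr//.
    by move: Fix; apply/subsetPset/ndF.
  by split; exact: E.
- move=> j x _; rewrite fE; case: ifP => _.
    by rewrite subrr Normc.normc0 normc_ge0.
  by rewrite sub0r normc_opp.
Qed.

End IntegrableApproximation.

Section PlaneTranslations.
Local Open Scope ereal_scope.
Context {R : realType} {n : nat}.
Implicit Types (g : R2n R n -> \bar R) (a b : Rn R n).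

Lemma leb2_shear g : measurable_fun setT g -> (forall p, 0 <= g p) ->
  \int[leb2]_p g p = \int[leb2]_p g (p.1, radd p.1 p.2).
Proof.
move=> mg g0.
have ms : measurable_fun setT (fun p : R2n R n => g (p.1, radd p.1 p.2)).
  apply: measurableT_comp => //; apply: measurable_fun_pair => //.
  exact: meas_radd.
rewrite /leb2 (fubini_tonelli1 g mg g0).
rewrite (fubini_tonelli1 (fun p => g (p.1, radd p.1 p.2)) ms)//.
apply: eq_integral => x _; rewrite /fubini_F/=.
rewrite -(@leb_translate _ _ x (fun y => g (x, y)))//.
  by apply: eq_integral => y _; rewrite raddC.
exact: (measurable_fun_pair2 x mg).
Qed.

Lemma leb2_translate a b g : measurable_fun setT g -> (forall p, 0 <= g p) ->
  \int[leb2]_p g (radd p.1 a, radd p.2 b) = \int[leb2]_p g p.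
Proof.
move=> mg g0.
have ms : measurable_fun setT (fun p : R2n R n => g (radd p.1 a, radd p.2 b)).
  by apply: measurableT_comp => //; apply: measurable_fun_pair; exact: meas_radd.
have ms' : measurable_fun setT (fun p : R2n R n => g (p.1, radd p.2 b)).
  by apply: measurableT_comp => //; apply: measurable_fun_pair => //; exact: meas_radd.
rewrite /leb2 (fubini_tonelli2 (fun p => g (radd p.1 a, radd p.2 b)) ms)//.
transitivity (\int[leb n]_y \int[leb n]_x g (x, radd y b)).
  apply: eq_integral => y _.
  by rewrite /fubini_G/= (@leb_translate _ _ a (fun x => g (x, radd y b)))//; exact: (measurable_fun_pair1 y ms').
rewrite (fubini_tonelli2 g mg g0).
rewrite (@leb_translate _ _ b (fun y => \int[leb n]_x g (x, y)))//.
  exact: (measurable_integral_fst (leb n) measurableT mg g0).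
by move=> y; exact: integral_ge0.
Qed.

End PlaneTranslations.

Section WeylKernel.
Local Open Scope complex_scope.
Context {R : realType} {n : nat}.
Implicit Types (phi psi K : R2n R n -> R[i]) (k l : Zn n).

Lemma cmeas_weyl phi : cmeasurable_fun setT phi ->
  cmeasurable_fun setT (weyl_kernel_L1L2 phi).
Proof.
move=> mphi; apply: (cmeas_cintegral (leb n) (G := fun q : R2n R n * Rn R n =>
  phi (q.2, rsub q.1.2 q.1.1) * expi (pi * rdot q.2 (radd q.1.1 q.1.2)))).
have m11 : measurable_fun setT (fun q : R2n R n * Rn R n => q.1.1).
  exact: (measurableT_comp measurable_fst measurable_fst).
have m12 : measurable_fun setT (fun q : R2n R n * Rn R n => q.1.2).
  exact: (measurableT_comp measurable_snd measurable_fst).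
apply: cmeasM.
  apply: (cmeas_comp mphi); apply: measurable_fun_pair => //.
  exact: meas_rsub.
apply: cmeas_expi; apply: measurable_funM => //; apply: meas_rdot => //.
exact: meas_radd.
Qed.

Lemma rsub_raddl (x y : Rn R n) : rsub (radd x y) x = y.
Proof. by rewrite raddC raddK. Qed.

(** With eta = xi + y the phase pi x.(2 xi + y) splits into the Fourier phase 2 pi x.xi and a
    unimodular factor independent of xi. *)
Lemma weyl_shear phi (xi y : Rn R n) : weyl_kernel_L1L2 phi (xi, radd xi y) =
  fourier (fun x => phi (x, y) * expi (pi * rdot x y)) xi.
Proof.
apply: eq_cintegral => x _ /=; rewrite rsub_raddl -mulrA -expiD; congr (_ * expi _).
rewrite !rdotDr; ring.
Qed.

Lemma L2sqnorm_shear (H : R2n R n -> R[i]) : cmeasurable_fun setT H ->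
  L2sqnorm leb2 setT H =
  (\int[leb n]_y L2sqnorm (leb n) setT (fun xi => H (xi, radd xi y)))%E.
Proof.
move=> mH; have mHH := emeas_normc2 mH.
have p0 (p : R2n R n) : (0 <= (normc (H p) ^+ 2)%:E)%E by rewrite lee_fin sqr_ge0.
rewrite {1}/L2sqnorm (leb2_shear mHH p0) /leb2.
have ms : measurable_fun setT (fun p : R2n R n => (normc (H (p.1, radd p.1 p.2)) ^+ 2)%:E : \bar R).
  by apply: (measurableT_comp mHH); apply: measurable_fun_pair => //; exact: meas_radd.
by rewrite (fubini_tonelli2 _ ms).
Qed.

(** Algebraic identities between kernels can be checked where the slice phi(., y) is integrable: for
    almost every y in the sheared coordinates, and then for all xi. This converts them into
    identities up to norm zero. *)
Lemma L2sqnorm_sheared_null (H : R2n R n -> R[i]) : cmeasurable_fun setT H ->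
  {ae leb n, forall y, forall xi : Rn R n, H (xi, radd xi y) = 0} ->
  L2sqnorm leb2 setT H = 0%E.
Proof.
move=> mH H0; rewrite L2sqnorm_shear//.
have mHH : measurable_fun setT (fun p : R2n R n => (normc (H (p.1, radd p.1 p.2)) ^+ 2)%:E : \bar R).
  apply: (measurableT_comp (emeas_normc2 mH)); apply: measurable_fun_pair => //.
  exact: meas_radd.
have mf := measurable_integral_fst (leb n) measurableT mHH (fun p => _).
rewrite (@ge0_ae_eq_integral _ _ _ (leb n) setT _ (fun=> 0%E)) ?integral0//.
- by apply: mf => p; rewrite lee_fin sqr_ge0.
- by move=> y _; exact: L2sqnorm_ge0.
- apply: filterS H0 => y Hy _; apply: integral0_eq => x _.
  by rewrite Hy Normc.normc0 expr0n.
Qed.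

Lemma weyl_isometry phi : inL1 leb2 setT phi -> inL2 leb2 setT phi ->
  L2sqnorm leb2 setT (weyl_kernel_L1L2 phi) = L2sqnorm leb2 setT phi.
Proof.
move=> phi1 phi2; have mphi := proj1 phi2; have mK := cmeas_weyl mphi.
rewrite L2sqnorm_shear//.
rewrite [RHS](fubini_tonelli2 _ (emeas_normc2 mphi)); last first.
  by move=> p; rewrite lee_fin sqr_ge0.
apply: ge0_ae_eq_integral => //.
- have mHH : measurable_fun setT (fun p : R2n R n => (normc (weyl_kernel_L1L2 phi (p.1, radd p.1 p.2)) ^+ 2)%:E : \bar R).
    apply: (measurableT_comp (emeas_normc2 mK)); apply: measurable_fun_pair => //.
    exact: meas_radd.
  by apply: (measurable_integral_fst (leb n) measurableT mHH) => p; rewrite lee_fin sqr_ge0.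
- apply: (measurable_integral_fst (leb n) measurableT (emeas_normc2 mphi)) => p.
  by rewrite lee_fin sqr_ge0.
- by move=> y _; exact: L2sqnorm_ge0.
- by move=> y _; exact: L2sqnorm_ge0.
- have a1 := @ae_slice_inL1 _ _ _ _ _ (leb n) (leb n) _ phi1.
  have a2 := @ae_slice_inL2 _ _ _ _ _ (leb n) (leb n) _ phi2.
  apply: filterS2 a1 a2 => y f1 f2 _.
  have mr : measurable_fun setT (fun x : Rn R n => pi * rdot x y).
    by apply: measurable_funM => //; exact: meas_rdot.
  transitivity (L2sqnorm (leb n) setT (fourier (fun x => phi (x, y) * expi (pi * rdot x y)))).
    by apply: eq_L2sqnorm => xi _; rewrite weyl_shear.
  rewrite plancherel; [|exact: inL1_expi|exact: inL2_expi].
  by apply: eq_L2sqnorm => x _; rewrite Normc.normcM normc_expi mulr1.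
Qed.

Lemma weyl_linear c phi psi : inL1 leb2 setT phi -> inL1 leb2 setT psi ->
  L2sqnorm leb2 setT (fun p => weyl_kernel_L1L2 (fun x => c * phi x + psi x) p -
    (c * weyl_kernel_L1L2 phi p + weyl_kernel_L1L2 psi p)) = 0%E.
Proof.
move=> phi1 psi1; have mphi := proj1 phi1; have mpsi := proj1 psi1.
apply: L2sqnorm_sheared_null.
  apply: cmeasB.
    by apply: cmeas_weyl; apply: cmeasD => //; exact: cmeasZ.
  by apply: cmeasD; [apply: cmeasZ|]; exact: cmeas_weyl.
have a1 := @ae_slice_inL1 _ _ _ _ _ (leb n) (leb n) _ phi1.
have a2 := @ae_slice_inL1 _ _ _ _ _ (leb n) (leb n) _ psi1.
apply: filterS2 a1 a2 => y f1 f2 xi; apply/eqP; rewrite subr_eq0; apply/eqP.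
rewrite /weyl_kernel_L1L2 /= rsub_raddl.
have mr : measurable_fun setT (fun x : Rn R n => pi * rdot x (radd xi (radd xi y))).
  by apply: measurable_funM => //; exact: meas_rdot.
have i1 := inL1_expi measurableT f1 mr; have i2 := inL1_expi measurableT f2 mr.
rewrite -cintegralZ// -cintegralD//; last exact: inL1Z.
by apply: eq_cintegral => x _; rewrite mulrDl mulrA.
Qed.

(** The sign (-1)^(k.l), as k.l is an integer. *)
Definition twist_sign k l : R[i] := expi (pi * rdot (Zn_to_Rn k) (Zn_to_Rn l : Rn R n)).

(** The operator on kernels that corresponds to the twisted translation by (k, l): modulation and
    translation in the first variable only. *)
Definition kernel_translation k l K : R2n R n -> R[i] := fun p =>
  twist_sign k l * (zchar k p.1 * K (radd (Zn_to_Rn l) p.1, p.2)).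

Lemma meas_rsub_pair (a b : Rn R n) :
  measurable_fun setT (fun p : R2n R n => (rsub p.1 a, rsub p.2 b)).
Proof. by apply: measurable_fun_pair; exact: meas_rsub. Qed.

Lemma meas_radd_pair (a : Rn R n) :
  measurable_fun setT (fun p : R2n R n => (radd a p.1, p.2)).
Proof. by apply: measurable_fun_pair => //; exact: meas_radd. Qed.

Lemma cmeas_twisted k l phi : cmeasurable_fun setT phi ->
  cmeasurable_fun setT (twisted_translation k l phi).
Proof.
move=> mphi; apply: cmeasM; last exact: (cmeas_comp mphi (meas_rsub_pair _ _)).
apply: cmeas_expi; apply: measurable_funM => //.
by apply: measurable_funB; exact: meas_rdot.
Qed.

Lemma normc_twisted k l phi p : normc (twisted_translation k l phi p) =
  normc (phi (rsub p.1 (Zn_to_Rn k), rsub p.2 (Zn_to_Rn l))).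
Proof. by rewrite Normc.normcM normc_expi mul1r. Qed.

Lemma L2sqnorm_twisted k l phi : cmeasurable_fun setT phi ->
  L2sqnorm leb2 setT (twisted_translation k l phi) = L2sqnorm leb2 setT phi.
Proof.
move=> mphi; rewrite /L2sqnorm.
rewrite -[RHS](@leb2_translate _ _ [tuple - tnth (Zn_to_Rn k) i | i < n] [tuple - tnth (Zn_to_Rn l) i | i < n]).
- by apply: eq_integral => p _; rewrite normc_twisted !rsubE.
- exact: emeas_normc2.
- by move=> p; rewrite lee_fin sqr_ge0.
Qed.

Lemma inL2_twisted k l phi : inL2 leb2 setT phi ->
  inL2 leb2 setT (twisted_translation k l phi).
Proof.
by move=> [mphi phi2]; split; [exact: cmeas_twisted|rewrite L2sqnorm_twisted].
Qed.

Lemma inL1_twisted k l phi : inL1 leb2 setT phi ->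
  inL1 leb2 setT (twisted_translation k l phi).
Proof.
move=> [mphi phi1]; split; first exact: cmeas_twisted.
rewrite (_ : (\int[_]_(x in _) _)%E = (\int[leb2]_p (normc (phi p))%:E)%E)//.
rewrite -[RHS](@leb2_translate _ _ [tuple - tnth (Zn_to_Rn k) i | i < n] [tuple - tnth (Zn_to_Rn l) i | i < n]).
- by apply: eq_integral => p _; rewrite normc_twisted !rsubE.
- exact: emeas_normc.
- by move=> p; rewrite lee_fin normc_ge0.
Qed.

Lemma cmeas_kernel_translation k l K : cmeasurable_fun setT K ->
  cmeasurable_fun setT (kernel_translation k l K).
Proof.
move=> mK; apply: cmeasZ => //; apply: cmeasM.
  exact: (cmeas_comp (cmeas_zchar k setT) measurable_fst).
exact: (cmeas_comp mK (meas_radd_pair _)).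
Qed.

Lemma normc_kernel_translation k l K p :
  normc (kernel_translation k l K p) = normc (K (radd (Zn_to_Rn l) p.1, p.2)).
Proof. by rewrite !Normc.normcM normc_zchar normc_expi !mul1r. Qed.

Lemma L2sqnorm_kernel_translation k l K : cmeasurable_fun setT K ->
  L2sqnorm leb2 setT (kernel_translation k l K) = L2sqnorm leb2 setT K.
Proof.
move=> mK; rewrite /L2sqnorm.
rewrite -[RHS](@leb2_translate _ _ (Zn_to_Rn l) (Zn_to_Rn 0)).
- by apply: eq_integral => p _; rewrite normc_kernel_translation radd0 raddC.
- exact: emeas_normc2.
- by move=> p; rewrite lee_fin sqr_ge0.
Qed.

Lemma inL2_kernel_translation k l K : inL2 leb2 setT K ->
  inL2 leb2 setT (kernel_translation k l K).
Proof.
by move=> [mK K2]; split; [exact: cmeas_kernel_translation|rewrite L2sqnorm_kernel_translation].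
Qed.

Lemma weyl_twisted k l phi : inL1 leb2 setT phi ->
  L2sqnorm leb2 setT (fun p => weyl_kernel_L1L2 (twisted_translation k l phi) p -
    kernel_translation k l (weyl_kernel_L1L2 phi) p) = 0%E.
Proof.
move=> phi1; have mphi := proj1 phi1.
apply: L2sqnorm_sheared_null.
  apply: cmeasB; first by apply: cmeas_weyl; exact: cmeas_twisted.
  by apply: cmeas_kernel_translation; exact: cmeas_weyl.
(* The translate by (0, l) is used so that its slice at y is phi(., y - l), the slice that occurs on
   both sides. *)
have phi0 : inL1 leb2 setT (fun p : R2n R n => phi (rsub p.1 (Zn_to_Rn 0), rsub p.2 (Zn_to_Rn l))).
  apply: inL1_le (inL1_twisted 0 l phi1) _ => //.
    exact: (cmeas_comp mphi (meas_rsub_pair _ _)).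
  by move=> p _; rewrite normc_twisted.
have a1 := @ae_slice_inL1 _ _ _ _ _ (leb n) (leb n) _ phi0.
apply: filterS a1 => y /= f1 xi; apply/eqP; rewrite subr_eq0; apply/eqP.
have {}f1 : inL1 (leb n) setT (fun x => phi (x, rsub y (Zn_to_Rn l))).
  by move: f1; under eq_fun do rewrite rsub0.
rewrite /kernel_translation /weyl_kernel_L1L2 /=.
rewrite -(@cintegral_translate _ _ _ (Zn_to_Rn k)); last first.
  apply: cmeasM.
    have := cmeas_slice (radd xi y) (cmeas_twisted k l mphi).
    by have := cmeas_slice (rsub (radd xi y) xi) (cmeas_twisted k l mphi).
  by apply: cmeas_expi; apply: measurable_funM => //; exact: meas_rdot.
have mr : measurable_fun setT (fun x : Rn R n => pi * rdot x (radd (radd (Zn_to_Rn l) xi) (radd xi y))).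
  by apply: measurable_funM => //; exact: meas_rdot.
have i1 := inL1_expi measurableT f1 mr.
have yE : rsub (radd xi y) (radd (Zn_to_Rn l) xi) = rsub y (Zn_to_Rn l).
  by apply: eq_from_tnth => i; rewrite !tnth_mktuple; ring.
rewrite yE mulrA -cintegralZ//; apply: eq_cintegral => x _.
rewrite /twisted_translation /= rsub_raddl (raddC (Zn_to_Rn k) x) raddK.
(* After the substitution of x + k for x, the terms y.k cancel. What remains is k.l, giving the
   sign, 2 k.xi, giving the character, and x.(l + 2 xi + y), the phase of the kernel at (l + xi, xi
   + y). *)
have E : expi (pi * (rdot (radd x (Zn_to_Rn k)) (Zn_to_Rn l) - rdot y (Zn_to_Rn k))) *
    expi (pi * rdot (radd x (Zn_to_Rn k)) (radd xi (radd xi y))) =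
    twist_sign k l * zchar k xi * expi (pi * rdot x (radd (radd (Zn_to_Rn l) xi) (radd xi y))).
  rewrite /twist_sign /zchar -!expiD; congr (expi _).
  rewrite !(rdotDl, rdotDr, rdotBr) (rdotC y (Zn_to_Rn k)).
  by ring.
by rewrite mulrAC E; ring.
Qed.

End WeylKernel.

Section NullPerturbation.
Context d (T : measurableType d) {R : realType}.
Variables (mu : {measure set T -> \bar R}) (D : set T).
Hypothesis mD : measurable D.
Implicit Types (f g : T -> R[i]).

Lemma nrm_null f : L2sqnorm mu D f = 0%E -> nrm mu D f = 0.
Proof. by rewrite /nrm => ->; rewrite sqrtr0. Qed.

Lemma L2converges_null (J : Type) (F : set_system J) (FF : Filter F)
    (f_ g_ : J -> T -> R[i]) h :
  (forall j, inL2 mu D (f_ j)) -> (forall j, inL2 mu D (g_ j)) -> inL2 mu D h ->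
  (forall j, L2sqnorm mu D (fun x => f_ j x - g_ j x) = 0%E) ->
  L2converges mu D F g_ h -> L2converges mu D F f_ h.
Proof.
move=> fL gL hL fg /(L2converges_nrmP mD gL hL) gh.
apply/(L2converges_nrmP mD fL hL) => e e0; apply: filterS (gh e e0) => j.
apply: le_lt_trans; apply: le_trans (nrm_dist3 mD (fL j) (gL j) hL) _.
by rewrite (nrm_null (fg j)) add0r.
Qed.

Lemma L2converges_cauchy (f_ : nat -> T -> R[i]) f :
  (forall j, inL2 mu D (f_ j)) -> inL2 mu D f -> L2converges mu D \oo f_ f ->
  forall e, 0 < e -> exists N, forall i j, (N <= i)%N -> (N <= j)%N ->
     nrm mu D (fun x => f_ i x - f_ j x) < e.
Proof.
move=> fL fL' /(L2converges_nrmP mD fL fL') cf e e0.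
have [N _ HN] := cf _ (divr_gt0 e0 (ltr0n _ 2)).
exists N => i j Ni Nj; apply: le_lt_trans (nrm_dist3 mD (fL i) fL' (fL j)) _.
rewrite (splitr e); apply: ltrD; first exact: HN.
by rewrite nrm_distC; exact: HN.
Qed.

Lemma L2converges_eqnorm d' (T' : measurableType d') (mu' : {measure set T' -> \bar R})
    (D' : set T') (J : Type) (F : set_system J) (f_ : J -> T -> R[i]) f
    (g_ : J -> T' -> R[i]) (g : T' -> R[i]) :
  (forall j, L2sqnorm mu' D' (fun x => g_ j x - g x) = L2sqnorm mu D (fun x => f_ j x - f x)) ->
  L2converges mu D F f_ f -> L2converges mu' D' F g_ g.
Proof.
by move=> E; rewrite /L2converges; under [in X in _ -> X]eq_fun do rewrite E.
Qed.

End NullPerturbation.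

Section ProductSigmaFinite.
Context d1 d2 (T1 : measurableType d1) (T2 : measurableType d2) {R : realType}.
Variable m1 : {sigma_finite_measure set T1 -> \bar R}.
Variable m2 : {sigma_finite_measure set T2 -> \bar R}.

Lemma sigma_finite_prod : sigma_finite setT (m1 \x m2)%E.
Proof.
have /sigma_finiteP[F [TF ndF Foo]] := sigma_finiteT m1.
have /sigma_finiteP[G [TG ndG Goo]] := sigma_finiteT m2.
exists (fun k => F k `*` G k).
  apply/esym/seteqP; split => // -[x y] _.
  have [i _ Fi] : (\bigcup_i F i) x by rewrite -TF.
  have [j _ Gj] : (\bigcup_i G i) y by rewrite -TG.
  exists (maxn i j) => //; split => /=.
    by move: Fi; apply/subsetPset/ndF/leq_maxl.
  by move: Gj; apply/subsetPset/ndG/leq_maxr.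
move=> k; have [mF Fk] := Foo k; have [mG Gk] := Goo k; split.
  exact: measurableX.
by rewrite product_measure1E// lte_mul_pinfty// ge0_fin_numE.
Qed.

(* The library registers a sigma-finite structure on [m1 \x m2] only when m1
   and m2 are subprobabilities. *)
Definition prod_sigma_finite : {sigma_finite_measure set (T1 * T2)%type -> \bar R} :=
  HB.pack (m1 \x m2)%E
    (Measure_isSigmaFinite.Build _ _ _ (m1 \x m2)%E sigma_finite_prod).

End ProductSigmaFinite.

(** * Extension of the Weyl kernel to L^2 *)

Section WeylKernelL2.
Local Open Scope complex_scope.
Context {R : realType} {n : nat}.
Implicit Types (phi psi K L : R2n R n -> R[i]) (k l : Zn n).

Local Notation nrm2 := (nrm leb2 [set: R2n R n]).

Lemma inL2_weyl phi : inL1 leb2 setT phi -> inL2 leb2 setT phi ->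
  inL2 leb2 setT (weyl_kernel_L1L2 phi).
Proof.
move=> phi1 phi2; split; first by apply: cmeas_weyl; exact: (proj1 phi1).
by rewrite weyl_isometry//; exact: (proj2 phi2).
Qed.

Lemma nrm_weyl phi : inL1 leb2 setT phi -> inL2 leb2 setT phi ->
  nrm2 (weyl_kernel_L1L2 phi) = nrm2 phi.
Proof. by move=> phi1 phi2; rewrite /nrm weyl_isometry. Qed.

Lemma inL12_combo c phi psi :
  inL1 leb2 setT phi /\ inL2 leb2 setT phi -> inL1 leb2 setT psi /\ inL2 leb2 setT psi ->
  inL1 leb2 setT (fun x => c * phi x + psi x) /\ inL2 leb2 setT (fun x => c * phi x + psi x).
Proof.
by move=> [p1 p2] [q1 q2]; split; [apply: inL1D|apply: inL2D] => //; [exact: inL1Z|exact: inL2Z].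
Qed.

(** Linearity of the kernel is known up to norm zero, so the isometry is applied to phi - psi and
    its kernel is then compared with the difference of the kernels. *)
Lemma nrm_weylB phi psi : inL1 leb2 setT phi /\ inL2 leb2 setT phi ->
  inL1 leb2 setT psi /\ inL2 leb2 setT psi ->
  nrm2 (fun p => weyl_kernel_L1L2 phi p - weyl_kernel_L1L2 psi p) =
  nrm2 (fun x => phi x - psi x).
Proof.
move=> [p1 p2] [q1 q2].
have [d1 d2] := inL12_combo (-1) (conj q1 q2) (conj p1 p2).
have KdL := inL2_weyl d1 d2.
have KL := inL2B measurableT (inL2_weyl p1 p2) (inL2_weyl q1 q2).
have := nrm_null (weyl_linear (-1) q1 p1).
rewrite (_ : (fun p => _ - _) = (fun p => weyl_kernel_L1L2 (fun x => -1 * psi x + phi x) p -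
    (weyl_kernel_L1L2 phi p - weyl_kernel_L1L2 psi p))); last first.
  by apply/funext => p; congr (_ - _); rewrite mulN1r addrC.
move=> n0; have := nrm_dist measurableT KdL KL; rewrite n0 normr_le0 subr_eq0 => /eqP <-.
rewrite nrm_weyl//; congr nrm; apply/funext => x.
by rewrite mulN1r addrC.
Qed.

Lemma is_weyl_kernel_exists phi : inL2 leb2 setT phi -> exists K, is_weyl_kernel phi K.
Proof.
move=> phiL.
have [phi_ [p12 pc]] := @L1L2_approx _ (R2n R n) R (prod_sigma_finite (leb n) (leb n)) phi phiL.
have KL j := inL2_weyl (proj1 (p12 j)) (proj2 (p12 j)).
have [|K KLL Kc] := @L2_complete _ _ _ leb2 setT measurableT (fun j => weyl_kernel_L1L2 (phi_ j)) KL.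
  move=> e e0.
  have [N HN] := L2converges_cauchy measurableT (fun j => proj2 (p12 j)) phiL pc e0.
  by exists N => i j Ni Nj; rewrite nrm_weylB//; exact: HN.
by exists K; split => //; exists phi_.
Qed.

Lemma weyl_kernelP phi : inL2 leb2 setT phi -> is_weyl_kernel phi (weyl_kernel phi).
Proof. by move=> /is_weyl_kernel_exists[K HK]; exact: (@xgetI _ (fun=> 0) [set K | is_weyl_kernel phi K] K). Qed.

(** The isometry passes to the limit for every representative K and every approximating sequence;
    this is what dispenses with comparing representatives. *)
Lemma is_weyl_kernel_nrm phi K : inL2 leb2 setT phi -> is_weyl_kernel phi K ->
  nrm2 K = nrm2 phi.
Proof.
move=> phiL [KL [phi_ [p12 pc Kc]]].
have c1 : nrm2 (phi_ j) @[j --> \oo] --> nrm2 phi.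
  by apply: (L2converges_nrm measurableT _ phiL pc) => j; exact: (proj2 (p12 j)).
have c2 : nrm2 (weyl_kernel_L1L2 (phi_ j)) @[j --> \oo] --> nrm2 K.
  by apply: (L2converges_nrm measurableT _ KL Kc) => j; have [] := p12 j; exact: inL2_weyl.
have E : (fun j => nrm2 (weyl_kernel_L1L2 (phi_ j))) = (fun j => nrm2 (phi_ j)).
  by apply/funext => j; rewrite nrm_weyl//; have [] := p12 j.
by rewrite E in c2; rewrite -(cvg_lim _ c2)// -(cvg_lim _ c1).
Qed.

Lemma is_weyl_kernel_combo c phi psi K L :
  inL2 leb2 setT phi -> inL2 leb2 setT psi ->
  is_weyl_kernel phi K -> is_weyl_kernel psi L ->
  is_weyl_kernel (fun x => c * phi x + psi x) (fun p => c * K p + L p).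
Proof.
move=> phiL psiL [KL [phi_ [p12 pc Kc]]] [LL [psi_ [q12 qc Lc]]].
have cKL := inL2D measurableT (inL2Z measurableT c KL) LL.
split => //; exists (fun j x => c * phi_ j x + psi_ j x).
have d12 j := inL12_combo c (p12 j) (q12 j); split => //.
  apply: (L2convergesD measurableT) => //.
  - by move=> j; apply: inL2Z => //; exact: (proj2 (p12 j)).
  - exact: inL2Z.
  - by move=> j; exact: (proj2 (q12 j)).
  - by apply: (L2convergesZ measurableT) => // j; exact: (proj2 (p12 j)).
have KjL j := inL2_weyl (proj1 (p12 j)) (proj2 (p12 j)).
have LjL j := inL2_weyl (proj1 (q12 j)) (proj2 (q12 j)).
apply: (L2converges_null measurableT _ (f_ := fun j => weyl_kernel_L1L2 (fun x => c * phi_ j x + psi_ j x))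
   (g_ := fun j p => c * weyl_kernel_L1L2 (phi_ j) p + weyl_kernel_L1L2 (psi_ j) p)).
- by move=> j; have [] := d12 j; exact: inL2_weyl.
- by move=> j; apply: inL2D => //; exact: inL2Z.
- exact: cKL.
- by move=> j; apply: weyl_linear; [exact: (proj1 (p12 j))|exact: (proj1 (q12 j))].
- apply: (L2convergesD measurableT) => //.
  + by move=> j; apply: inL2Z.
  + exact: inL2Z.
  + exact: (@L2convergesZ _ _ _ leb2 setT measurableT _ _ _ c _ _ KjL KL Kc).
Qed.

Lemma is_weyl_kernel0 : @is_weyl_kernel R n (fun=> 0) (fun=> 0).
Proof.
have z2 := @inL2_0 _ _ _ (@leb2 R n) setT; have z1 := @inL1_0 _ _ _ (@leb2 R n) setT.
have cz : L2converges (@leb2 R n) setT \oo (fun _ _ => 0) (fun=> 0).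
  rewrite /L2converges (_ : (fun j => _) = fun=> 0%E); first exact: cvg_cst.
  by apply/funext => j; rewrite -[RHS](@L2sqnorm0 _ _ _ (@leb2 R n) setT);
    apply: eq_L2sqnorm => x _; rewrite subr0.
split => //; exists (fun _ _ => 0); split => //.
rewrite (_ : (fun j => _) = (fun _ _ => 0))//.
apply/funext => j; apply/funext => p; rewrite /weyl_kernel_L1L2.
by under eq_cintegral do rewrite mul0r; rewrite cintegral0.
Qed.

Lemma is_weyl_kernel_twisted k l phi K : inL2 leb2 setT phi -> is_weyl_kernel phi K ->
  is_weyl_kernel (twisted_translation k l phi) (kernel_translation k l K).
Proof.
move=> phiL [KL [phi_ [p12 pc Kc]]].
have KjL j := inL2_weyl (proj1 (p12 j)) (proj2 (p12 j)).
split; first exact: inL2_kernel_translation.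
exists (fun j => twisted_translation k l (phi_ j)); split.
- by move=> j; have [p1 p2] := p12 j; split; [exact: inL1_twisted|exact: inL2_twisted].
- apply: L2converges_eqnorm pc => j; rewrite -[RHS](L2sqnorm_twisted k l); last first.
    by apply: cmeasB; [exact: (proj1 (proj1 (p12 j)))|exact: (proj1 phiL)].
  by apply: eq_L2sqnorm => p _; rewrite -mulrBr.
apply: (L2converges_null measurableT _ (f_ := fun j => weyl_kernel_L1L2 (twisted_translation k l (phi_ j)))
   (g_ := fun j => kernel_translation k l (weyl_kernel_L1L2 (phi_ j)))).
- move=> j; have [p1 p2] := p12 j; apply: inL2_weyl; [exact: inL1_twisted|exact: inL2_twisted].
- by move=> j; exact: inL2_kernel_translation.
- exact: inL2_kernel_translation.
- by move=> j; apply: weyl_twisted; have [] := p12 j.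
- apply: L2converges_eqnorm Kc => j; rewrite -[RHS](L2sqnorm_kernel_translation k l); last first.
    by apply: cmeasB; [exact: (proj1 (KjL j))|exact: (proj1 KL)].
  by apply: eq_L2sqnorm => p _; rewrite -!mulrBr.
Qed.

(** The kernel chosen for a combination need not be the combination of the chosen kernels, but the
    latter is one of its representatives, hence has the right norm. *)
Lemma is_weyl_kernel_span (s : seq (R[i] * (Zn n * Zn n))) phi K :
  inL2 leb2 setT phi -> is_weyl_kernel phi K ->
  is_weyl_kernel (fun x => \sum_(p <- s) p.1 * twisted_translation p.2.1 p.2.2 phi x)
    (fun x => \sum_(p <- s) p.1 * kernel_translation p.2.1 p.2.2 K x).
Proof.
move=> phiL HK; elim: s => [|p s IH].
  rewrite (_ : (fun x => _) = fun=> 0); last by apply/funext => x; rewrite big_nil.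
  rewrite [X in is_weyl_kernel _ X](_ : _ = fun=> 0); first exact: is_weyl_kernel0.
  by apply/funext => x; rewrite big_nil.
rewrite (_ : (fun x => _) = (fun x => p.1 * twisted_translation p.2.1 p.2.2 phi x +
   \sum_(p <- s) p.1 * twisted_translation p.2.1 p.2.2 phi x)); last first.
  by apply/funext => x; rewrite big_cons.
rewrite [X in is_weyl_kernel _ X](_ : _ = (fun x => p.1 * kernel_translation p.2.1 p.2.2 K x +
   \sum_(p <- s) p.1 * kernel_translation p.2.1 p.2.2 K x)); last first.
  by apply/funext => x; rewrite big_cons.
apply: is_weyl_kernel_combo => //.
- exact: inL2_twisted.
- by apply: inL2_sum => // q; apply: inL2Z => //; exact: inL2_twisted.
- exact: is_weyl_kernel_twisted.
Qed.

Lemma inL2_span (s : seq (R[i] * (Zn n * Zn n))) phi : inL2 leb2 setT phi ->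
  inL2 leb2 setT (fun x => \sum_(p <- s) p.1 * twisted_translation p.2.1 p.2.2 phi x).
Proof.
by move=> phiL; apply: inL2_sum => // q; apply: inL2Z => //; exact: inL2_twisted.
Qed.

End WeylKernelL2.

(** * The Zak transform *)

Lemma big_fset_sub (I : choiceType) (V : nmodType) (f : I -> V) (F A : {fset I}) :
  (F `<=` A)%fset ->
  \sum_(i <- A) f i = \sum_(i <- F) f i + \sum_(i <- [seq i <- A | i \notin F]) f i.
Proof.
move=> FA; rewrite (bigID (mem F)) /= -[in LHS]big_filter; congr (_ + _).
  apply: perm_big; apply: uniq_perm; rewrite ?filter_uniq ?fset_uniq// => i.
  by rewrite mem_filter; apply: andb_idr => /(fsubsetP FA).
by rewrite big_filter.
Qed.

Lemma esum_fset_cvg (R : realType) (I : choiceType) (a : I -> R) (c : R) :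
  (forall i, 0 <= a i) -> \esum_(i in [set: I]) (a i)%:E = c%:E ->
  (forall A : {fset I}, \sum_(i <- A) a i <= c) /\
  (forall e, 0 < e -> exists F : {fset I}, c - e < \sum_(i <- F) a i).
Proof.
move=> a0 ac.
have sumE (A : {fset I}) : (\sum_(i \in [set` A]) (a i)%:E)%E = (\sum_(i <- A) a i)%:E.
  by rewrite fsbig_finite//= set_fsetK sumEFin.
split=> [A|e e0].
  rewrite -lee_fin -sumE -ac; apply: ereal_sup_ubound.
  by exists [set` A] => //; split.
have : ereal_sup [set (\sum_(i \in A) (a i)%:E)%E | A in fsets [set: I]] \is a fin_num.
  by rewrite -[X in X \is a _]/(\esum_(i in [set: I]) (a i)%:E) ac.
move=> /(ub_ereal_sup_adherent e0)[_ [A [fA _] <-]].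
rewrite -[X in (X - _)%E]/(\esum_(i in [set: I]) (a i)%:E) ac.
by rewrite fsbig_finite//= sumEFin -EFinB lte_fin => h; exists (fset_set A).
Qed.

#[local] Existing Instance totally_filter.

Section NetComplete.
Context d (T : measurableType d) {R : realType} {I : choiceType}.
Variables (mu : {measure set T -> \bar R}) (D : set T).
Hypothesis mD : measurable D.

(** Reduction to sequences: the sets X j = G 0 u ... u G j increase, and every finite set containing
    X j gives a sum within 2 / (j + 1) of that over X j. *)
Lemma L2_complete_totally (S : {fset I} -> T -> R[i]) : (forall A, inL2 mu D (S A)) ->
  (forall e, 0 < e -> exists F : {fset I}, forall A, (F `<=` A)%fset ->
     nrm mu D (fun x => S A x - S F x) < e) ->
  exists2 f, inL2 mu D f & L2converges mu D totally S f.
Proof.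
move=> SL cS.
have /choice[G HG] : forall j, exists F : {fset I}, forall A, (F `<=` A)%fset ->
     nrm mu D (fun x => S A x - S F x) < j.+1%:R^-1.
  by move=> j; apply: cS; rewrite invr_gt0.
pose X j := iteri j.+1 (fun i A => (A `|` G i)%fset) fset0.
have XS j : X j.+1 = (X j `|` G j.+1)%fset by [].
have GX j : (G j `<=` X j)%fset by case: j => [|j]; exact: fsubsetUr.
have XX i j : (i <= j)%N -> (X i `<=` X j)%fset.
  move=> /subnKC <-; elim: (j - i)%N => [|m IH]; first by rewrite addn0.
  by rewrite addnS XS; apply: fsubset_trans IH _; exact: fsubsetUl.
have HX j A : (X j `<=` A)%fset -> nrm mu D (fun x => S A x - S (X j) x) < j.+1%:R^-1 + j.+1%:R^-1.
  move=> XA; apply: le_lt_trans (nrm_dist3 mD (SL A) (SL (G j)) (SL (X j))) _.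
  apply: ltrD; first by apply: HG; exact: fsubset_trans (GX j) XA.
  by rewrite nrm_distC; apply: HG.
have small e : 0 < e -> exists j, j.+1%:R^-1 < e :> R.
  move=> e0; exists (Num.truncn e^-1).
  by rewrite invf_plt ?posrE//; exact: truncnS_gt.
have [|f fL cf] := @L2_complete _ _ _ mu D mD (fun j => S (X j)) (fun j => SL (X j)).
  move=> e e0; have [N HN] := small (e / 4) (divr_gt0 e0 (ltr0n _ 4)).
  exists N => i j Ni Nj.
  apply: le_lt_trans (nrm_dist3 mD (SL (X i)) (SL (X N)) (SL (X j))) _.
  rewrite [X in _ + X]nrm_distC.
  have hi := HX N _ (XX _ _ Ni); have hj := HX N _ (XX _ _ Nj).
  apply: lt_trans (ltrD hi hj) _; move: HN; set t := _^-1; lra.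
exists f => //; apply/(L2converges_nrmP mD SL fL) => e e0.
move/(L2converges_nrmP mD (fun j => SL (X j)) fL): cf => cf.
have [N HN] := small (e / 4) (divr_gt0 e0 (ltr0n _ 4)).
have [M _ HM] := cf _ (divr_gt0 e0 (ltr0n _ 2)).
exists (X (maxn N M)) => // A /= XA.
apply: le_lt_trans (nrm_dist3 mD (SL A) (SL (X (maxn N M))) fL) _.
have h1 := HX _ _ XA.
have h2 : nrm mu D (fun x => S (X (maxn N M)) x - f x) < e / 2 by apply: HM; exact: leq_maxr.
have h3 : (maxn N M).+1%:R^-1 <= N.+1%:R^-1 :> R.
  by rewrite lef_pV2 ?posrE ?ltr0n// ler_nat ltnS leq_maxl.
apply: lt_le_trans (ltrD h1 h2) _; move: h3 HN.
set t := _^-1; set u := _^-1 => h3 HN; lra.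
Qed.

End NetComplete.

Section Zak.
Local Open Scope complex_scope.
Context {R : realType} {n : nat}.
Implicit Types (K L : R2n R n -> R[i]) (Z : R3n R n -> R[i]) (k l m : Zn n).

Definition D3 : set (R3n R n) := cube `*` cube `*` setT.

Lemma meas_D3 : measurable D3.
Proof. by apply: measurableX => //; exact: meas_cube2. Qed.

Let mD3 := meas_D3.
Let mcube := @meas_cube R n.
Let mcube2 := @meas_cube2 R n.

Definition zak_sum K (s : seq (Zn n)) (q : R3n R n) : R[i] :=
  \sum_(m <- s) K (radd (Zn_to_Rn m) q.1.1, q.2) * expi (- (2 * pi * rdot (Zn_to_Rn m) q.1.2)).

(** [is_weyl_zak] with the chosen kernel replaced by an arbitrary K, so that it can be applied to
    any representative of a kernel. *)
Definition is_zak K Z := inL2 leb3 D3 Z /\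
  L2converges leb3 D3 totally (fun F : {fset Zn n} => zak_sum K F) Z.

Lemma is_weyl_zakE phi : is_weyl_zak phi = is_zak (weyl_kernel phi).
Proof.
apply/funext => Z; rewrite /is_weyl_zak.
rewrite (_ : (fun F : {fset Zn n} => _) = (fun F : {fset Zn n} => zak_sum (weyl_kernel phi) F))//.
by apply/funext => F; apply/funext => -[[xi xi'] eta].
Qed.

Lemma expiN_zchar m (x : Rn R n) : expi (- (2 * pi * rdot (Zn_to_Rn m) x)) = zchar (- m) x.
Proof. by rewrite /zchar (rdotC (Zn_to_Rn (- m))) rdotNr mulrN rdotC. Qed.

Lemma cmeas_zak_term K m : cmeasurable_fun setT K ->
  cmeasurable_fun setT (fun q : R3n R n => K (radd (Zn_to_Rn m) q.1.1, q.2)).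
Proof.
move=> mK; apply: (cmeas_comp mK); apply: measurable_fun_pair => //.
by apply: meas_radd => //; exact: measurableT_comp.
Qed.

Lemma cmeas_zak_sum K s : cmeasurable_fun setT K -> cmeasurable_fun setT (zak_sum K s).
Proof.
move=> mK; apply: cmeas_sum => m; apply: cmeasM; first exact: cmeas_zak_term.
rewrite (_ : (fun q => _) = (fun q : R3n R n => zchar (- m) q.1.2)).
  by apply: (cmeas_comp (cmeas_zchar (- m) setT)); exact: measurableT_comp.
by apply/funext => q; rewrite expiN_zchar.
Qed.

(** The L^2 mass of K on the strip (m + [0,1)^n) x R^n; these strips tile the plane. *)
Definition kernel_mass K m : \bar R :=
  L2sqnorm leb2 (cube `*` setT) (fun p => K (radd (Zn_to_Rn m) p.1, p.2)).

Let mKm K m : cmeasurable_fun setT K ->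
  cmeasurable_fun setT (fun p : R2n R n => K (radd (Zn_to_Rn m) p.1, p.2)).
Proof. by move=> mK; exact: (cmeas_comp mK (meas_radd_pair _)). Qed.

Lemma kernel_massE K m : cmeasurable_fun setT K -> kernel_mass K m =
  (\int[leb n]_eta \int[leb n]_(xi in cube)
     (normc (K (radd (Zn_to_Rn m) xi, eta)) ^+ 2)%:E)%E.
Proof.
move=> mK; rewrite /kernel_mass /L2sqnorm (integral_setX21 _ _ mcube measurableT (emeas_normc2 (mKm m mK)))//.
by move=> p; rewrite lee_fin sqr_ge0.
Qed.

(** For fixed (xi, eta) the sum is a trigonometric polynomial in xi' with coefficient K(m + xi, eta)
    at frequency -m; integrating its square over xi' first removes all cross terms. *)
Lemma zak_sum_mass K s : uniq s -> cmeasurable_fun setT K ->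
  (L2sqnorm leb3 D3 (zak_sum K s) = \sum_(m <- s) kernel_mass K m)%E.
Proof.
move=> us mK; rewrite /L2sqnorm.
pose m2 := prod_sigma_finite (@leb R n) (@leb R n).
have ms := cmeas_zak_sum s mK.
rewrite (integral_setX21 m2 (leb n) mcube2 measurableT (emeas_normc2 ms)); last first.
  by move=> p; rewrite lee_fin sqr_ge0.
under [RHS]eq_bigr do rewrite kernel_massE//.
rewrite -ge0_integral_sum//; first last.
- by move=> m eta _; apply: integral_ge0 => x _; rewrite lee_fin sqr_ge0.
- move=> m; apply: (measurable_integral_fst _ mcube (emeas_normc2 (mKm m mK))).
  by move=> p; rewrite lee_fin sqr_ge0.
apply: eq_integral => eta _.
rewrite -ge0_integral_sum//; first last.
- by move=> m x _; rewrite lee_fin sqr_ge0.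
- move=> m; apply: emeas_normc2; have [h1 h2] := cmeas_slice eta (mKm m mK).
  by split; exact: measurable_funTS.
have mse : cmeasurable_fun setT (fun q : R2n R n => zak_sum K s (q, eta)) by exact: cmeas_slice.
rewrite [LHS](integral_setX12 (leb n) (leb n) mcube mcube (emeas_normc2 mse)); last first.
  by move=> p; rewrite lee_fin sqr_ge0.
apply: eq_integral => xi _.
have := L2sqnorm_trig (s := map (fun m => - m) s) (fun m => K (radd (Zn_to_Rn (- m)) xi, eta)).
rewrite map_inj_uniq; last exact: oppr_inj.
move=> /(_ us); rewrite big_map; under eq_bigr do rewrite opprK.
rewrite sumEFin => <-; apply: eq_L2sqnorm => xi' _; congr normc.
rewrite big_map /zak_sum; apply: eq_bigr => m _ /=.
by rewrite expiN_zchar opprK.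
Qed.

Lemma esum_kernel_mass K : cmeasurable_fun setT K ->
  \esum_(m in [set: Zn n]) kernel_mass K m = L2sqnorm leb2 setT K.
Proof.
move=> mK; rewrite /L2sqnorm.
have K0 p : (0 <= (normc (K p) ^+ 2)%:E)%E by rewrite lee_fin sqr_ge0.
rewrite -setXTT (integral_setX21 (leb n) (leb n) measurableT measurableT (emeas_normc2 mK))//.
under eq_esum do rewrite kernel_massE//.
rewrite -integral_esum//; first last.
- by move=> m eta _; apply: integral_ge0 => x _; rewrite lee_fin sqr_ge0.
- move=> m; apply: (measurable_integral_fst _ mcube (emeas_normc2 (mKm m mK))).
  by move=> p; rewrite lee_fin sqr_ge0.
apply: eq_integral => eta _.
rewrite [RHS]leb_tile//.
exact: (emeas_normc2 (cmeas_slice eta mK)).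
Qed.

Lemma kernel_mass_nrm K : inL2 leb2 setT K ->
  exists a : Zn n -> R, [/\ forall m, 0 <= a m, forall m, kernel_mass K m = (a m)%:E &
    \esum_(m in [set: Zn n]) (a m)%:E = (nrm leb2 setT K ^+ 2)%:E].
Proof.
move=> [mK KL]; have mass0 m : (0 <= kernel_mass K m)%E by exact: L2sqnorm_ge0.
have massf m : kernel_mass K m \is a fin_num.
  rewrite ge0_fin_numE//; apply: le_lt_trans KL.
  rewrite -esum_kernel_mass//; apply: ereal_sup_ubound; exists [set m]; last by rewrite fsbig_set1.
  by split => //; exact: finite_set1.
exists (fun m => fine (kernel_mass K m)); split => [m|m|].
- exact: fine_ge0.
- by rewrite fineK.
- rewrite -(nrm2E (conj mK KL)) -esum_kernel_mass//.
  by apply: eq_esum => m _; rewrite fineK.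
Qed.

Lemma inL2_zak_sum K s : uniq s -> inL2 leb2 setT K -> inL2 leb3 D3 (zak_sum K s).
Proof.
move=> us KL; have [a [a0 aE _]] := kernel_mass_nrm KL; split.
  have [h1 h2] := cmeas_zak_sum s (proj1 KL).
  by split; exact: measurable_funTS.
rewrite zak_sum_mass//; last exact: (proj1 KL).
by under eq_bigr do rewrite aE; rewrite sumEFin ltry.
Qed.

Lemma nrm_zak_sum K s (a : Zn n -> R) : (forall m, kernel_mass K m = (a m)%:E) ->
  uniq s -> inL2 leb2 setT K -> nrm leb3 D3 (zak_sum K s) ^+ 2 = \sum_(m <- s) a m.
Proof.
move=> aE us KL; have := nrm2E (inL2_zak_sum us KL).
rewrite zak_sum_mass//; last exact: (proj1 KL).
by under eq_bigr do rewrite aE; rewrite sumEFin => -[].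
Qed.

(** The difference of two nested partial sums has for squared norm the mass of the strips in
    between, and the masses are summable. *)
Lemma is_zak_exists K : inL2 leb2 setT K -> exists Z, is_zak K Z.
Proof.
move=> KL; have [a [a0 aE asum]] := kernel_mass_nrm KL.
have [ub adh] := esum_fset_cvg a0 asum.
have SL (A : {fset Zn n}) := inL2_zak_sum (fset_uniq A) KL.
have [|Z ZL cZ] := L2_complete_totally mD3 SL; last by exists Z.
move=> e e0; have [F HF] := adh _ (exprn_gt0 2 e0).
exists F => A FA.
rewrite -(ltr_pXn2r (n:=2)) ?nnegrE ?nrm_ge0 ?(ltW e0)//.
rewrite (_ : (fun x => _) = zak_sum K [seq m <- A | m \notin F]); last first.
  by apply/funext => q; rewrite /zak_sum (big_fset_sub _ FA) addrC addrA addNr add0r.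
rewrite (nrm_zak_sum aE)// ?filter_uniq ?fset_uniq//.
have := ub A; rewrite (big_fset_sub _ FA) -lerBrDl => h; apply: le_lt_trans h _.
by rewrite ltrBlDr -ltrBlDl.
Qed.

(** The squared norms of the partial sums tend to that of Z by convergence in L^2, and to that of K
    because they are partial sums of the masses. *)
Lemma is_zak_nrm K Z : inL2 leb2 setT K -> is_zak K Z ->
  nrm leb3 D3 Z = nrm leb2 setT K.
Proof.
move=> KL [ZL cZ]; have [a [a0 aE asum]] := kernel_mass_nrm KL.
have [ub adh] := esum_fset_cvg a0 asum.
have SL (A : {fset Zn n}) := inL2_zak_sum (fset_uniq A) KL.
have c1 : (fun A : {fset Zn n} => nrm leb3 D3 (zak_sum K A)) @ totally --> nrm leb3 D3 Z.
  exact: (L2converges_nrm mD3 SL ZL cZ).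
have c2 : (fun A : {fset Zn n} => nrm leb3 D3 (zak_sum K A) ^+ 2) @ totally --> nrm leb3 D3 Z ^+ 2.
  by rewrite expr2; under eq_fun do rewrite expr2; exact: cvgM.
have c3 : (fun A : {fset Zn n} => nrm leb3 D3 (zak_sum K A) ^+ 2) @ totally --> nrm leb2 setT K ^+ 2.
  apply/cvgrPdist_lt => e e0; have [F HF] := adh _ e0.
  exists F => // A /= FA; rewrite (nrm_zak_sum aE) ?fset_uniq// ger0_norm ?subr_ge0//.
  rewrite ltrBlDr -ltrBlDl; apply: lt_le_trans HF _.
  by rewrite (big_fset_sub _ FA) lerDl sumr_ge0.
have /eqP : nrm leb3 D3 Z ^+ 2 = nrm leb2 setT K ^+ 2.
  by rewrite -(cvg_lim _ c2)// -(cvg_lim _ c3).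
by rewrite eqrXn2 ?nrm_ge0// => /eqP.
Qed.

Lemma is_zak0 : is_zak (fun=> 0) (fun=> 0).
Proof.
split; first exact: inL2_0.
rewrite /L2converges (_ : (fun j => _) = fun=> 0%E); first exact: cvg_cst.
apply/funext => F; rewrite -[RHS](L2sqnorm0 leb3 D3); apply: eq_L2sqnorm => x _.
by rewrite subr0 /zak_sum big1// => m _; rewrite mul0r.
Qed.

Lemma is_zak_combo c K L Z W : inL2 leb2 setT K -> inL2 leb2 setT L ->
  is_zak K Z -> is_zak L W ->
  is_zak (fun p => c * K p + L p) (fun q => c * Z q + W q).
Proof.
move=> KL LL [ZL cZ] [WL cW].
have SK (A : {fset Zn n}) := inL2_zak_sum (fset_uniq A) KL.
have SL (A : {fset Zn n}) := inL2_zak_sum (fset_uniq A) LL.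
split; first by apply: inL2D => //; exact: inL2Z.
rewrite (_ : (fun F : {fset Zn n} => _) =
    (fun (F : {fset Zn n}) q => c * zak_sum K F q + zak_sum L F q)); last first.
  apply/funext => F; apply/funext => q; rewrite mulr_sumr -big_split.
  by apply: eq_bigr => m _; rewrite mulrDl mulrA.
apply: (@L2convergesD _ _ _ leb3 D3 mD3 _ _ _ _ _ _ _ _ _ SL WL _ cW).
- by move=> A; exact: inL2Z.
- exact: inL2Z.
- exact: (@L2convergesZ _ _ _ leb3 D3 mD3 _ _ _ c _ _ SK ZL cZ).
Qed.

Definition zak_factor (kl : Zn n * Zn n) (p : R2n R n) : R[i] :=
  twist_sign kl.1 kl.2 * zchar2 kl p.

Lemma normc_zak_factor kl p : normc (zak_factor kl p) = 1.
Proof. by rewrite Normc.normcM normc_zchar2 normc_expi mulr1. Qed.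

Lemma cmeas_zak_factor kl D : cmeasurable_fun D (zak_factor kl).
Proof. by apply: cmeasZ; exact: cmeas_zchar2. Qed.

(** Translation by l replaces the index m by l + m and releases the character of l in xi'. A partial
    sum over s thus becomes one over l + s, which is harmless for convergence along all finite
    subsets. *)
Lemma zak_sum_kernel_translation k l K s q :
  zak_sum (kernel_translation k l K) s q =
  zak_factor (k, l) q.1 * zak_sum K (map (fun m => l + m) s) q.
Proof.
rewrite /zak_sum big_map mulr_sumr; apply: eq_bigr => m _ /=.
rewrite !expiN_zchar /kernel_translation /zak_factor /zchar2 /=.
rewrite zchar_radd zchar_Zn mul1r raddA -Zn_to_RnD.
rewrite (_ : zchar (- m) q.1.2 = zchar l q.1.2 * zchar (- (l + m)) q.1.2).
  ring.
by rewrite -zcharD opprD addrA subrr add0r.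
Qed.

Lemma is_zak_kernel_translation k l K Z : inL2 leb2 setT K -> is_zak K Z ->
  is_zak (kernel_translation k l K) (fun q => zak_factor (k, l) q.1 * Z q).
Proof.
move=> KL [ZL cZ].
have SL (A : {fset Zn n}) := inL2_zak_sum (fset_uniq A) KL.
have TL := inL2_kernel_translation k l KL.
have TSL (A : {fset Zn n}) := inL2_zak_sum (fset_uniq A) TL.
have fZL : inL2 leb3 D3 (fun q => zak_factor (k, l) q.1 * Z q).
  apply: (@inL2_le _ _ _ leb3 D3 mD3 _ Z) => //.
    apply: cmeasM => //; last exact: (proj1 ZL).
    have [h1 h2] := cmeas_comp (cmeas_zak_factor (k, l) setT) (@measurable_fst _ _ (R2n R n) (Rn R n)).
    by split; exact: measurable_funTS.
  by move=> q _; rewrite Normc.normcM normc_zak_factor mul1r.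
split => //; apply/(L2converges_nrmP mD3 TSL fZL) => e e0.
move/(L2converges_nrmP mD3 SL ZL): cZ => /(_ _ e0)[F _ HF].
(* The set -l + F: if A contains it, then l + A contains F. *)
exists [fset (- l + m)%R | m in F]%fset => // A /= FA.
rewrite (_ : nrm _ _ _ = nrm leb3 D3 (fun q => zak_sum K [fset (l + m)%R | m in A]%fset q - Z q)).
  apply: HF => /=; apply/fsubsetP => m mF; apply/imfsetP; exists (- l + m) => /=.
    by apply: (fsubsetP FA); apply/imfsetP; exists m.
  by rewrite addrA subrr add0r.
congr (Num.sqrt (fine _)); apply: eq_L2sqnorm => q _.
rewrite zak_sum_kernel_translation -mulrBr Normc.normcM normc_zak_factor mul1r.
congr (normc (_ - _)); apply: perm_big; apply: uniq_perm.
- by rewrite map_inj_uniq ?fset_uniq//; exact: addrI.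
- exact: fset_uniq.
- move=> m; apply/mapP/imfsetP => -[x /= xA ->]; by exists x.
Qed.

Lemma is_zak_span (s : seq (R[i] * (Zn n * Zn n))) K Z : inL2 leb2 setT K -> is_zak K Z ->
  is_zak (fun x => \sum_(p <- s) p.1 * kernel_translation p.2.1 p.2.2 K x)
    (fun q => (\sum_(p <- s) p.1 * zak_factor p.2 q.1) * Z q).
Proof.
move=> KL HZ; elim: s => [|p s IH].
  rewrite (_ : (fun x => _) = fun=> 0); last by apply/funext => x; rewrite big_nil.
  rewrite [X in is_zak _ X](_ : _ = fun=> 0); first exact: is_zak0.
  by apply/funext => x; rewrite big_nil mul0r.
rewrite (_ : (fun x => _) = (fun x => p.1 * kernel_translation p.2.1 p.2.2 K x +
   \sum_(p <- s) p.1 * kernel_translation p.2.1 p.2.2 K x)); last first.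
  by apply/funext => x; rewrite big_cons.
rewrite [X in is_zak _ X](_ : _ = (fun q => p.1 * (zak_factor (p.2.1, p.2.2) q.1 * Z q) +
   (\sum_(p <- s) p.1 * zak_factor p.2 q.1) * Z q)); last first.
  by apply/funext => q; rewrite big_cons mulrDl -surjective_pairing mulrA.
apply: is_zak_combo => //.
- exact: inL2_kernel_translation.
- by apply: inL2_sum => // r; apply: inL2Z => //; exact: inL2_kernel_translation.
- exact: is_zak_kernel_translation.
Qed.

End Zak.

(** * From the Zak transform to a weight on the torus *)

Section ZakWeight.
Local Open Scope complex_scope.
Context {R : realType} {n : nat}.
Implicit Types (phi : R2n R n -> R[i]).

Let mD3 := @meas_D3 R n.
Let mcube2 := @meas_cube2 R n.

Lemma weyl_zakP phi : inL2 leb2 setT phi -> is_zak (weyl_kernel phi) (weyl_zak phi).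
Proof.
move=> /weyl_kernelP[KL _]; have [Z HZ] := is_zak_exists KL.
rewrite -is_weyl_zakE; apply: (@xgetI _ (fun=> 0) [set Z | is_weyl_zak phi Z] Z).
by rewrite /= is_weyl_zakE.
Qed.

Lemma nrm_span_zak phi (s : seq (R[i] * (Zn n * Zn n))) : inL2 leb2 setT phi ->
  nrm leb2 setT (fun x => \sum_(p <- s) p.1 * twisted_translation p.2.1 p.2.2 phi x) =
  nrm leb3 D3 (fun q => (\sum_(p <- s) p.1 * zak_factor p.2 q.1) * weyl_zak phi q).
Proof.
move=> phiL; have HK := weyl_kernelP phiL; have HZ := weyl_zakP phiL.
have HKs := is_weyl_kernel_span s phiL HK; have KL := proj1 HK.
rewrite (is_zak_nrm (proj1 HKs) (is_zak_span s KL HZ)).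
by rewrite (is_weyl_kernel_nrm (inL2_span s phiL) HKs).
Qed.

(** w is the integral over eta of |Z|^2. Where that integral is infinite, a null set in the cube,
    [fine] gives 0, which is also the default in [bracket]; hence w agrees with the bracket at every
    point of the cube. Multipliers depending on (xi, xi') only come out of the integral over eta,
    which gives the norm formula. *)
Lemma bracket_weight phi : inL2 leb2 setT phi ->
  exists w : R2n R n -> R, [/\ measurable_fun setT w, forall q, 0 <= w q,
    forall q, cube2 q -> complex.Re (bracket phi phi q) = w q,
    inL2 leb2 cube2 (fun q => (Num.sqrt (w q))%:C) &
    forall s : seq (R[i] * (Zn n * Zn n)),
      nrm leb2 setT (fun x => \sum_(p <- s) p.1 * twisted_translation p.2.1 p.2.2 phi x) =
      nrm leb2 cube2 (fun q => (\sum_(p <- s) p.1 * zak_factor p.2 q) * (Num.sqrt (w q))%:C)].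
Proof.
move=> phiL; have [ZL _] := weyl_zakP phiL; set Z := weyl_zak phi in ZL *.
pose m2 := prod_sigma_finite (@leb R n) (@leb R n).
(* Z is controlled on D3 only; extension by zero makes it, and hence w, measurable everywhere. *)
pose Z' q := if q \in D3 then Z q else 0.
have ZZ' q : D3 q -> Z' q = Z q by move=> Dq; rewrite /Z' mem_set.
have mZ' : cmeasurable_fun setT Z'.
  split.
    rewrite (_ : (fun q => _) = (fun q => Re (Z q)) \_ D3).
      by apply/(measurable_restrictT _ _).1 => //; exact: (proj1 (proj1 ZL)).
    by apply/funext => q; rewrite /Z' /patch; case: ifP.
  rewrite (_ : (fun q => _) = (fun q => Im (Z q)) \_ D3).
    by apply/(measurable_restrictT _ _).1 => //; exact: (proj2 (proj1 ZL)).
  by apply/funext => q; rewrite /Z' /patch; case: ifP.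
pose W q : \bar R := L2sqnorm (leb n) setT (fun eta => Z' (q, eta)).
have Z'0 p : (0 <= (normc (Z' p) ^+ 2)%:E)%E by rewrite lee_fin sqr_ge0.
have mW : measurable_fun setT W.
  exact: (measurable_integral_snd (leb n) measurableT (emeas_normc2 mZ') Z'0).
have W0 q : (0 <= W q)%E by exact: L2sqnorm_ge0.
have intW : (\int[leb2]_(q in cube2) W q)%E = L2sqnorm leb3 D3 Z.
  rewrite -(integral_setX12 m2 (leb n) mcube2 measurableT (emeas_normc2 mZ') Z'0).
  by apply: eq_L2sqnorm => q Dq; rewrite ZZ'.
have Wfin : {ae leb2, forall q, cube2 q -> W q \is a fin_num}.
  apply: integrable_ae => //; apply/integrableP; split; first exact: measurable_funTS.
  under eq_integral do rewrite gee0_abs//.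
  by rewrite intW; exact: (proj2 ZL).
pose w q := fine (W q).
have w0 q : 0 <= w q by exact: fine_ge0.
have mw : measurable_fun setT w by exact: measurableT_comp.
have msw : cmeasurable_fun setT (fun q => (Num.sqrt (w q))%:C).
  split => /=; last exact: measurable_cst.
  by apply: measurableT_comp => //; apply: continuous_measurable_fun; exact: sqrt_continuous.
have normE (g : R2n R n -> R[i]) q :
    normc (g q * (Num.sqrt (w q))%:C) ^+ 2 = normc (g q) ^+ 2 * w q.
  by rewrite Normc.normcM normc_real exprMn real_normK ?num_real// sqr_sqrtr.
have key (g : R2n R n -> R[i]) : cmeasurable_fun setT g ->
    L2sqnorm leb2 cube2 (fun q => g q * (Num.sqrt (w q))%:C) =
    L2sqnorm leb3 D3 (fun q => g q.1 * Z q).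
  move=> mg.
  have mgZ : cmeasurable_fun setT (fun q => g q.1 * Z' q).
    by apply: cmeasM => //; exact: (cmeas_comp mg measurable_fst).
  rewrite [RHS](_ : _ = L2sqnorm leb3 D3 (fun q => g q.1 * Z' q)); last first.
    by apply: eq_L2sqnorm => q Dq; rewrite ZZ'.
  rewrite [RHS](integral_setX12 m2 (leb n) mcube2 measurableT (emeas_normc2 mgZ)); last first.
    by move=> p; rewrite lee_fin sqr_ge0.
  rewrite /L2sqnorm.
  have E q : (\int[leb n]_eta (normc (g q * Z' (q, eta)) ^+ 2)%:E =
      (normc (g q) ^+ 2)%:E * W q)%E.
    rewrite -[LHS]/(L2sqnorm (leb n) setT (fun eta => g q * Z' (q, eta))) L2sqnormZ//.
    have [h1 h2] := mZ'; split; first exact: (measurable_fun_pair2 q h1).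
    exact: (measurable_fun_pair2 q h2).
  under [RHS]eq_integral do rewrite E.
  apply: ge0_ae_eq_integral => //.
  - apply: measurable_funTS; apply: emeas_normc2; exact: cmeasM.
  - apply: emeasurable_funM; first by apply: measurable_funTS; exact: emeas_normc2.
    exact: measurable_funTS.
  - by move=> q _; rewrite lee_fin sqr_ge0.
  - by move=> q _; rewrite mule_ge0// lee_fin sqr_ge0.
  - by apply: filterS Wfin => q /[apply] Wq; rewrite normE EFinM fineK.
exists w; split => //.
- move=> q cq; rewrite /w /W /L2sqnorm /=; congr fine; apply: eq_integral => eta _.
  by rewrite ZZ' ?mul_conjc//; split.
- have [h1 h2] := msw; split; first by split; exact: measurable_funTS.
  rewrite (_ : L2sqnorm _ _ _ = L2sqnorm leb3 D3 Z); first exact: (proj2 ZL).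
  transitivity (L2sqnorm leb2 cube2 (fun q => 1 * (Num.sqrt (w q))%:C)).
    by apply: eq_L2sqnorm => q _; rewrite mul1r.
  rewrite (key (fun=> 1) (cmeas_cst _ _)).
  by apply: eq_L2sqnorm => q _; rewrite mul1r.
- move=> s; rewrite nrm_span_zak// /nrm; congr (Num.sqrt (fine _)).
  apply/esym; apply: (key (fun q => \sum_(p <- s) p.1 * zak_factor p.2 q)).
  by apply: cmeas_sum => p; apply: cmeasZ; exact: cmeas_zak_factor.
Qed.

End ZakWeight.

(** * Biorthogonality and the bracket *)

Lemma conjC_scale_mul (R : realType) (t : R) (z : R[i]) :
  (Num.conj (- (t%:C * z)) * z = (- (t * normc z ^+ 2))%:C)%C.
Proof.
rewrite normc_sqE -[Num.conj _]/(conjc _); case: z => a b.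
by apply: complex_ext; rewrite !ReImE /=; ring.
Qed.

Lemma conjCB (R : realType) (z u : R[i]) : Num.conj (z - u) = conjc z - conjc u.
Proof.
rewrite -[Num.conj _]/(conjc _); case: z u => a b [c d].
by apply: complex_ext; rewrite !ReImE /=; ring.
Qed.

(** * Dual vectors obtained by minimizing a norm *)

Section DualVector.
Local Open Scope complex_scope.
Context d (T : measurableType d) {R : realType} {J : eqType}.
Variables (mu : {measure set T -> \bar R}) (D : set T).
Hypothesis mD : measurable D.
Variables (e : J -> T -> R[i]) (j0 : J).
Hypothesis eL : forall j, inL2 mu D (e j).
Implicit Types (s : seq (R[i] * J)) (c : R[i]) (f g h : T -> R[i]).

Definition combo s : T -> R[i] := fun x => \sum_(p <- s) p.1 * e p.2 x.

(** Read off the formal combination, since the e j need not be independent; the bound by C makes it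
    a bounded functional of the resulting function. *)
Definition combo_coef s : R[i] := \sum_(p <- s) p.1 * (p.2 == j0)%:R.

Definition combo_scale c s : seq (R[i] * J) := [seq (c * p.1, p.2) | p <- s].

Lemma combo_cat c s1 s2 :
  combo (s1 ++ combo_scale c s2) = (fun x => combo s1 x + c * combo s2 x).
Proof.
apply/funext => x; rewrite /combo big_cat big_map mulr_sumr; congr (_ + _).
by apply: eq_bigr => p _; rewrite mulrA.
Qed.

Lemma combo_coef_cat c s1 s2 :
  combo_coef (s1 ++ combo_scale c s2) = combo_coef s1 + c * combo_coef s2.
Proof.
rewrite /combo_coef big_cat big_map mulr_sumr; congr (_ + _).
by apply: eq_bigr => p _; rewrite mulrA.
Qed.

Lemma combo_scaleE c s : combo (combo_scale c s) = (fun x => c * combo s x).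
Proof.
apply/funext => x; rewrite /combo big_map mulr_sumr.
by apply: eq_bigr => p _; rewrite mulrA.
Qed.

Lemma combo_coef_scale c s : combo_coef (combo_scale c s) = c * combo_coef s.
Proof.
rewrite /combo_coef big_map mulr_sumr.
by apply: eq_bigr => p _; rewrite mulrA.
Qed.

Lemma combo1 c j : combo [:: (c, j)] = (fun x => c * e j x).
Proof. by apply/funext => x; rewrite /combo big_seq1. Qed.

Lemma combo_coef1 c j : combo_coef [:: (c, j)] = c * (j == j0)%:R.
Proof. by rewrite /combo_coef big_seq1. Qed.

Lemma inL2_combo s : inL2 mu D (combo s).
Proof. by apply: inL2_sum => // p; exact: inL2Z. Qed.

Lemma nrm_parallelogram f g : inL2 mu D f -> inL2 mu D g ->
  nrm mu D (fun x => f x + g x) ^+ 2 + nrm mu D (fun x => f x - g x) ^+ 2 =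
  2 * nrm mu D f ^+ 2 + 2 * nrm mu D g ^+ 2.
Proof.
move=> fL gL; rewrite nrm2D//.
have cN : (-1 : R)%:C = -1 :> R[i] by rewrite rmorphN1.
have -> : (fun x => f x - g x) = (fun x => f x + (-1 : R)%:C * g x).
  by apply/funext => x; rewrite cN mulN1r.
rewrite nrm2D//; last exact: inL2Z.
rewrite (nrmZ mD)// (L2dotZr mD _ fL gL) (_ : Num.conj _ = -1); last first.
  by rewrite -cN; exact: conjc_real.
rewrite mulN1r ReN normc_real normrN1 mul1r.
set a := nrm mu D f; set b := nrm mu D g; set t := Re _; ring.
Qed.

Variable C : R.
Hypothesis coefC : forall s, normc (combo_coef s) <= C * nrm mu D (combo s).

Let A : set R := [set nrm mu D (combo s) | s in [set s | combo_coef s = 1]].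

Let A_nonempty : A !=set0.
Proof.
exists (nrm mu D (combo [:: (1, j0)])); exists [:: (1, j0)] => //.
by rewrite /= combo_coef1 eqxx mulr1.
Qed.

Let C0 : 0 < C.
Proof.
have := coefC [:: (1, j0)]; rewrite combo_coef1 eqxx mulr1 Normc.normc1 => h.
rewrite ltNge; apply/negP => C0.
have : C * nrm mu D (combo [:: (1, j0)]) <= 0 by rewrite mulr_le0_ge0// nrm_ge0.
by move=> /(le_trans h); rewrite ler10.
Qed.

(** The bound on the coefficient keeps the combinations of coefficient 1 away from 0, so their least
    norm can later be divided by. *)
Let A_lb a : A a -> C^-1 <= a.
Proof.
move=> [s /= s1 <-]; have := coefC s; rewrite s1 Normc.normc1.
by rewrite -ler_pdivrMl// mulr1.
Qed.

Let has_infA : has_inf A.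
Proof. by split; [exact: A_nonempty|exists C^-1 => a /A_lb]. Qed.

Let dist := inf A.

Let dist_gt0 : 0 < dist.
Proof.
apply: (@lt_le_trans _ _ C^-1); first by rewrite invr_gt0.
by apply: lb_le_inf => //; exact: A_nonempty.
Qed.

Let dist_le s : combo_coef s = 1 -> dist <= nrm mu D (combo s).
Proof. by move=> s1; apply: ge_inf; [exact: has_infA.2|exists s]. Qed.

(** The midpoint still has coefficient 1, so its norm is at least [dist]. The parallelogram law then
    leaves at most 4 (dist + eps)^2 - 4 dist^2 = 8 dist eps + 4 eps^2. *)
Let combo_close eps s1 s2 : 0 < eps -> eps <= 1 ->
  combo_coef s1 = 1 -> combo_coef s2 = 1 ->
  nrm mu D (combo s1) < dist + eps -> nrm mu D (combo s2) < dist + eps ->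
  nrm mu D (fun x => combo s1 x - combo s2 x) ^+ 2 < (8 * dist + 4) * eps.
Proof.
move=> e0 e1 c1 c2 n1 n2.
have := nrm_parallelogram (inL2_combo s1) (inL2_combo s2).
have : 2 * dist <= nrm mu D (fun x => combo s1 x + combo s2 x).
  have h : combo_coef (combo_scale 2^-1 (s1 ++ combo_scale 1 s2)) = 1.
    by rewrite combo_coef_scale combo_coef_cat c1 c2 mul1r mulVf// (_ : 1 + 1 = 2%:R)// pnatr_eq0.
  have := dist_le h; rewrite  combo_scaleE combo_cat (nrmZ mD); last first.
    by apply: inL2D => //; [exact: inL2_combo|apply: inL2Z => //; exact: inL2_combo].
  rewrite (_ : normc 2^-1 = 2^-1); last first.
    by rewrite (_ : 2^-1 = (2^-1 : R)%:C) ?normc_real ?ger0_norm// fmorphV rmorph_nat.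
  rewrite (_ : (fun x => combo s1 x + 1 * combo s2 x) = (fun x => combo s1 x + combo s2 x)).
    by rewrite mulrC -ler_pdivrMr// invrK mulrC.
  by apply/funext => x; rewrite mul1r.
have a0 := nrm_ge0 mu D (combo s1); have b0 := nrm_ge0 mu D (combo s2).
move: n1 n2 a0 b0; set a := nrm mu D (combo s1); set b := nrm mu D (combo s2).
set u := nrm _ _ _; set v := nrm _ _ _; move: dist dist_gt0 => dd d0.
move=> n1 n2 a0 b0 h E; nra.
Qed.

(** Minimizing sequences converge to some h of norm [dist], and minimality makes h orthogonal to all
    combinations of coefficient 0, in particular to e j for j <> j0. It remains to normalize: the
    inner product of h with e j0 is dist^2, so h / dist^2 is the dual vector. *)
Lemma dual_vector : exists2 psi, L2closure mu D (cspan e) psi &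
  forall j, L2dot mu D (e j) psi = (j == j0)%:R.
Proof.
have /choice[S HS] : forall i, exists s, combo_coef s = 1 /\
    nrm mu D (combo s) < dist + i.+1%:R^-1.
  move=> i; have i0 : 0 < i.+1%:R^-1 :> R by rewrite invr_gt0.
  have [_ [s /= s1 <-] h] := inf_adherent i0 has_infA.
  by exists s.
have SL i := inL2_combo (S i).
have inv_small (x : R) : 0 < x -> exists N, forall i, (N <= i)%N -> i.+1%:R^-1 < x :> R.
  move=> x0; exists (Num.truncn x^-1) => i Ni.
  rewrite invf_plt ?posrE//; apply: lt_le_trans (truncnS_gt _) _.
  by rewrite ler_nat.
have [|h hL ch] := L2_complete mD SL.
  move=> x x0.
  have y0 : 0 < x ^+ 2 / (8 * dist + 4).
    by rewrite divr_gt0 ?exprn_gt0// addr_gt0 ?mulr_gt0.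
  have [N HN] := inv_small _ y0; exists N => i j Ni Nj.
  rewrite -(ltr_pXn2r (n:=2)) ?nnegrE ?nrm_ge0 ?(ltW x0)//.
  have [si1 sin] := HS i; have [sj1 sjn] := HS j.
  have mon k : (N <= k)%N -> k.+1%:R^-1 <= N.+1%:R^-1 :> R.
    by move=> Nk; rewrite lef_pV2 ?posrE ?ltr0n// ler_nat ltnS.
  apply: (@lt_trans _ _ ((8 * dist + 4) * N.+1%:R^-1)).
    apply: combo_close => //.
    - by rewrite invf_le1 ?ltr0n// ler1n.
    - by apply: lt_le_trans sin _; rewrite lerD2l; exact: mon.
    - by apply: lt_le_trans sjn _; rewrite lerD2l; exact: mon.
  rewrite mulrC -ltr_pdivlMr; last by rewrite addr_gt0 ?mulr_gt0.
  exact: HN.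
move/(L2converges_nrmP mD SL hL): ch => ch.
have near x : 0 < x -> exists s, [/\ combo_coef s = 1, nrm mu D (combo s) < dist + x &
    nrm mu D (fun y => combo s y - h y) < x].
  move=> x0; have [N HN] := inv_small _ x0; have [M _ HM] := ch _ x0.
  have [s1 sn] := HS (maxn N M); exists (S (maxn N M)); split => //.
    by apply: lt_trans sn _; rewrite ltrD2l; apply: HN; exact: leq_maxl.
  by apply: HM; exact: leq_maxr.
have hdist : nrm mu D h <= dist.
  apply/ler_addgt0Pr => x x0; have [s [_ sn sh]] := near _ (divr_gt0 x0 (ltr0n _ 2)).
  have := nrm_dist mD (inL2_combo s) hL => /ler_normlP[k _].
  move: sn sh k; set a := nrm _ _ _; set b := nrm _ _ _; set u := nrm _ _ _; lra.
have hmin c s : combo_coef s = 0 -> dist <= nrm mu D (fun x => h x + c * combo s x).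
  move=> s0; apply/ler_addgt0Pr => x x0; have [t [t1 _ th]] := near _ x0.
  have tc : combo_coef (t ++ combo_scale c s) = 1 by rewrite combo_coef_cat t1 s0 mulr0 addr0.
  have tL := inL2D mD (inL2_combo t) (inL2Z mD c (inL2_combo s)).
  have hsL := inL2D mD hL (inL2Z mD c (inL2_combo s)).
  have := dist_le tc; rewrite combo_cat => k.
  have := nrm_dist mD tL hsL.
  rewrite (_ : (fun y => _ - _) = (fun y => combo t y - h y)); last first.
    by apply/funext => y; rewrite opprD addrACA subrr addr0.
  move=> /ler_normlP[_]; move: th k.
  set a := nrm _ _ _; set b := nrm _ _ _; set u := nrm _ _ _; lra.
(* To be used with y = |<h, s>|^2 and N = ||s||^2: moving h by -t <h, s> s changes the squared norm
   by t^2 y N - 2 t y, which would be negative for y > 0 and t N < 1. The choice t = 1 / (N + 1)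
   achieves the latter. *)
have aux (a b y t N : R) : a <= b -> b <= a + t ^+ 2 * y * N + 2 * - (t * y) ->
    t * N < 1 -> 0 <= y -> 0 < t -> 0 <= N -> y <= 0.
  move=> ab k tN Y0 t0 N0.
  have k1 : 0 <= t ^+ 2 * y * N + 2 * - (t * y) by lra.
  rewrite leNgt; apply/negP => y0; have ty := mulr_gt0 t0 y0.
  have : 0 < (t * y) * (1 - t * N) by rewrite mulr_gt0// subr_gt0.
  by move: k1 ty; rewrite expr2; lra.
have orth s : combo_coef s = 0 -> L2dot mu D h (combo s) = 0.
  move=> s0; have sL := inL2_combo s; set X := L2dot mu D h (combo s).
  pose N := nrm mu D (combo s) ^+ 2; have N0 : 0 <= N by exact: sqr_ge0.
  pose t := (N + 1)^-1; have t0 : 0 < t by rewrite invr_gt0 ltr_wpDl.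
  have := hmin (- (t%:C * X)) s s0.
  rewrite -(ler_pXn2r (n:=2)) ?nnegrE ?nrm_ge0 ?(ltW dist_gt0)//.
  rewrite nrm2D//; last exact: inL2Z.
  rewrite nrmZ// L2dotZr// -/X.
  rewrite conjC_scale_mul.
  rewrite normc_opp Normc.normcM normc_real (ger0_norm (ltW t0)) !exprMn -/N.
  have ReC (a : R) : complex.Re a%:C = a by [].
  rewrite ReC.
  have hd : nrm mu D h ^+ 2 <= dist ^+ 2 by rewrite ler_pXn2r ?nnegrE ?nrm_ge0 ?(ltW dist_gt0).
  move=> k.
  have tN : t * N < 1.
    by rewrite /t mulrC ltr_pdivrMr ?mul1r ?ltrDl// ltr_wpDl.
  have Y0 : 0 <= normc X ^+ 2 by exact: sqr_ge0.
  have : normc X ^+ 2 <= 0.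
    exact: (aux _ _ _ _ _ hd k tN Y0 t0 N0).
  move=> Yle; have /eqP : normc X ^+ 2 = 0 by apply/le_anti; rewrite Yle Y0.
  by rewrite sqrf_eq0 => /eqP /Normc.eq0_normc.
have orth_e j : j != j0 -> L2dot mu D h (e j) = 0.
  move=> jj; have := orth [:: (1, j)]; rewrite combo_coef1 (negbTE jj) mulr0 combo1.
  by rewrite (_ : (fun x => _) = e j); [exact|apply/funext => x; rewrite mul1r].
have he0 : L2dot mu D h (e j0) = (nrm mu D h ^+ 2)%:C.
  rewrite -L2dot_nrm//; apply/eqP; rewrite -subr_eq0; apply/eqP.
  apply: Normc.eq0_normc; apply/le_anti; rewrite normc_ge0 andbT.
  apply/ler_addgt0Pr => x x0; rewrite add0r.
  have y0 : 0 < x / (nrm mu D h + 1) by rewrite divr_gt0// ltr_wpDl ?nrm_ge0.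
  have [s [s1 _ sh]] := near _ y0.
  (* s - e j0 has coefficient 0, so <h, e j0> = <h, s>, and s is close to h. *)
  have := orth (s ++ combo_scale (-1) [:: (1, j0)]).
  rewrite combo_coef_cat combo_coef1 eqxx s1 mulr1 mulN1r subrr combo_cat combo1 => /(_ erefl).
  rewrite (_ : (fun x => _) = (fun x => combo s x - e j0 x)); last first.
    by apply/funext => y; rewrite mul1r mulN1r.
  have dotBr f g : inL2 mu D f -> inL2 mu D g ->
      L2dot mu D h (fun x => f x - g x) = L2dot mu D h f - L2dot mu D h g.
    move=> fL gL; rewrite (L2dotC mD (inL2B mD fL gL) hL) L2dotBl// (L2dotC mD fL hL) (L2dotC mD gL hL).
    by move: (L2dot mu D f h) (L2dot mu D g h) => z u; exact: conjCB.
  rewrite dotBr//; last exact: inL2_combo.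
  move=> /eqP; rewrite subr_eq0 => /eqP <-.
  rewrite -dotBr//; last exact: inL2_combo.
  have sL := inL2_combo s.
  apply: le_trans (cauchy_schwarz mD hL (inL2B mD sL hL)) _.
  rewrite -[leRHS](@divfK _ (nrm mu D h + 1)); last first.
    by rewrite gt_eqF// ltr_wpDl ?nrm_ge0.
  rewrite mulrC; apply: ler_pM; rewrite ?nrm_ge0//; first exact: ltW.
  by rewrite lerDl.
have nh : nrm mu D h = dist.
  apply/le_anti; rewrite hdist /=.
  have := hmin 0 [::]; rewrite /combo_coef big_nil => /(_ erefl).
  by rewrite (_ : (fun x => _) = h)//; apply/funext => x; rewrite mul0r addr0.
rewrite nh in he0; pose r : R := (dist ^+ 2)^-1.
have r0 : 0 < r by rewrite invr_gt0 exprn_gt0.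
have conjr : Num.conj (r%:C : R[i]) = r%:C by exact: conjc_real.
exists (fun x => r%:C * h x).
  split; first exact: inL2Z.
  move=> eps eps0; have z0 : 0 < Num.sqrt eps / r by rewrite divr_gt0// sqrtr_gt0.
  have [s [_ _ sh]] := near _ z0.
  exists (combo (combo_scale r%:C s)); first by exists (combo_scale r%:C s).
  rewrite combo_scaleE.
  have sL := inL2_combo s; have hsL := inL2B mD hL sL.
  rewrite (_ : (fun x => _) = (fun x => r%:C * (h x - combo s x))); last first.
    by apply/funext => x; rewrite mulrBr.
  rewrite nrm2E; last exact: inL2Z.
  rewrite nrmZ// normc_real (ger0_norm (ltW r0)) lte_fin -[ltRHS]sqr_sqrtr; last exact: ltW.
  rewrite ltr_pXn2r ?nnegrE ?sqrtr_ge0 ?mulr_ge0 ?nrm_ge0 ?(ltW r0)//.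
  by rewrite mulrC -ltr_pdivlMr// nrm_distC.
move=> j; rewrite L2dotZr// conjr (L2dotC mD hL (eL j)).
case: eqVneq => [->|jj].
  rewrite he0 conjc_real.
  by rewrite -rmorphM /r mulVf// expf_neq0// gt_eqF.
rewrite orth_e// (_ : 0^* = 0 :> R[i]) ?mulr0//.
by apply: complex_ext; rewrite ?ReImE /= ?oppr0.
Qed.

End DualVector.

(** At a = 0 the left-hand side is j + 1 and tends to +oo, the value of the extended inverse at 0;
    this handles the zeros of w. *)
Lemma cvg_inve (R : realType) (a : R) : 0 <= a ->
  ((a + j.+1%:R^-1)^-1)%:E @[j --> \oo] --> (a%:E^-1)%E.
Proof.
rewrite le_eqVlt => /predU1P[<-|a0].
  rewrite inve0; under eq_cvg do rewrite add0r invrK.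
  apply/cvgeryP/cvgryPge => A; near=> j.
  apply: (@le_trans _ _ j%:R); last by rewrite ler_nat.
  by near: j; exact: nbhs_infty_ger.
rewrite inver gt_eqF//; apply: cvg_EFin; first by near=> j.
apply: cvgV; first by rewrite gt_eqF.
rewrite -[X in _ --> X]addr0; apply: cvgD; first exact: cvg_cst.
exact: cvg_harmonic.
Unshelve. all: by end_near. Qed.

(** * Trigonometric polynomials in L^2(w) and integrability of 1/w *)

Section WeightedTrig.
Local Open Scope complex_scope.
Context {R : realType} {n : nat}.
Variable w : R2n R n -> R.
Hypotheses (mw : measurable_fun setT w) (w0 : forall q, 0 <= w q).
Hypothesis wL : inL2 leb2 cube2 (fun q => (Num.sqrt (w q))%:C).
Implicit Types (s : seq (R[i] * (Zn n * Zn n))) (f : R2n R n -> R[i]).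

Let mcube2 := @meas_cube2 R n.

Let leb_cube2_lty : (leb2 (cube2 : set (R2n R n)) < +oo)%E.
Proof. by have -> := @leb_cube2 R n; rewrite ltry. Qed.

Local Notation nrmc := (nrm leb2 cube2).
Local Notation coef0 := (combo_coef (0 : Zn n, 0 : Zn n)).
Local Notation trig := (combo (@zak_factor R n)).
Local Notation omega := (fun q => (Num.sqrt (w q))%:C).

Let cmeasS f : cmeasurable_fun setT f -> cmeasurable_fun cube2 f.
Proof. by move=> [f1 f2]; split; exact: measurable_funTS. Qed.

Lemma cmeas_sqrt (v : R2n R n -> R) : measurable_fun setT v ->
  cmeasurable_fun setT (fun q => (Num.sqrt (v q))%:C).
Proof.
move=> mv; split => /=; last exact: measurable_cst.
by apply: measurableT_comp => //; apply: continuous_measurable_fun; exact: sqrt_continuous.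
Qed.

Lemma cube2_inL1_bounded f M : 0 <= M -> cmeasurable_fun setT f ->
  (forall q, normc (f q) <= M) -> inL1 leb2 cube2 f.
Proof.
move=> M0 mf fM; apply: (@inL1_bounded_finite _ _ _ _ _ _ M) => //.
exact: cmeasS.
Qed.

Lemma cube2_inL2_bounded f M : 0 <= M -> cmeasurable_fun setT f ->
  (forall q, normc (f q) <= M) -> inL2 leb2 cube2 f.
Proof.
move=> M0 mf fM; apply: (@inL2_bounded_finite _ _ _ _ _ _ M) => //.
exact: cmeasS.
Qed.

Lemma inL2_cube2_1 : inL2 leb2 cube2 (fun _ : R2n R n => 1 : R[i]).
Proof.
by apply: (@cube2_inL2_bounded _ 1) => // q; rewrite Normc.normc1.
Qed.

Lemma cmeas_trig s D : cmeasurable_fun D (trig s).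
Proof. by apply: cmeas_sum => p; apply: cmeasZ; exact: cmeas_zak_factor. Qed.

Lemma trig_bounded s : exists2 K, 0 <= K & forall q, normc (trig s q) <= K.
Proof. by apply: (cspan_bounded (@normc_zak_factor R n)); exists s. Qed.

Lemma nrm_le f (g : R2n R n -> R[i]) : cmeasurable_fun cube2 f -> inL2 leb2 cube2 g ->
  (forall q, normc (f q) <= normc (g q)) -> nrmc f <= nrmc g.
Proof.
move=> mf gL fg; have fL : inL2 leb2 cube2 f by apply: inL2_le gL _ => // q _; exact: fg.
rewrite -(ler_pXn2r (n:=2)) ?nnegrE ?nrm_ge0// -lee_fin -!nrm2E//.
by apply: le_L2sqnorm => //; exact: (proj1 gL).
Qed.

(** Cauchy-Schwarz against the constant 1, of norm 1 since the torus has mass 1. *)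
Lemma cube2_integral_le_nrm f M : 0 <= M -> cmeasurable_fun setT f ->
  (forall q, normc (f q) <= M) -> normc (cintegral leb2 cube2 f) <= nrmc f.
Proof.
move=> M0 mf fM; have fL := cube2_inL2_bounded M0 mf fM.
have oneL := inL2_cube2_1.
have n1 : nrmc (fun _ : R2n R n => 1) = 1.
  apply: nrm_eq => //; rewrite /L2sqnorm; under eq_integral do rewrite Normc.normc1.
  by rewrite integral_cst// expr1n mul1e; exact: leb_cube2.
have := cauchy_schwarz mcube2 fL oneL; rewrite n1 mulr1.
rewrite /L2dot (_ : (fun x => _) = f)//; apply/funext => q.
by rewrite -[X in _ * X]/((1 : R)%:C)^*%C conjc_real mulr1.
Qed.

(** Turns the formal coefficient into an integral: all characters but the trivial one integrate to
    0, and the sign attached to (0, 0) is 1. *)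
Lemma trig_integral s : cintegral leb2 cube2 (trig s) = coef0 s.
Proof.
have fL (kl : Zn n * Zn n) : inL1 leb2 cube2 (zak_factor kl : R2n R n -> R[i]).
  apply: (@cube2_inL1_bounded _ 1) => //; first exact: cmeas_zak_factor.
  by move=> q; rewrite normc_zak_factor.
rewrite /combo cintegral_sum//; last by move=> p; exact: inL1Z.
apply: eq_bigr => -[c kl] _; rewrite cintegralZ//=; congr (_ * _).
have zL : inL1 leb2 cube2 (zchar2 kl : R2n R n -> R[i]).
  apply: (@cube2_inL1_bounded _ 1) => //; first exact: cmeas_zchar2.
  by move=> q; rewrite normc_zchar2.
rewrite /zak_factor cintegralZ//; case: eqVneq => [->|kl0].
  by rewrite cube2_char_integral0 /twist_sign rdot0r mulr0 expi0 mulr1.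
by rewrite cube2_char_integral// mulr0.
Qed.

Lemma cspan_zchar2_trig f : cspan (@zchar2 R n) f -> exists s, f = trig s.
Proof.
move=> [s ->]; exists [seq (p.1 / twist_sign p.2.1 p.2.2, p.2) | p <- s].
apply/funext => q; rewrite /combo big_map; apply: eq_bigr => p _ /=.
rewrite /zak_factor mulrA divfK//.
by apply/eqP => t0; have := @normc_expi R (pi * rdot (Zn_to_Rn p.2.1) (Zn_to_Rn p.2.2 : Rn R n));
  rewrite -[expi _]/(twist_sign _ _) t0 Normc.normc0 => /eqP; rewrite eq_sym oner_eq0.
Qed.

Section Bound.
Variable C : R.
Hypotheses (C0 : 0 <= C) (coefC : forall s, normc (coef0 s) <= C * nrmc (fun q => trig s q * omega q)).

Lemma bounded_integral_le f M : 0 <= M -> cmeasurable_fun setT f ->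
  (forall q, normc (f q) <= M) ->
  normc (cintegral leb2 cube2 f) <= C * nrmc (fun q => f q * omega q).
Proof.
(* Approximating in the weight 1 + w controls both int (f - p) and the
   L^2(w) norm of f - p. *)
move=> M0 mf fM; pose sigma q : R[i] := (Num.sqrt (1 + w q))%:C.
have msigma : cmeasurable_fun setT sigma by apply: cmeas_sqrt; exact: measurable_funD.
have sigmaE q : normc (sigma q) = Num.sqrt (1 + w q) by rewrite normc_real ger0_norm ?sqrtr_ge0.
have sigma_ge1 q : 1 <= normc (sigma q).
  by rewrite sigmaE -[leLHS]sqrtr1 ler_sqrt ?lerDl// addr_ge0.
have omegaE q : normc (omega q) = Num.sqrt (w q) by rewrite normc_real ger0_norm ?sqrtr_ge0.
have omega_sigma q : normc (omega q) <= normc (sigma q).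
  by rewrite omegaE sigmaE ler_sqrt ?lerDr// addr_ge0.
have oneL := inL2_cube2_1.
have sigmaL : inL2 leb2 cube2 sigma.
  split; first exact: cmeasS.
  rewrite (_ : L2sqnorm _ _ _ = (\int[leb2]_(q in cube2) ((normc (1 : R[i]) ^+ 2)%:E + (normc (omega q) ^+ 2)%:E))%E).
    rewrite ge0_integralD//.
    - by apply: lte_add_pinfty; [exact: (proj2 oneL)|exact: (proj2 wL)].
    - by move=> q _; rewrite lee_fin sqr_ge0.
    - by move=> q _; rewrite lee_fin sqr_ge0.
    - exact: (emeas_normc2 (proj1 wL)).
  apply: eq_integral => q _; rewrite sigmaE omegaE Normc.normc1 !sqr_sqrtr// ?addr_ge0//.
  by rewrite expr1n EFinD.
apply/ler_addgt0Pr => eps eps0.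
have C1 : 0 < 1 + C by rewrite ltr_wpDr.
(* The error enters once through the integral and C times through the weighted norm, hence the
   tolerance eps / (1 + C). *)
have [_ /cspan_zchar2_trig[s ->] pe] := zchar2_dense sigmaL mf fM (divr_gt0 eps0 C1).
have [K K0 sK] := trig_bounded s.
have ms := cmeas_trig s setT.
have md : cmeasurable_fun setT (fun q => f q - trig s q) by exact: cmeasB.
have dM q : normc (f q - trig s q) <= M + K.
  by apply: le_trans (normc_triangle _ _) _; rewrite normc_opp lerD.
have MK0 : 0 <= M + K by rewrite addr_ge0.
have mulL g N : 0 <= N -> cmeasurable_fun setT g -> (forall q, normc (g q) <= N) ->
    inL2 leb2 cube2 (fun q => g q * omega q) /\ inL2 leb2 cube2 (fun q => g q * sigma q).
  move=> N0 mg gN; split.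
    by apply: (proj1 (inL2_bounded_mul mcube2 wL (cmeasS mg) N0 _)) => q _.
  by apply: (proj1 (inL2_bounded_mul mcube2 sigmaL (cmeasS mg) N0 _)) => q _.
have [dwL dsL] := mulL _ _ MK0 md dM.
have [fwL _] := mulL _ _ M0 mf fM.
have [swL _] := mulL _ _ K0 ms sK.
have d1 : nrmc (fun q => f q - trig s q) < eps / (1 + C).
  apply: le_lt_trans pe; apply: nrm_le => //; first exact: cmeasS.
  by move=> q; rewrite Normc.normcM ler_peMr ?normc_ge0.
have d2 : nrmc (fun q => (f q - trig s q) * omega q) < eps / (1 + C).
  apply: le_lt_trans pe; apply: nrm_le => //; first exact: (proj1 dwL).
  by move=> q; rewrite !Normc.normcM ler_wpM2l ?normc_ge0.
have i1 : normc (cintegral leb2 cube2 f) <=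
    normc (cintegral leb2 cube2 (trig s)) + nrmc (fun q => f q - trig s q).
  have fI := cube2_inL1_bounded M0 mf fM; have sI := cube2_inL1_bounded K0 ms sK.
  have := normc_triangle (cintegral leb2 cube2 (trig s)) (cintegral leb2 cube2 (fun q => f q - trig s q)).
  rewrite cintegralB// addrC subrK => h; apply: le_trans h _.
  rewrite lerD2l -cintegralB//.
  exact: (cube2_integral_le_nrm MK0 md dM).
have i2 : nrmc (fun q => trig s q * omega q) <=
    nrmc (fun q => f q * omega q) + nrmc (fun q => (f q - trig s q) * omega q).
  have := nrmB mcube2 fwL dwL.
  rewrite (_ : (fun q => _ - _) = (fun q => trig s q * omega q))//.
  by apply/funext => q; rewrite -mulrBl opprB addrC subrK.
have i3 := coefC s; rewrite -trig_integral in i3.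
apply: le_trans i1 _.
apply: (@le_trans _ _ (C * (nrmc (fun q => f q * omega q) + eps / (1 + C)) + eps / (1 + C))).
  apply: lerD; last exact: ltW.
  apply: le_trans i3 _; rewrite ler_wpM2l//; apply: le_trans i2 _.
  by rewrite lerD2l ltW.
rewrite mulrDr -addrA -[X in _ + (_ + X)]mul1r -mulrDl (addrC C) mulrCA divff ?mulr1//.
by rewrite gt_eqF.
Qed.

Let u j q : R := (w q + j.+1%:R^-1)^-1.

Let u0 j q : 0 <= u j q.
Proof. by rewrite invr_ge0 addr_ge0// invr_ge0. Qed.

Let u_le j q : u j q <= j.+1%:R.
Proof.
rewrite -[leRHS]invrK lef_pV2 ?posrE ?invr_gt0 ?ltr0n ?lerDr//.
by rewrite ltr_wpDl// invr_gt0.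
Qed.

Let mu_ j : measurable_fun setT (u j).
Proof.
apply: (@measurable_comp _ _ _ _ _ _ [set x : R | x != 0] (fun x : R => x^-1)).
- by apply: open_measurable; exact: open_neq.
- by move=> _ [q _ <-] /=; rewrite gt_eqF// ltr_wpDl// invr_gt0.
- apply: subspace_continuous_measurable_fun.
    by apply: open_measurable; exact: open_neq.
  apply: continuous_in_subspaceT => x; rewrite inE /= => x0; exact: inv_continuous.
- exact: measurable_funD.
Qed.

(** Let I be the integral of u = u_j and b the norm of u in L^2(w). The previous bound gives I <= C
    b, while u w <= 1 gives b^2 <= I; hence b <= C and I <= C^2. *)
Let u_int j : (\int[leb2]_(q in cube2) (u j q)%:E <= (C ^+ 2)%:E)%E.
Proof.
pose f q : R[i] := (u j q)%:C.
have mf : cmeasurable_fun setT f by split => //=; exact: measurable_cst.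
have fM q : normc (f q) <= j.+1%:R by rewrite normc_real ger0_norm.
have j0 : 0 <= j.+1%:R :> R by [].
have b := bounded_integral_le j0 mf fM.
have iu : leb2.-integrable cube2 (EFin \o u j).
  exact: (inL1_Re mcube2 (cube2_inL1_bounded j0 mf fM)).
have fin : (\int[leb2]_(q in cube2) (u j q)%:E)%E \is a fin_num by exact: integrable_fin_num.
set I := (\int[leb2]_(q in cube2) (u j q)%:E)%E in fin *.
have I0 : (0 <= I)%E by apply: integral_ge0 => q _; rewrite lee_fin.
have b1 : fine I <= C * nrmc (fun q => f q * omega q).
  apply: le_trans b; apply: le_trans (normRe_le _); exact: ler_norm.
have fwL : inL2 leb2 cube2 (fun q => f q * omega q).
  by apply: (proj1 (inL2_bounded_mul mcube2 wL (cmeasS mf) j0 _)) => q _.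
have b2 : nrmc (fun q => f q * omega q) ^+ 2 <= fine I.
  rewrite -lee_fin -nrm2E// fineK//; apply: ge0_le_integral => //.
  - by move=> q _; rewrite lee_fin sqr_ge0.
  - exact: (emeas_normc2 (proj1 fwL)).
  - by apply/measurable_EFinP; exact: measurable_funTS.
  - move=> q _; rewrite lee_fin Normc.normcM !normc_real !ger0_norm ?sqrtr_ge0//.
    rewrite exprMn sqr_sqrtr// expr2 -mulrA ler_piMr//.
    rewrite mulrC ler_pdivrMr ?mul1r ?lerDl ?invr_ge0//.
    by rewrite ltr_wpDl// invr_gt0.
rewrite -/I -(fineK fin) lee_fin.
move: b1 b2 (nrm_ge0 leb2 cube2 (fun q => f q * omega q)) (fine_ge0 I0).
move: (fine I) (nrmc _) => a b1 h1 h2 h3 h4.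
have h5 : b1 ^+ 2 <= C * b1 by exact: le_trans h2 h1.
have h6 : b1 <= C.
  rewrite leNgt; apply/negP => Cb; have := mulr_gt0 (le_lt_trans C0 Cb) (_ : 0 < b1 - C).
  by rewrite subr_gt0 => /(_ Cb); move: h5; rewrite expr2; lra.
by apply: le_trans h1 _; rewrite expr2 ler_wpM2l.
Qed.

Lemma integral_inv_weight_le : (\int[leb2]_(q in cube2) ((w q)%:E^-1) <= (C ^+ 2)%:E)%E.
Proof.
have mE j : measurable_fun cube2 (fun q => (u j q)%:E).
  by apply/measurable_EFinP; exact: measurable_funTS.
have E0 j q : cube2 q -> (0 <= (u j q)%:E)%E by rewrite lee_fin.
have Eh q : cube2 q -> {homo (fun j => (u j q)%:E) : i j / (i <= j)%N >-> (i <= j)%E}.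
  move=> _ i j ij; rewrite lee_fin lef_pV2 ?posrE ?ltr_wpDl ?invr_gt0//.
  by rewrite lerD2l lef_pV2 ?posrE ?ltr0n// ler_nat ltnS.
rewrite (_ : (\int[_]_(q in _) _)%E = (\int[leb2]_(q in cube2) (limn (fun j => (u j q)%:E)))%E).
  rewrite (monotone_convergence _ mcube2 mE E0 Eh); apply: lime_le.
    apply: ereal_nondecreasing_is_cvgn => i j ij; apply: ge0_le_integral => //.
    - by move=> q; exact: E0.
    - by move=> q cq; exact: Eh.
  by near=> j; exact: u_int.
apply: eq_integral => q _; apply/esym/cvg_lim => //; exact: cvg_inve.
Unshelve. all: by end_near. Qed.

Lemma measurable_inv_weight : measurable_fun cube2 (fun q => ((w q)%:E^-1)%E).
Proof.
apply: (emeasurable_fun_cvg (fun j q => (u j q)%:E)) => [j|q _]; last exact: cvg_inve.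
by apply/measurable_EFinP; exact: measurable_funTS.
Qed.

Lemma integrable_inv_weight : leb2.-integrable cube2 (fun q => ((w q)%:E^-1)%E).
Proof.
apply/integrableP; split; first exact: measurable_inv_weight.
under eq_integral do rewrite gee0_abs ?inve_ge0 ?lee_fin//.
by apply: le_lt_trans integral_inv_weight_le _; rewrite ltry.
Qed.

End Bound.

(** Cauchy-Schwarz for p w^(1/2) and w^(-1/2); the constant is the norm of w^(-1/2). *)
Lemma integrable_inv_weight_bound :
  leb2.-integrable cube2 (fun q => ((w q)%:E^-1)%E) ->
  exists C, forall s, normc (coef0 s) <= C * nrmc (fun q => trig s q * omega q).
Proof.
move=> iw; pose v q : R[i] := ((Num.sqrt (w q))^-1)%:C.
have mv : cmeasurable_fun cube2 v.
  split => /=; last exact: measurable_cst.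
  rewrite (_ : (fun q => _) = Num.sqrt \o (fine \o (fun q => ((w q)%:E^-1)%E))).
    apply: measurableT_comp; first by apply: continuous_measurable_fun; exact: sqrt_continuous.
    by apply: measurableT_comp => //; have /integrableP[] := iw.
  by apply/funext => q /=; rewrite fine_invr sqrtrV.
have vL : inL2 leb2 cube2 v.
  split => //.
  have /integrableP[miw] := iw; apply: le_lt_trans.
  apply: ge0_le_integral => //.
  - by move=> q _; rewrite lee_fin sqr_ge0.
  - exact: emeas_normc2.
  - exact: measurableT_comp.
  - move=> q _; rewrite gee0_abs ?inve_ge0 ?lee_fin//.
    rewrite normc_real ger0_norm ?invr_ge0 ?sqrtr_ge0// exprVn sqr_sqrtr// inver.
    by case: ifPn => [_|]; rewrite ?leey.
exists (nrmc v) => s.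
have ms := cmeas_trig s setT.
have [K K0 sK] := trig_bounded s.
have swL : inL2 leb2 cube2 (fun q => trig s q * omega q).
  by apply: (proj1 (inL2_bounded_mul mcube2 wL (cmeasS ms) K0 _)) => q _.
rewrite -trig_integral mulrC; apply: le_trans (cauchy_schwarz mcube2 swL vL).
rewrite le_eqVlt; apply/orP; left; apply/eqP; congr normc.
apply: ae_eq_cintegral => //.
- exact: cmeasS.
- by apply: cmeasM; [exact: (proj1 swL)|exact: cmeas_conj].
(* Where w = 0 the real inverse in v is 0 and the product omega v is not 1. Integrability of the
   extended inverse confines this to a null set. *)
have := integrable_ae mcube2 iw; apply: filterS => q /[apply].
rewrite inver; case: eqP => // /eqP wq _.
have cv : Num.conj (v q) = v q by exact: conjc_real.
rewrite cv -mulrA /v -rmorphM divff ?rmorph1 ?mulr1//.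
by rewrite sqrtr_eq0 -ltNge lt_neqAle eq_sym wq w0.
Qed.

End WeightedTrig.

Theorem theorem5p2 (R : realType) (n : nat) (phi : R2n R n -> R[i])
  (hphi : inL2 leb2 [set: R2n R n] phi) :
  (exists2 phit : R2n R n -> R[i],
     twisted_shift_invariant_space phi phit & biorthogonal phi phit) <->
  leb2.-integrable (cube `*` cube) (inv_bracket phi).
Proof.
have mcube2 := @meas_cube2 R n.
have [w [mw w0 wE wL nrmE]] := bracket_weight hphi.
pose e (kl : Zn n * Zn n) := twisted_translation kl.1 kl.2 phi.
have eL kl : inL2 leb2 setT (e kl) by exact: inL2_twisted.
have invE : {in cube2, inv_bracket phi =1 (fun q => ((w q)%:E^-1)%E)}.
  by move=> q /set_mem cq; rewrite /inv_bracket wE.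
have comboE s : nrm leb2 setT (combo e s) =
    nrm leb2 cube2 (fun q => combo (@zak_factor R n) s q * (Num.sqrt (w q))%:C%C).
  exact: nrmE.
split=> [[psi [psiL _] bi]|ib].
  apply: (eq_integrable mcube2 (fun q => ((w q)%:E^-1)%E)).
    by move=> q cq; rewrite invE.
  (* The constant is C = ||psi||: by biorthogonality, the coefficient of a combination at (0, 0) is
     its inner product with psi. *)
  apply: (integrable_inv_weight mw w0 wL (nrm_ge0 leb2 setT psi)) => s.
  rewrite -comboE mulrC; apply: le_trans (cauchy_schwarz measurableT (inL2_combo measurableT eL s) psiL).
  rewrite le_eqVlt; apply/orP; left; apply/eqP; congr (Normc.normc _).
  rewrite /combo (L2dot_suml measurableT s (fun p => p.1))//.
  by apply: eq_bigr => p _; rewrite [L2dot _ _ _ _]bi -surjective_pairing.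
have iw : leb2.-integrable cube2 (fun q => ((w q)%:E^-1)%E).
  by apply: (eq_integrable mcube2 (inv_bracket phi)).
have [C HC] := integrable_inv_weight_bound w0 wL iw.
have [|psi psiV bi] := @dual_vector _ _ R _ leb2 setT measurableT e (0, 0) eL C.
  by move=> s; rewrite comboE; exact: HC.
exists psi; first exact: psiV.
by move=> k l; exact: (bi (k, l)).
Qed.
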